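(* Let $D_1,\dots,D_n\subseteq\mathbb{C}$ be regions and let $f$ be a real function of $n$ real variables that continues analytically to a single-valued holomorphic function $f(z_1,\dots,z_n)$ on $D_1\times\cdots\times D_n$. For $j=1,\dots,n$ let $A_j\subset\mathbb{R}$ be a finite set, $\nu_j:A_j\to\mathbb{N}$ a function with positive integer values, and $C_j$ a positively oriented simple closed contour which together with its interior is contained in $D_j$ and whose interior contains $A_j$. Put $\mathbf{A}=A_1\times\cdots\times A_n$ and $H_r(w)=\prod_{a\in A_r}(w-a)^{\nu_r(a)}$ for $r=1,\dots,n$. Then for all real $x_1,\dots,x_n$ with $x_j$ in the interior of $C_j$ for each $j$, the interpolation error $$R(x_1,\dots,x_n):=f(x_1,\dots,x_n)-\sum_{\mathbf{a}\in\mathbf{A}}\ \sum_{\mathbf{k}\in[\mathbf{0},\nu(\mathbf{a})-\mathbf{1}]}t_{\mathbf{a}}^{\mathbf{k}}\,H_{\mathbf{a}}^{\mathbf{k}}(x_1,\dots,x_n),\qquad t_{\mathbf{a}}^{\mathbf{k}}=\partial_{\mathbf{a}}^{\mathbf{k}}f,$$ is given by $$R=\frac{1}{(2\pi i)^n}\int_{C_1}\cdots\int_{C_n}\frac{\prod_{r=1}^nH_r(z_r)-\prod_{r=1}^n\left(H_r(z_r)-H_r(x_r)\right)}{\prod_{r=1}^n(z_r-x_r)H_r(z_r)}\,f(z_1,\dots,z_n)\,dz_1\cdots dz_n.$$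
   Context: For $\mathbf{a}=(a_1,\dots,a_n)\in\mathbf{A}$, $\nu(\mathbf{a}):=(\nu_1(a_1),\dots,\nu_n(a_n))$, and $[\mathbf{0},\nu(\mathbf{a})-\mathbf{1}]$ is the set of $\mathbf{k}=(k_1,\dots,k_n)$ with integers $0\le k_i\le\nu_i(a_i)-1$. $\partial_{\mathbf{a}}^{\mathbf{k}}f$ is the value at $\mathbf{x}=\mathbf{a}$ of $\frac{\partial^{k_1+\cdots+k_n}f}{\partial x_1^{k_1}\cdots\partial x_n^{k_n}}$. For $a_j\in A_j$ and $0\le k_j\le\nu_j(a_j)-1$ let $H_{a_j}(x_j):=\prod_{c\in A_j,\,c\ne a_j}\left(\frac{x_j-c}{a_j-c}\right)^{\nu_j(c)}$, $$H_{a_j}^{k_j}(x_j):=H_{a_j}(x_j)\,\frac{(x_j-a_j)^{k_j}}{k_j!}\sum_{t=0}^{\nu_j(a_j)-k_j-1}\frac{(x_j-a_j)^t}{t!}\,\left.\frac{d^t}{dx_j^t}\left(\frac{1}{H_{a_j}(x_j)}\right)\right|_{x_j=a_j},$$ and $H_{\mathbf{a}}^{\mathbf{k}}(x_1,\dots,x_n):=\prod_{j=1}^nH_{a_j}^{k_j}(x_j)$. (The double sum is the unique polynomial with degree in $x_i$ less than $\sum_{a\in A_i}\nu_i(a)$ for all $i$ whose partial derivatives at every $\mathbf{a}\in\mathbf{A}$ of every order $\mathbf{k}\in[\mathbf{0},\nu(\mathbf{a})-\mathbf{1}]$ coincide with those of $f$.) *)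

(* Defs.v *)
From HB Require Import structures.
From mathcomp Require Import all_boot all_order all_algebra finmap.
From mathcomp Require Import all_classical all_reals all_analysis.
From mathcomp Require Import complex.

Set Implicit Arguments.
Unset Strict Implicit.
Unset Printing Implicit Defensive.

Import Order.TTheory GRing.Theory Num.Theory.
Import numFieldNormedType.Exports.

Local Open Scope classical_set_scope.
Local Open Scope ring_scope.
Local Open Scope complex_scope.

(* The usual topology of the complex plane: R[i] as a normed module over
   itself, with the complex modulus as norm. *)
#[warnings="-redundant-canonical-projection"]
HB.instance Definition _ (R : realType) := NormedModule.copy R[i] R[i]^o.

Section ContourIntegrals.
Context {R : realType}.
Implicit Types (gamma : R -> R[i]).

Definition region (D : set R[i]) : Prop :=
  [/\ D !=set0, open D & connected D].

Definition C1_on (c d : R) (g : R -> R) : Prop :=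
  exists dg : R -> R,
    [/\ {within `[c, d], continuous g},
        {within `[c, d], continuous dg} &
        forall t, t \in `]c, d[ -> is_derive t 1 g (dg t)].

(* Curves are parametrized by [0, 1]; [s] lists the right ends of the
   intervals of a subdivision of [0, 1]. *)
Definition piecewise_C1 gamma : Prop :=
  exists s : seq R,
    [/\ path <%R 0 s, last 0 s = 1 &
        forall i, (i < size s)%N ->
          C1_on (nth 0 (0 :: s) i) (nth 0 s i) (fun t => complex.Re (gamma t)) /\
          C1_on (nth 0 (0 :: s) i) (nth 0 s i) (fun t => complex.Im (gamma t))].

Definition trace gamma : set R[i] := gamma @` `[0, 1].

Definition simple_closed gamma : Prop :=
  gamma 0 = gamma 1 /\ {in `[0, 1[ &, injective gamma}.

(* The interior of a Jordan curve: the points off the curve lying in a bounded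
   component of its complement. *)
Definition inside gamma : set R[i] :=
  [set w | ~ trace gamma w /\
           bounded_set (connected_component (~` trace gamma) w)].

Definition velocity gamma (t : R) : R[i] :=
  derive1 (fun s => complex.Re (gamma s)) t +i*
  derive1 (fun s => complex.Im (gamma s)) t.

(* The velocity is meaningless at the finitely many break points, which are
   negligible for the integral. *)
Definition contour_integral gamma (h : R[i] -> R[i]) : R[i] :=
  let g t := h (gamma t) * velocity gamma t in
  (\int[lebesgue_measure]_(t in `[0, 1]) complex.Re (g t))%R +i*
  (\int[lebesgue_measure]_(t in `[0, 1]) complex.Im (g t))%R.

Definition winding_number gamma w : R[i] :=
  (0 +i* (2 * pi))^-1 * contour_integral gamma (fun z => (z - w)^-1).

Definition positively_oriented gamma : Prop :=
  forall w, inside gamma w -> winding_number gamma w = 1.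

Definition positive_simple_closed_contour gamma : Prop :=
  [/\ piecewise_C1 gamma, simple_closed gamma & positively_oriented gamma].

(* int_{gamma_1} (... (int_{gamma_n} F(z_1, ..., z_n) dz_n) ...) dz_1 *)
Fixpoint iterated_contour_integral (n : nat) :
    ('I_n -> R -> R[i]) -> ('rV[R[i]]_n -> R[i]) -> R[i] :=
  match n with
  | 0 => fun _ F => F 0
  | m.+1 => fun gammas F =>
      contour_integral (gammas ord0) (fun z =>
        iterated_contour_integral (fun j => gammas (lift ord0 j))
          (fun w : 'rV_m => F (row_mx z%:M w : 'rV_(1 + m))))
  end.

Definition box (n : nat) (D : 'I_n -> set R[i]) : set 'rV[R[i]]_n :=
  [set z | forall j, D j (z 0 j)].

Definition holomorphic_on (n : nat) (U : set 'rV[R[i]]_n)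
    (F : 'rV[R[i]]_n -> R[i]) : Prop :=
  forall z, U z -> differentiable F z.

Definition embedC (n : nat) (x : 'rV[R]_n) : 'rV[R[i]]_n :=
  map_mx (real_complex R) x.

Definition analytic_continuation (n : nat) (U : set 'rV[R[i]]_n)
    (f : 'rV[R]_n -> R) (F : 'rV[R[i]]_n -> R[i]) : Prop :=
  holomorphic_on U F /\ forall x, U (embedC x) -> F (embedC x) = (f x)%:C.

End ContourIntegrals.

Section HermiteInterpolation.
Context {R : realType}.

Definition partial (n : nat) (j : 'I_n) (f : 'rV[R]_n -> R) : 'rV[R]_n -> R :=
  fun x => 'D_(delta_mx 0 j) f x.

(* d^(k_1 + ... + k_n) / (dx_1^k_1 ... dx_n^k_n); the rightmost variable is
   differentiated first. *)
Definition mixed_partial (n : nat) (k : 'I_n -> nat) (f : 'rV[R]_n -> R) :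
    'rV[R]_n -> R :=
  foldr (fun j g => iter (k j) (partial j) g) f (enum 'I_n).

Section OneVariable.
Variables (A : {fset R}) (nu : A -> nat).

Definition nodal (w : R[i]) : R[i] :=
  \prod_(a : A) (w - (val a)%:C) ^+ nu a.

Definition hermite_factor (a : A) (x : R) : R :=
  \prod_(c : A | c != a) ((x - val c) / (val a - val c)) ^+ nu c.

Definition hermite_basis (a : A) (k : nat) (x : R) : R :=
  hermite_factor a x * ((x - val a) ^+ k / k`!%:R) *
  \sum_(t < nu a - k)
     (x - val a) ^+ t / t`!%:R *
     derive1n t (fun y => (hermite_factor a y)^-1) (val a).

End OneVariable.

Definition hermite_interpolant (n : nat) (A : 'I_n -> {fset R})
    (nu : forall j, A j -> nat) (f : 'rV[R]_n -> R) (x : 'rV[R]_n) : R :=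
  \sum_(a : {dffun forall j, A j})
    \sum_(k : {dffun forall j, 'I_(nu j (a j))})
      mixed_partial (fun j => k j) f (\row_j val (a j)) *
      \prod_j hermite_basis (nu j) (a j) (k j) (x 0 j).

End HermiteInterpolation.

(* Main.v *)
Require Import Defs.
From HB Require Import structures.
From mathcomp Require Import all_boot all_order all_algebra finmap.
From mathcomp Require Import all_classical all_reals all_analysis.
From mathcomp Require Import complex.
From mathcomp Require Import ring lra zify.

(* The kernel splits. By partial fractions in [z_r],
     (H_r(z_r) - H_r(x_r)) / ((z_r - x_r) H_r(z_r)) =
       sum_(a, k) H_a^k(x_r) k! / (z_r - a)^(k+1),
   so the integrand is [F] times a linear combination of products over [r] of
   the functions [(z_r - p_r)^-(k_r+1)], where [p] is [x] (with [k = 0]) or a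
   node. The iterated integral of each of them is [(2 pi i)^n d^k F(p) / k!] by
   Cauchy's formula in one variable after the other, and this yields [f x]
   minus the interpolant. A Jordan curve is only known to have winding number 1
   about the points of its interior and 0 off [D_j], so Cauchy's formula is the
   homological one, proved by Dixon's argument. *)

Set Implicit Arguments.
Unset Strict Implicit.
Unset Printing Implicit Defensive.

Import Order.TTheory GRing.Theory Num.Theory.
Import numFieldNormedType.Exports.

Local Open Scope classical_set_scope.
Local Open Scope ring_scope.
Local Open Scope complex_scope.
Import Normc.

(** * Complex differentiability *)

(** The velocity of a contour is only bounded and measurable, so limits are moved past an integral
    by means of second-order Taylor bounds that are uniform in the integration variable: a quadratic
    remainder stays quadratic after integration. Such bounds give the derivative of an integral that
    depends on a complex parameter, and the constancy of one that depends on a real parameter. For a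
    general holomorphic integrand they come from Cauchy's estimates, so Cauchy's formula for circles
    comes before Dixon's argument. It is reached through Goursat's theorem on rectangles, since
    holomorphy means here the mere existence of the derivative. In several variables the innermost
    integral is evaluated first, for the whole finite sum at once: the kernels in the outer
    variables act as coefficients, and an evaluated inner integral is a mixed derivative of [F],
    holomorphic in the next variable. The complex derivatives at real points become real partial
    derivatives because [F] agrees with [f] there. *)

Section Modulus.
Context {R : realType}.
Implicit Types (x y z w : R[i]) (f g : R[i] -> R[i]).

(* [le_normcD] and [normcN] are stated on [Rcomplex R]. *)
Lemma ler_normcD x y : normc (x + y) <= normc x + normc y.
Proof. exact: le_normcD. Qed.

Lemma normc_opp x : normc (- x) = normc x.
Proof. exact: normcN. Qed.

Lemma normcBC x y : normc (x - y) = normc (y - x).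
Proof. by rewrite -normc_opp opprB. Qed.

Lemma normc_ge0 x : 0 <= normc x.
Proof. rewrite -lecR; exact: (@normr_ge0 R[i] R[i] x). Qed.

Lemma normc_eq0 x : (normc x == 0) = (x == 0).
Proof. by apply/eqP/eqP => [/eq0_normc//|->]; rewrite normc0. Qed.

Lemma normc_gt0 x : (0 < normc x) = (x != 0).
Proof. by rewrite lt_def normc_eq0 normc_ge0 andbT. Qed.

Lemma normc_real (a : R) : normc a%:C = `|a|.
Proof. by rewrite /normc /= expr0n /= addr0 sqrtr_sqr. Qed.

Lemma normc_nat n : normc (n%:R : R[i]) = n%:R.
Proof. by rewrite -(rmorph_nat (real_complex R)) normc_real ger0_norm. Qed.

Lemma normcX x n : normc (x ^+ n) = normc x ^+ n.
Proof. by elim: n => [|n IHn]; rewrite ?normc1 // !exprS normcM IHn. Qed.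

Lemma normc_div x y : normc (x / y) = normc x / normc y.
Proof. by rewrite normcM normcV. Qed.

Lemma ler_Re_normc x : `|complex.Re x| <= normc x.
Proof. by rewrite -lecR; exact: normc_ge_Re. Qed.

Lemma normc_mulI x : normc ('i * x) = normc x.
Proof. by rewrite normcM [normc 'i]/= expr0n expr1n /= add0r sqrtr1 mul1r. Qed.

Lemma ler_Im_normc x : `|complex.Im x| <= normc x.
Proof.
by rewrite -(normc_mulI x) -normrN -ReiNIm mulrC; exact: ler_Re_normc.
Qed.

Lemma ler_normc_ReIm x : normc x <= `|complex.Re x| + `|complex.Im x|.
Proof.
rewrite [x in normc x]complexE; apply: (le_trans (ler_normcD _ _)).
by rewrite normc_mulI !normc_real.
Qed.

Lemma ler_distc_add x y z : normc (x - z) <= normc (x - y) + normc (y - z).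
Proof. by rewrite -[x - z](subrKA y); exact: ler_normcD. Qed.

Lemma ler_normcB x y : normc (x - y) <= normc x + normc y.
Proof. by rewrite -(normc_opp y); exact: ler_normcD. Qed.

Lemma lerB_normc x y : normc x - normc y <= normc (x - y).
Proof. by rewrite lerBlDr -[x in normc x <= _](subrK y); exact: ler_normcD. Qed.

Lemma complex_eqE (x y : R[i]) :
  complex.Re x = complex.Re y -> complex.Im x = complex.Im y -> x = y.
Proof. by case: x y => [a b] [c d] /= -> ->. Qed.

Lemma cReB x y : complex.Re (x - y) = complex.Re x - complex.Re y.
Proof. by case: x y => [a b] [c d]. Qed.
Lemma cImB x y : complex.Im (x - y) = complex.Im x - complex.Im y.
Proof. by case: x y => [a b] [c d]. Qed.
Lemma cReD x y : complex.Re (x + y) = complex.Re x + complex.Re y.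
Proof. by case: x y => [a b] [c d]. Qed.
Lemma cImD x y : complex.Im (x + y) = complex.Im x + complex.Im y.
Proof. by case: x y => [a b] [c d]. Qed.
Lemma cReM x y : complex.Re (x * y) =
  complex.Re x * complex.Re y - complex.Im x * complex.Im y.
Proof. by case: x y => [a b] [c d]. Qed.
Lemma cImM x y : complex.Im (x * y) =
  complex.Re x * complex.Im y + complex.Im x * complex.Re y.
Proof. by case: x y => [a b] [c d]. Qed.

(* The epsilon-delta forms use the real-valued modulus [normc]; the norm that
   the library puts on [R[i]], hence the radius of a ball, is [R[i]]-valued. *)
Definition ccont f z := forall e : R, 0 < e -> exists2 d : R, 0 < d &
  forall w, normc (w - z) < d -> normc (f w - f z) < e.

Definition cder f z l := forall e : R, 0 < e -> exists2 d : R, 0 < d &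
  forall w, normc (w - z) < d ->
    normc (f w - f z - l * (w - z)) <= e * normc (w - z).

Definition copen (U : set R[i]) := forall z, U z -> exists2 d : R, 0 < d &
  forall w, normc (w - z) < d -> U w.

Definition cball z (r : R) : set R[i] := [set w | normc (w - z) < r].

Lemma copen_cball z r : copen (cball z r).
Proof.
move=> w; rewrite /cball /= => wr; exists (r - normc (w - z)).
  by rewrite subr_gt0.
move=> v vw; apply: le_lt_trans (ler_distc_add _ w _) _; lra.
Qed.

Lemma cball_center z (r : R) : 0 < r -> cball z r z.
Proof. by move=> r0; rewrite /cball /= subrr normc0. Qed.

(** The derivative is taken in the full plane, so for a set that is not open, such as a closed
    rectangle, the values of [f] around it count too. *)
Definition holo (U : set R[i]) f := forall z, U z -> exists l, cder f z l.

Lemma holoW (U V : set R[i]) f : V `<=` U -> holo U f -> holo V f.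
Proof. by move=> VU h z /VU; exact: h. Qed.

Lemma ccont_le f z : ccont f z -> exists2 d : R, 0 < d &
  forall w, normc (w - z) < d -> normc (f w) <= normc (f z) + 1.
Proof.
move=> /(_ 1 ltr01)[d d0 H]; exists d => // w /H /ltW h.
by have := ler_normcD (f w - f z) (f z); rewrite subrK; lra.
Qed.

Lemma cder_cont f z l : cder f z l -> ccont f z.
Proof.
move=> H e e0; have [d d0 Hd] := H 1 ltr01.
have k0 : 0 < normc l + 2 by have := normc_ge0 l; lra.
exists (Num.min d (e / (normc l + 2))).
  by rewrite lt_min d0 /= divr_gt0.
move=> w; rewrite lt_min ltr_pdivlMr // => /andP[/Hd h1 h2].
have := ler_normcD (f w - f z - l * (w - z)) (l * (w - z)).
rewrite subrK normcM => h3.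
have := normc_ge0 (w - z); nra.
Qed.

Lemma cder_uniq f z l1 l2 : cder f z l1 -> cder f z l2 -> l1 = l2.
Proof.
move=> H1 H2; apply/eqP; rewrite -subr_eq0 -normc_eq0; apply: contraT => n0.
have p0 : 0 < normc (l1 - l2) by rewrite lt_def n0 normc_ge0.
(* With a quarter, the two remainders at the common point [z + m] give [normc (l1 - l2) * m <= normc
   (l1 - l2) * m / 2]. *)
have e0 : 0 < normc (l1 - l2) / 4 by rewrite divr_gt0.
have [d d0 h1] := H1 _ e0; have [d' d'0 h2] := H2 _ e0.
pose m := Num.min d d' / 2.
have m0 : 0 < m by rewrite divr_gt0 // lt_min d0.
have /andP[md md'] : (m < d) && (m < d').
  by rewrite -lt_min /m ltr_pdivrMr // ltr_pMr ?ltr1n // lt_min d0.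
have nm : normc (z + m%:C - z) = m by rewrite addrC addKr normc_real gtr0_norm.
have := h1 (z + m%:C); have := h2 (z + m%:C); rewrite nm => /(_ md') a2 /(_ md) a1.
have := ler_normcB (f (z + m%:C) - f z - l2 * (z + m%:C - z))
  (f (z + m%:C) - f z - l1 * (z + m%:C - z)).
have -> : f (z + m%:C) - f z - l2 * (z + m%:C - z) - (f (z + m%:C) - f z - l1 * (z + m%:C - z)) =
  (l1 - l2) * (z + m%:C - z) by ring.
rewrite normcM nm; nra.
Qed.

Lemma cder_local f g z l : (exists2 d : R, 0 < d &
  forall w, normc (w - z) < d -> f w = g w) -> cder f z l -> cder g z l.
Proof.
move=> [d d0 fg] H e e0; have [d' d'0 h] := H _ e0.
exists (Num.min d d') => [|w]; first by rewrite lt_min d0.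
rewrite lt_min => /andP[wd wd']; rewrite -!fg ?subrr ?normc0 //; exact: h.
Qed.

Lemma cder_open (U : set R[i]) f g z l : copen U -> U z ->
  (forall w, U w -> f w = g w) -> cder f z l -> cder g z l.
Proof.
move=> oU Uz fg; apply: cder_local; have [d d0 h] := oU _ Uz.
by exists d => // w /h /fg.
Qed.

Lemma cder_cst (c : R[i]) z : cder (fun=> c) z 0.
Proof.
move=> e e0; exists 1 => // w _.
by rewrite mul0r !subrr normc0 mulr_ge0 ?normc_ge0 // ltW.
Qed.

Lemma cder_id z : cder id z 1.
Proof.
by move=> e e0; exists 1 => // w _; rewrite mul1r subrr normc0 mulr_ge0 ?normc_ge0 // ltW.
Qed.

Lemma cderD f g z l m : cder f z l -> cder g z m ->
  cder (fun w => f w + g w) z (l + m).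
Proof.
move=> hf hg e e0; have e2 : 0 < e / 2 by rewrite divr_gt0.
have [d d0 h1] := hf _ e2; have [d' d'0 h2] := hg _ e2.
exists (Num.min d d') => [|w]; first by rewrite lt_min d0.
rewrite lt_min => /andP[/h1 a1 /h2 a2].
have := ler_normcD (f w - f z - l * (w - z)) (g w - g z - m * (w - z)).
rewrite (_ : _ + _ = f w + g w - (f z + g z) - (l + m) * (w - z)); last by ring.
lra.
Qed.

Lemma cderM f g z l m : cder f z l -> cder g z m ->
  cder (fun w => f w * g w) z (l * g z + f z * m).
Proof.
move=> hf hg e e0.
have [dg dg0 hgc] := ccont_le (cder_cont hg).
(* With [q = e / (2 * K)] the three error terms below add up to [q * (K - 1) * normc (w - z)]. *)
pose K := normc (g z) + normc (f z) + normc l + 2.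
have K0 : 0 < K by have := normc_ge0 (g z); have := normc_ge0 (f z); have := normc_ge0 l;
  rewrite /K; lra.
have e2 : 0 < e / (2 * K) by rewrite divr_gt0 // mulr_gt0.
have [d1 d10 h1] := hf _ e2; have [d2 d20 h2] := hg _ e2.
have [d3 d30 h3] := cder_cont hg e2.
exists (Num.min (Num.min dg d1) (Num.min d2 d3)) => [|w]; first by rewrite !lt_min dg0 d10 d20.
rewrite !lt_min => /andP[/andP[/hgc wg /h1 w1] /andP[/h2 w2 /h3 w3]].
have -> : f w * g w - f z * g z - (l * g z + f z * m) * (w - z) =
  (f w - f z - l * (w - z)) * g w + (f z * (g w - g z - m * (w - z)) + l * (w - z) * (g w - g z))
    by ring.
apply: le_trans (ler_normcD _ _) _.
apply: le_trans (lerD (lexx _) (ler_normcD _ _)) _.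
rewrite !normcM.
set n := normc (w - z) in w1 w2 *.
have n0 : 0 <= n by exact: normc_ge0.
have eK : e / (2 * K) * K = e / 2 by field; rewrite gt_eqF.
have b1 : normc (f w - f z - l * (w - z)) * normc (g w) <= e / (2 * K) * n * (normc (g z) + 1).
  by apply: ler_pM => //; exact: normc_ge0.
have b2 : normc (f z) * normc (g w - g z - m * (w - z)) <= normc (f z) * (e / (2 * K) * n).
  by apply: ler_wpM2l => //; exact: normc_ge0.
have b3 : normc l * n * normc (g w - g z) <= normc l * n * (e / (2 * K)).
  by apply: ler_wpM2l => //; rewrite ?mulr_ge0 ?normc_ge0 // ltW.
have := normc_ge0 (g z); have := normc_ge0 (f z); have := normc_ge0 l => nl nf ng.
set q := e / (2 * K) in eK b1 b2 b3 e2.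
have : q * K * n = q * n * normc (g z) + q * n * normc (f z) + q * n * normc l +
  2 * (q * n) by rewrite /K; ring.
have : 0 <= q * n by rewrite mulr_ge0 // ltW.
rewrite eK; nra.
Qed.

Lemma cder_comp f g z l m : cder g z m -> cder f (g z) l ->
  cder (fun w => f (g w)) z (l * m).
Proof.
move=> hg hf e e0.
pose K := normc m + normc l + 1.
have K0 : 0 < K by have := normc_ge0 m; have := normc_ge0 l; rewrite /K; lra.
(* The cap 1 bounds the increment of [g] by [(normc m + 1) * n]; the two errors then add up to
   [q * K * n <= e / 2 * n]. *)
pose q := Num.min 1 (e / (2 * K)).
have q0 : 0 < q by rewrite lt_min ltr01 divr_gt0 // mulr_gt0.
have [d1 d10 h1] := hf _ q0; have [d2 d20 h2] := hg _ q0.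
have [d3 d30 h3] := cder_cont hg d10.
exists (Num.min d2 d3) => [|w]; first by rewrite !lt_min d20.
rewrite !lt_min => /andP[/h2 w2 /h3 /h1 w1].
have -> : f (g w) - f (g z) - l * m * (w - z) =
  (f (g w) - f (g z) - l * (g w - g z)) + l * (g w - g z - m * (w - z)) by ring.
apply: le_trans (ler_normcD _ _) _; rewrite normcM.
have := ler_normcD (g w - g z - m * (w - z)) (m * (w - z)).
rewrite subrK normcM.
set n := normc (w - z) in w2 *; set G := normc (g w - g z) in w1 * => hG.
have n0 : 0 <= n by exact: normc_ge0.
have q1 : q <= 1 by rewrite ge_min lexx.
have qe : q <= e / (2 * K) by rewrite ge_min lexx orbT.
have eK : e / (2 * K) * K = e / 2 by field; rewrite gt_eqF.
have := normc_ge0 m; have := normc_ge0 l => nl nm.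
have GK : G <= (normc m + 1) * n by nra.
have b1 : q * G <= q * ((normc m + 1) * n) by apply: ler_wpM2l => //; exact: ltW.
have b2 : normc l * normc (g w - g z - m * (w - z)) <= normc l * (q * n) by exact: ler_wpM2l.
have b3 : q * (K * n) <= e / (2 * K) * (K * n) by apply: ler_wpM2r => //; rewrite mulr_ge0 // ltW.
have : q * (K * n) = q * ((normc m + 1) * n) + normc l * (q * n) by rewrite /K; ring.
have bE : e / (2 * K) * (K * n) = e / 2 * n by rewrite mulrA eK.
rewrite bE in b3; nra.
Qed.

Lemma cder_inv z : z != 0 -> cder (fun w => w^-1) z (- z ^- 2).
Proof.
move=> z0 e e0; have nz : 0 < normc z by rewrite normc_gt0.
(* The error is [(w - z) ^ 2 / (w * z ^ 2)]. The first bound gives [normc w > normc z / 2], and the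
   second then absorbs one factor [w - z]. *)
exists (Num.min (normc z / 2) (e * normc z ^+ 3 / 2)) => [|w].
  by rewrite lt_min !divr_gt0 // mulr_gt0 // exprn_gt0.
rewrite lt_min => /andP[w1 w2].
have nw : normc z / 2 < normc w by have := lerB_normc z w; rewrite normcBC; lra.
have w0 : w != 0 by rewrite -normc_gt0; lra.
have -> : w^-1 - z^-1 - - z ^- 2 * (w - z) = (w - z) ^+ 2 / (w * z ^+ 2).
  by field; rewrite z0.
rewrite normc_div normcX normcM normcX ler_pdivrMr; last first.
  by rewrite mulr_gt0 // ?exprn_gt0 // normc_gt0.
have n0 := normc_ge0 (w - z).
set n := normc (w - z) in w1 w2 n0 *; set a := normc z in w1 w2 nw nz *.
rewrite -mulrA mulrCA expr2; apply: ler_wpM2l => //.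
apply: le_trans (ltW w2) _; rewrite -mulrA; apply: ler_wpM2l; first exact: ltW.
by rewrite exprSr mulrC mulrA -mulrAC; apply: ler_wpM2r; rewrite ?sqr_ge0 // mulrC ltW.
Qed.

Lemma eq_cder f g z l m : f =1 g -> l = m -> cder f z l -> cder g z m.
Proof. by move=> /funext -> ->. Qed.

Lemma cderZ (c : R[i]) f z l : cder f z l -> cder (fun w => c * f w) z (c * l).
Proof.
move=> h; apply: eq_cder (cderM (cder_cst c z) h) => //; by rewrite mul0r add0r.
Qed.

Lemma cderB f g z l m : cder f z l -> cder g z m ->
  cder (fun w => f w - g w) z (l - m).
Proof.
move=> hf /(cderZ (-1)) hg; apply: eq_cder (cderD hf hg) => [w|]; by rewrite mulN1r.
Qed.

Lemma cderV f z l : f z != 0 -> cder f z l ->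
  cder (fun w => (f w)^-1) z (- f z ^- 2 * l).
Proof. by move=> fz h; apply: (cder_comp h) (cder_inv fz). Qed.

Lemma cderX f z l n : cder f z l ->
  cder (fun w => f w ^+ n) z (n%:R * f z ^+ n.-1 * l).
Proof.
move=> h; elim: n => [|n IHn]; first by apply: eq_cder (cder_cst 1 z) => //; rewrite !mul0r.
apply: eq_cder (cderM h IHn) => [w|]; first by rewrite exprS.
by case: n {IHn} => [|n] /=; rewrite ?exprS; ring.
Qed.

End Modulus.

(** * Integration along piecewise C1 paths *)

Section RealLine.
Context {R : realType}.
Local Notation mu := (@lebesgue_measure R).
Implicit Types (a b c d e t s : R) (g h : R -> R).

Lemma continuous_within_itvE a b g : {within `[a, b], continuous g} <->
  forall t, t \in `[a, b] -> forall e, 0 < e -> exists2 d, 0 < d &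
    forall s, s \in `[a, b] -> `|s - t| < d -> `|g s - g t| < e.
Proof.
split=> [/subspace_continuousP H t tab e e0|H].
  have /cvgrPdist_lt/(_ e e0) := H t tab.
  rewrite near_withinE => -[d /= d0 hd]; exists d => // s sab st.
  by rewrite distrC; apply: hd => //=; rewrite distrC.
apply/subspace_continuousP => t tab; apply/cvgrPdist_lt => e e0.
have [d d0 hd] := H t tab e e0.
rewrite near_withinE; exists d => //= s st sab.
by rewrite distrC; apply: hd => //; rewrite distrC.
Qed.

Lemma is_deriveE t g (l : R) : is_derive t 1 g l <->
  forall e, 0 < e -> exists2 d, 0 < d &
    forall s, `|s - t| < d -> `|g s - g t - l * (s - t)| <= e * `|s - t|.
Proof.
have E e (h : R) : h != 0 -> (`|l - h^-1 *: (g (h *: 1 + t) - g t)| <= e) =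
    (`|g (t + h) - g t - l * (t + h - t)| <= e * `|t + h - t|).
  move=> h0; rewrite [h *: 1]mulr1 [h^-1 *: _]mulrC [t + h]addrC addrK.
  rewrite -[RHS](ler_pdivrMr) ?normr_gt0 //.
  by rewrite -normfV -normrM [(_ - l * h) / h]mulrBl mulfK // distrC.
split=> [[/= dg Dl] e e0|H].
  move/cvgrPdist_le/(_ e e0): dg => [d /= d0 hd].
  exists d => // s st; have [->|ts] := eqVneq s t.
    by rewrite !subrr mulr0 subr0 normr0 mulr0.
  have n0 : s - t != 0 by rewrite subr_eq0.
  have := hd (s - t); rewrite /= sub0r normrN => /(_ st n0).
  by rewrite -[lim _]/('D_1 g t) Dl E // [t + (s - t)]addrC subrK.
suff C : (fun h : R => h^-1 *: (g (h *: 1 + t) - g t)) @ 0^' --> l.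
  by split; [apply/cvg_ex; exists l | exact: cvg_lim].
apply/cvgrPdist_le => e e0; have [d d0 hd] := H e e0.
rewrite /dnbhs near_withinE; exists d => // h /=.
rewrite sub0r normrN => hd' h0; rewrite E //; apply: hd.
by rewrite addrC addKr.
Qed.

(** Passes from the pieces of a subdivision to the whole interval. It serves for the continuity of a
    path, the bounds on its velocity and the fundamental theorem alike. *)
Lemma path_additive (Q T : R -> R -> Prop) c (s : seq R) :
  path <%R c s ->
  (forall i, (i < size s)%N -> Q (nth 0 (c :: s) i) (nth 0 s i)) ->
  T c c -> (forall a b, a < b -> Q a b -> T a b) ->
  (forall a b c, a <= b <= c -> T a b -> T b c -> T a c) -> T c (last c s).
Proof.
move=> pcs hQ Tcc hT hadd.
suff: c <= last c s /\ T c (last c s) by case.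
have: forall n, (n <= size s)%N ->
    c <= last c (take n s) /\ T c (last c (take n s)).
  elim=> [|n IHn] ns; first by rewrite take0.
  have [cn Tn] := IHn (ltnW ns).
  rewrite (take_nth 0) // last_rcons.
  have E : last c (take n s) = nth 0 (c :: s) n.
    by rewrite (last_nth 0) size_take ns; case: n ns {IHn cn Tn} => //= n ns; rewrite nth_take.
  have lt : nth 0 (c :: s) n < nth 0 s n by move/pathP: pcs => /(_ 0 _ ns).
  rewrite E in cn Tn; split; first exact: le_trans cn (ltW lt).
  apply: (hadd _ (nth 0 (c :: s) n)) => //; first by rewrite cn ltW.
  by apply: hT => //; exact: hQ.
by move=> /(_ _ (leqnn _)); rewrite take_size.
Qed.

Lemma itv_bnd_finite a b : (mu `[a, b] < +oo)%E.
Proof. by rewrite lebesgue_measure_itv /=; case: ifP => // _; rewrite -EFinB ltry. Qed.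

Lemma bounded_integrable a b g : measurable_fun `[a, b] g ->
  (exists M, forall t, t \in `[a, b] -> `|g t| <= M) ->
  mu.-integrable `[a, b] (EFin \o g).
Proof.
move=> mg [M hM]; apply: measurable_bounded_integrable => //.
  exact: itv_bnd_finite.
exists M; split; first exact: num_real.
by move=> y My t /= tab; apply: le_trans (hM _ tab) (ltW My).
Qed.

Lemma within_continuous_measurable a b g :
  {within `[a, b], continuous g} -> measurable_fun `[a, b] g.
Proof. by move=> cg; apply: measurable_realfun.subspace_continuous_measurable_fun. Qed.

Lemma within_continuous_bounded a b g : {within `[a, b], continuous g} ->
  exists M, forall t, t \in `[a, b] -> `|g t| <= M.
Proof.
move=> cg; have /compact_bounded[M [_ mrt]] := continuous_compact cg (@segment_compact _ a b).
exists (M + 1) => t tab; apply: mrt; first by rewrite ltrDl.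
by exists t.
Qed.

Lemma within_continuous_integrable a b g : {within `[a, b], continuous g} ->
  mu.-integrable `[a, b] (EFin \o g).
Proof.
by move=> cg; apply: bounded_integrable;
  [exact: within_continuous_measurable|exact: within_continuous_bounded].
Qed.

(** [derive1 g] agrees with the continuous [dg] in the open interval only; its two end values are
    arbitrary, which spoils neither measurability nor boundedness. *)
Lemma C1_on_derive1 a b g : a < b -> C1_on a b g ->
  measurable_fun `[a, b] (derive1 g) /\
  exists M, forall t, t \in `[a, b] -> `|derive1 g t| <= M.
Proof.
move=> ab [dg [cg cdg hdg]].
have E t : t \in `]a, b[ -> derive1 g t = dg t.
  by move=> tab; have [_ <-] := hdg t tab; rewrite derive1E.
split.
  have m1 : measurable_fun `]a, b[ (derive1 g).
    apply: (@eq_measurable_fun _ _ _ _ _ dg).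
      by move=> t; rewrite inE /= => /E.
    apply: measurable_funS (within_continuous_measurable cdg) => //.
    exact: subset_itv_oo_cc.
  have -> : `[a, b]%classic = [set a] `|` (`]a, b[ `|` [set b]).
      rewrite -(@setU1itv _ _ (BRight b) a false) ?bnd_simp ?(ltW ab) //.
    by rewrite -(@setUitv1 _ _ (BRight a) b true) ?bnd_simp.
  apply/measurable_funU => //; first exact: measurableU.
  split; first exact: measurable_fun_set1.
  apply/measurable_funU => //; split => //; exact: measurable_fun_set1.
have [M hM] := within_continuous_bounded cdg.
exists (Num.max M (Num.max `|derive1 g a| `|derive1 g b|)) => t.
rewrite in_itv /= => /andP[]; rewrite le_eqVlt => /predU1P[<- _|ta].
  by rewrite !le_max lexx orbT.
rewrite le_eqVlt => /predU1P[->|tb]; first by rewrite !le_max lexx !orbT.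
rewrite le_max E ?hM ?in_itv /= ?ta ?tb //; by rewrite !ltW.
Qed.

Lemma Rintegral_itv_cat a b c g : a <= b <= c ->
  mu.-integrable `[a, c] (EFin \o g) ->
  \int[mu]_(t in `[a, c]) g t = \int[mu]_(t in `[a, b]) g t + \int[mu]_(t in `[b, c]) g t.
Proof.
move=> /andP[ab bc] ig.
have := @Rintegral_itvB _ g (BLeft a) (BRight c) b ig.
rewrite !bnd_simp => /(_ ab bc).
rewrite Rintegral_itv_obnd_cbnd; first lra.
apply: integrableS ig => //; apply: subset_itvr.
by rewrite bnd_simp; apply: le_trans ab _.
Qed.

Lemma continuous_FTC2_Rintegral a b g dg : a < b ->
  {within `[a, b], continuous g} -> {within `[a, b], continuous dg} ->
  (forall t, t \in `]a, b[ -> is_derive t 1 g (dg t)) ->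
  \int[mu]_(t in `[a, b]) dg t = g b - g a.
Proof.
move=> ab cg cdg hdg; rewrite /Rintegral.
rewrite (@continuous_FTC2 _ dg g a b ab cdg) //.
  have [_ g1 g2] := (continuous_within_itvP _ ab).1 cg.
  by split => // t tab; have [] := hdg t tab.
by move=> t tab; rewrite derive1E; have [_ ->] := hdg t tab.
Qed.

(** End points are negligible; this lets a velocity with arbitrary end values be replaced by a
    continuous one. *)
Lemma eq_Rintegral_oo a b g h :
  mu.-integrable `[a, b] (EFin \o g) -> mu.-integrable `[a, b] (EFin \o h) ->
  (forall t, t \in `]a, b[ -> g t = h t) ->
  \int[mu]_(t in `[a, b]) g t = \int[mu]_(t in `[a, b]) h t.
Proof.
have K f : mu.-integrable `[a, b] (EFin \o f) ->
    \int[mu]_(t in `[a, b]) f t = \int[mu]_(t in `]a, b[) f t.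
  move=> f1; rewrite Rintegral_itv_bndo_bndc.
    rewrite Rintegral_itv_obnd_cbnd //.
    by apply: integrableS f1 => //; exact: subset_itv_oc_cc.
  by apply: integrableS f1 => //; exact: subset_itv_oo_cc.
move=> ig ih gh; rewrite !K //; apply: eq_Rintegral => t.
by rewrite inE /= => /gh.
Qed.

Lemma normr_Rintegral_le a b g M : a <= b -> measurable_fun `[a, b] g ->
  (forall t, t \in `[a, b] -> `|g t| <= M) ->
  `|\int[mu]_(t in `[a, b]) g t| <= M * (b - a).
Proof.
move=> ab mg hM.
have ig : mu.-integrable `[a, b] (EFin \o g) by apply: bounded_integrable => //; exists M.
apply: le_trans (le_normr_Rintegral _ ig) _ => //.
have -> : M * (b - a) = \int[mu]_(t in `[a, b]) M.
  rewrite Rintegral_cst //= lebesgue_measure_itv /= lte_fin.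
  by move: ab; rewrite le_eqVlt => /predU1P[->|->] //; rewrite ltxx subrr mulr0.
apply: le_Rintegral => //.
  apply: bounded_integrable; first exact: measurableT_comp.
  by exists M => t /hM; rewrite normr_id.
apply: bounded_integrable => //; by exists `|M|.
Qed.

End RealLine.

(** * Integrals of complex functions of a real variable *)

Section ComplexIntegral.
Context {R : realType}.
Local Notation mu := (@lebesgue_measure R).
Implicit Types (a b c d e t s : R) (H K : R -> R[i]).

Definition cwithin a b H :=
  {within `[a, b], continuous (fun t => complex.Re (H t))} /\
  {within `[a, b], continuous (fun t => complex.Im (H t))}.

Definition cint a b H : R[i] :=
  (\int[mu]_(t in `[a, b]) complex.Re (H t)) +i*
  (\int[mu]_(t in `[a, b]) complex.Im (H t)).

Definition cmeasurable a b H :=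
  measurable_fun `[a, b] (fun t => complex.Re (H t)) /\
  measurable_fun `[a, b] (fun t => complex.Im (H t)).

Definition cbounded a b H := exists M, forall t, t \in `[a, b] -> normc (H t) <= M.

Lemma cwithinE a b H : cwithin a b H <->
  forall t, t \in `[a, b] -> forall e, 0 < e -> exists2 d, 0 < d &
    forall s, s \in `[a, b] -> `|s - t| < d -> normc (H s - H t) < e.
Proof.
split=> [[/continuous_within_itvE hr /continuous_within_itvE hi] t tab e e0|h].
  have e2 : 0 < e / 2 by rewrite divr_gt0.
  have [d d0 hd] := hr t tab _ e2; have [d' d'0 hd'] := hi t tab _ e2.
  exists (Num.min d d') => [|s sab]; first by rewrite lt_min d0.
  rewrite lt_min => /andP[/(hd _ sab) h1 /(hd' _ sab) h2].
  apply: le_lt_trans (ler_normc_ReIm _) _; rewrite cReB cImB; lra.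
split; apply/continuous_within_itvE => t tab e e0; have [d d0 hd] := h t tab e e0;
  exists d => // s sab st; have := hd s sab st.
  by apply: le_lt_trans; rewrite -cReB; exact: ler_Re_normc.
by apply: le_lt_trans; rewrite -cImB; exact: ler_Im_normc.
Qed.

Lemma cwithin_cmeasurable a b H : cwithin a b H -> cmeasurable a b H.
Proof. by move=> [? ?]; split; exact: within_continuous_measurable. Qed.

Lemma cwithin_cbounded a b H : cwithin a b H -> cbounded a b H.
Proof.
move=> [/within_continuous_bounded[M hM] /within_continuous_bounded[N hN]].
by exists (M + N) => t tab; apply: le_trans (ler_normc_ReIm _) (lerD (hM _ tab) (hN _ tab)).
Qed.

Lemma cwithin_cst a b (c : R[i]) : cwithin a b (fun=> c).
Proof. by split => x; exact: cvg_cst. Qed.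

Lemma cwithinD a b H K : cwithin a b H -> cwithin a b K -> cwithin a b (fun t => H t + K t).
Proof.
move=> [h1 h2] [k1 k2]; split.
  rewrite (_ : (fun t => _) = (fun t => complex.Re (H t) + complex.Re (K t))).
    by move=> x; exact: (continuousD (h1 x) (k1 x)).
  by apply/funext => t; rewrite cReD.
rewrite (_ : (fun t => _) = (fun t => complex.Im (H t) + complex.Im (K t))).
  by move=> x; exact: (continuousD (h2 x) (k2 x)).
by apply/funext => t; rewrite cImD.
Qed.

Lemma cwithinM a b H K : cwithin a b H -> cwithin a b K -> cwithin a b (fun t => H t * K t).
Proof.
move=> [h1 h2] [k1 k2]; split.
  rewrite (_ :
    (fun t => _) =
    (fun t => complex.Re (H t) * complex.Re (K t) - complex.Im (H t) * complex.Im (K t))).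
    by move=> x; exact: (continuousB (continuousM (h1 x) (k1 x)) (continuousM (h2 x) (k2 x))).
  by apply/funext => t; rewrite cReM.
rewrite (_ :
  (fun t => _) =
  (fun t => complex.Re (H t) * complex.Im (K t) + complex.Im (H t) * complex.Re (K t))).
  by move=> x; exact: (continuousD (continuousM (h1 x) (k2 x)) (continuousM (h2 x) (k1 x))).
by apply/funext => t; rewrite cImM.
Qed.

Lemma cwithin_comp a b (f : R[i] -> R[i]) H :
  (forall t, t \in `[a, b] -> ccont f (H t)) -> cwithin a b H ->
  cwithin a b (fun t => f (H t)).
Proof.
move=> hf /cwithinE hH; apply/cwithinE => t tab e e0.
have [d d0 hd] := hf t tab e e0; have [d' d'0 hd'] := hH t tab d d0.
by exists d' => // s sab /(hd' _ sab) /hd.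
Qed.

Lemma cwithinS a b c d H : a <= c -> d <= b -> cwithin a b H -> cwithin c d H.
Proof.
move=> ac db /cwithinE h; apply/cwithinE => t tcd e e0.
have sub s : s \in `[c, d] -> s \in `[a, b].
  by apply: subitvP; rewrite subitvE !bnd_simp ac db.
have [d' d'0 hd'] := h t (sub _ tcd) e e0.
by exists d' => // s /sub; exact: hd'.
Qed.

Lemma cwithinB a b H K : cwithin a b H -> cwithin a b K -> cwithin a b (fun t => H t - K t).
Proof.
move=> hH hK; rewrite (_ : (fun t => _) = (fun t => H t + (-1) * K t)); last by apply/funext => t;
  rewrite mulN1r.
by apply: cwithinD => //; apply: cwithinM => //; exact: cwithin_cst.
Qed.

Lemma cwithin_V a b H : cwithin a b H -> (forall t, t \in `[a, b] -> H t != 0) ->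
  cwithin a b (fun t => (H t)^-1).
Proof.
move=> h h0; apply: (cwithin_comp (f := fun w => w^-1)) h => t tab.
exact: cder_cont (cder_inv (h0 _ tab)).
Qed.

Lemma cwithinX a b H n : cwithin a b H -> cwithin a b (fun t => H t ^+ n).
Proof.
move=> h; elim: n => [|n IHn]; first exact: cwithin_cst.
rewrite (_ : (fun t => _) = (fun t => H t * H t ^+ n)); first exact: cwithinM.
by apply/funext => t; rewrite exprS.
Qed.

Lemma cmeasurableM a b H K : cmeasurable a b H -> cmeasurable a b K ->
  cmeasurable a b (fun t => H t * K t).
Proof.
move=> [h1 h2] [k1 k2]; split.
  rewrite (_ :
    (fun t => _) =
    (fun t => complex.Re (H t) * complex.Re (K t) - complex.Im (H t) * complex.Im (K t))).
    by apply: measurable_realfun.measurable_funB; apply: measurable_realfun.measurable_funM.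
  by apply/funext => t; rewrite cReM.
rewrite (_ :
  (fun t => _) =
  (fun t => complex.Re (H t) * complex.Im (K t) + complex.Im (H t) * complex.Re (K t))).
  by apply: measurable_realfun.measurable_funD; apply: measurable_realfun.measurable_funM.
by apply/funext => t; rewrite cImM.
Qed.

Lemma cboundedM a b H K : cbounded a b H -> cbounded a b K -> cbounded a b (fun t => H t * K t).
Proof.
move=> [M hM] [N hN]; exists (M * N) => t tab.
by rewrite normcM ler_pM ?normc_ge0 ?hM ?hN.
Qed.

Definition cintegrable a b H :=
  mu.-integrable `[a, b] (EFin \o (fun t => complex.Re (H t))) /\
  mu.-integrable `[a, b] (EFin \o (fun t => complex.Im (H t))).

Lemma cintegrable_cbounded a b H : cmeasurable a b H -> cbounded a b H -> cintegrable a b H.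
Proof.
move=> [mr mi] [M hM]; split; apply: bounded_integrable => //; exists M => t /hM;
  by apply: le_trans; first [exact: ler_Re_normc|exact: ler_Im_normc].
Qed.

Lemma cwithin_integrable a b H : cwithin a b H -> cintegrable a b H.
Proof.
by move=> h; apply: cintegrable_cbounded; [exact: cwithin_cmeasurable|exact: cwithin_cbounded].
Qed.

Lemma cintD a b H K : cintegrable a b H -> cintegrable a b K ->
  cint a b (fun t => H t + K t) = cint a b H + cint a b K.
Proof.
move=> [h1 h2] [k1 k2]; apply: complex_eqE; rewrite /cint /= -RintegralD //;
  by apply: eq_Rintegral => t _; rewrite ?cReD ?cImD.
Qed.

Lemma cintZ a b (c : R[i]) H : cintegrable a b H ->
  cint a b (fun t => c * H t) = c * cint a b H.
Proof.
move=> [h1 h2]; case: c => x y; rewrite /cint; apply: complex_eqE => /=.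
  rewrite -!RintegralZl // -RintegralB //.
  - by apply: eq_Rintegral => t _; rewrite cReM.
  - by apply: eq_integrable (integrableZl _ x h1).
  - by apply: eq_integrable (integrableZl _ y h2).
rewrite -!RintegralZl // -RintegralD //.
- by apply: eq_Rintegral => t _; rewrite cImM.
- by apply: eq_integrable (integrableZl _ x h2).
- by apply: eq_integrable (integrableZl _ y h1).
Qed.

Lemma eq_cint a b H K : (forall t, t \in `[a, b] -> H t = K t) ->
  cint a b H = cint a b K.
Proof.
by move=> hk; congr (_ +i* _); apply: eq_Rintegral => t; rewrite inE /= => /hk ->.
Qed.

(** Real and imaginary parts are estimated separately, which costs the factor 2. *)
Lemma normc_cint_le a b H M : a <= b -> cmeasurable a b H ->
  (forall t, t \in `[a, b] -> normc (H t) <= M) ->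
  normc (cint a b H) <= 2 * M * (b - a).
Proof.
move=> ab [mr mi] hM; apply: le_trans (ler_normc_ReIm _) _ => /=.
rewrite -mulrA mulr_natl mulr2n; apply: lerD; apply: normr_Rintegral_le => // t /hM;
  by apply: le_trans; first [exact: ler_Re_normc|exact: ler_Im_normc].
Qed.

Lemma cint_cat a b c H : a <= b <= c -> cintegrable a c H ->
  cint a c H = cint a b H + cint b c H.
Proof.
by move=> abc [h1 h2]; apply: complex_eqE; rewrite /cint /=; exact: Rintegral_itv_cat.
Qed.

Definition pder (g : R -> R[i]) t l := forall e, 0 < e -> exists2 d, 0 < d &
  forall s, `|s - t| < d ->
    normc (g s - g t - l * (s - t)%:C) <= e * `|s - t|.

Lemma pderP (g : R -> R[i]) t l : pder g t l <->
  is_derive t 1 (fun s => complex.Re (g s)) (complex.Re l) /\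
  is_derive t 1 (fun s => complex.Im (g s)) (complex.Im l).
Proof.
have E s : g s - g t - l * (s - t)%:C =
    (complex.Re (g s) - complex.Re (g t) - complex.Re l * (s - t)) +i*
    (complex.Im (g s) - complex.Im (g t) - complex.Im l * (s - t)).
  by apply: complex_eqE; rewrite ?(cReB, cImB) ?(cReM, cImM) /= mulr0 ?(subr0, add0r).
split=> [h|[/is_deriveE hr /is_deriveE hi] e e0].
  split; apply/is_deriveE => e e0; have [d d0 hd] := h e e0; exists d => // s /hd;
    apply: le_trans; rewrite E.
    exact: (ler_Re_normc (_ +i* _)).
  exact: (ler_Im_normc (_ +i* _)).
have e2 : 0 < e / 2 by rewrite divr_gt0.
have [d d0 hd] := hr _ e2; have [d' d'0 hd'] := hi _ e2.
exists (Num.min d d') => [|s]; first by rewrite lt_min d0.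
rewrite lt_min => /andP[/hd h1 /hd' h2].
apply: le_trans (ler_normc_ReIm _) _; rewrite E /=; lra.
Qed.

Lemma pder_comp (f : R[i] -> R[i]) (g : R -> R[i]) t l m :
  cder f (g t) l -> pder g t m -> pder (fun s => f (g s)) t (l * m).
Proof.
move=> hf hg e e0.
pose K := normc m + normc l + 1.
have K0 : 0 < K by have := normc_ge0 m; have := normc_ge0 l; rewrite /K; lra.
pose q := Num.min 1 (e / (2 * K)).
have q0 : 0 < q by rewrite lt_min ltr01 divr_gt0 // mulr_gt0.
have [d1 d10 h1] := hf _ q0; have [d2 d20 h2] := hg _ q0.
have nl := normc_ge0 l; have nm := normc_ge0 m.
exists (Num.min d2 (d1 / K)) => [|s]; first by rewrite lt_min d20 divr_gt0.
rewrite lt_min ltr_pdivlMr // => /andP[/h2 w2 w3].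
have -> : f (g s) - f (g t) - l * m * (s - t)%:C =
  (f (g s) - f (g t) - l * (g s - g t)) + l * (g s - g t - m * (s - t)%:C) by ring.
apply: le_trans (ler_normcD _ _) _; rewrite normcM.
have := ler_normcD (g s - g t - m * (s - t)%:C) (m * (s - t)%:C).
rewrite subrK normcM normc_real.
set n := `|s - t| in w2 w3 *; set G := normc (g s - g t) => hG.
have n0 : 0 <= n by exact: normr_ge0.
have q1 : q <= 1 by rewrite ge_min lexx.
have qe : q <= e / (2 * K) by rewrite ge_min lexx orbT.
have eK : e / (2 * K) * K = e / 2 by field; rewrite gt_eqF.
have GK : G <= (normc m + 1) * n by nra.
have /h1 w1 : G < d1 by rewrite /K in w3; nra.
rewrite -/G in w1.
have b1 : q * G <= q * ((normc m + 1) * n) by apply: ler_wpM2l => //; exact: ltW.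
have b2 : normc l * normc (g s - g t - m * (s - t)%:C) <= normc l * (q * n) by exact: ler_wpM2l.
have b3 : q * (K * n) <= e / (2 * K) * (K * n) by apply: ler_wpM2r => //; rewrite mulr_ge0 // ltW.
have : q * (K * n) = q * ((normc m + 1) * n) + normc l * (q * n) by rewrite /K; ring.
have bE : e / (2 * K) * (K * n) = e / 2 * n by rewrite mulrA eK.
rewrite bE in b3; nra.
Qed.

Lemma cint_FTC2 a b (g dg : R -> R[i]) : a < b -> cwithin a b g -> cwithin a b dg ->
  (forall t, t \in `]a, b[ -> pder g t (dg t)) -> cint a b dg = g b - g a.
Proof.
move=> ab [g1 g2] [d1 d2] h; rewrite /cint; apply: complex_eqE; rewrite ?cReB ?cImB /=.
  by apply: (continuous_FTC2_Rintegral ab g1 d1) => t /h /pderP[].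
by apply: (continuous_FTC2_Rintegral ab g2 d2) => t /h /pderP[].
Qed.

End ComplexIntegral.

(** * Integrals along a piecewise C1 path *)

Section PathIntegral.
Context {R : realType}.
Local Notation mu := (@lebesgue_measure R).
Variable gamma : R -> R[i].
Hypothesis hg : piecewise_C1 gamma.
Implicit Types (t : R) (H K : R -> R[i]).

(** The integrand is a function of the parameter, so that continuity is asked along the path and
    nowhere else. *)
Definition pathint (g : R -> R[i]) H := cint 0 1 (fun t => H t * velocity g t).

Let Q (a b : R) := C1_on a b (fun t => complex.Re (gamma t)) /\
  C1_on a b (fun t => complex.Im (gamma t)).

Lemma piecewise_C1_cwithin : cwithin 0 1 gamma.
Proof.
have [s [ps ls hs]] := hg.
have in0 (a b c : R) : a <= b <= c -> cwithin a b gamma -> cwithin b c gamma -> cwithin a c gamma.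
  move=> /andP[ab bc] /cwithinE h1 /cwithinE h2; apply/cwithinE => t;
    rewrite in_itv /= => /andP[ta tc] e e0.
  have [tb|tb|tb] := ltgtP t b.
  - have [|d d0 hd] := h1 t _ e e0; first by rewrite in_itv /= ta ltW.
    exists (Num.min d (b - t)) => [|u]; first by rewrite lt_min d0 subr_gt0.
    rewrite in_itv /= lt_min => /andP[ua uc] /andP[ud]; rewrite ltr_norml => /andP[_ ub].
    by apply: hd => //; rewrite in_itv /= ua /=; lra.
  - have [|d d0 hd] := h2 t _ e e0; first by rewrite in_itv /= tc ltW.
    exists (Num.min d (t - b)) => [|u]; first by rewrite lt_min d0 subr_gt0.
    rewrite in_itv /= lt_min => /andP[ua uc] /andP[ud]; rewrite ltr_norml => /andP[ub _].
    by apply: hd => //; rewrite in_itv /= uc andbT; lra.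
  - rewrite tb in ta tc *.
    have [|d d0 hd] := h1 b _ e e0; first by rewrite in_itv /= ta lexx.
    have [|d' d'0 hd'] := h2 b _ e e0; first by rewrite in_itv /= tc lexx.
    exists (Num.min d d') => [|u]; first by rewrite lt_min d0.
    rewrite in_itv /= lt_min => /andP[ua uc] /andP[ud ud'].
    by case: (leP u b) => ub; [apply: hd|apply: hd'] => //; rewrite in_itv /= ?ua ?uc ?andbT // ltW.
rewrite -ls; apply: (path_additive (Q := Q) (T := fun a b => cwithin a b gamma) ps hs) => //.
  apply/cwithinE => t; rewrite in_itv /= => /le_anti <- e e0; exists 1 => // u;
    rewrite in_itv /= => /le_anti <-.
  by rewrite [gamma 0 - _]subrr normc0.
by move=> a b ab [[? [? _ _]] [? [? _ _]]]; split.
Qed.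

(** The velocity may be discontinuous at the break points; measurability and boundedness survive the
    gluing and suffice to integrate it against continuous functions. *)
Lemma velocity_cmeasurable_cbounded :
  cmeasurable 0 1 (velocity gamma) /\ cbounded 0 1 (velocity gamma).
Proof.
have [s [ps ls hs]] := hg; rewrite -ls.
apply: (path_additive (Q := Q) (T :=
  fun a b => cmeasurable a b (velocity gamma) /\ cbounded a b (velocity gamma)) ps hs).
- rewrite /cmeasurable /cbounded set_itv1; split; first by split; exact: measurable_fun_set1.
  exists (normc (velocity gamma 0)) => t; rewrite in_itv /= => /le_anti <-.
  by rewrite lexx.
- move=> a b ab [/(C1_on_derive1 ab)[m1 [M hM]] /(C1_on_derive1 ab)[m2 [N hN]]].
  split; first by split.
  exists (M + N) => t tab; apply: le_trans (ler_normc_ReIm _) _ => /=.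
  by rewrite lerD ?hM ?hN.
- move=> a b c /andP[ab bc] [[r1 i1] [M hM]] [[r2 i2] [N hN]].
  have E : `[a, c]%classic = `[a, b]%classic `|` `[b, c]%classic.
    apply/seteqP; split => [u|u [|]] /=; rewrite !in_itv /=.
    - by move=> /andP[-> ->]; case: (leP u b) => ub; [left|right; rewrite ltW].
    - by move=> /andP[-> /le_trans ->].
    - by move=> /andP[/(le_trans ab) -> ->].
  split.
    by rewrite /cmeasurable E; split; apply/measurable_funU.
  exists (Num.max M N) => t tac.
  have : `[a, c]%classic t by [].
  by rewrite E => -[/hM|/hN] h; rewrite le_max h ?orbT.
Qed.

Lemma pathint_integrable H : cwithin 0 1 H ->
  cintegrable 0 1 (fun t => H t * velocity gamma t).
Proof.
have [vm vb] := velocity_cmeasurable_cbounded.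
move=> cH; apply: cintegrable_cbounded.
  by apply: cmeasurableM => //; exact: cwithin_cmeasurable.
by apply: cboundedM => //; exact: cwithin_cbounded.
Qed.

Lemma pathintD H K : cwithin 0 1 H -> cwithin 0 1 K ->
  pathint gamma (fun t => H t + K t) = pathint gamma H + pathint gamma K.
Proof.
move=> cH cK; rewrite /pathint -cintD; try exact: pathint_integrable.
by apply: eq_cint => t _; rewrite mulrDl.
Qed.

Lemma pathintZ (c : R[i]) H : cwithin 0 1 H ->
  pathint gamma (fun t => c * H t) = c * pathint gamma H.
Proof.
move=> cH; rewrite /pathint -cintZ; last exact: pathint_integrable.
by apply: eq_cint => t _; rewrite mulrA.
Qed.

Lemma eq_pathint H K : (forall t, t \in `[0, 1] -> H t = K t) ->
  pathint gamma H = pathint gamma K.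
Proof. by move=> HK; apply: eq_cint => t /HK ->. Qed.

Lemma pathintB H K : cwithin 0 1 H -> cwithin 0 1 K ->
  pathint gamma (fun t => H t - K t) = pathint gamma H - pathint gamma K.
Proof.
move=> cH cK; rewrite -[- pathint _ K]mulN1r -pathintZ // -pathintD //.
  by apply: eq_pathint => t _; rewrite mulN1r.
by apply: cwithinM => //; exact: cwithin_cst.
Qed.

Lemma pathint_sum (I : Type) (s : seq I) (H : I -> R -> R[i]) :
  (forall i, cwithin 0 1 (H i)) ->
  pathint gamma (fun t => \sum_(i <- s) H i t) = \sum_(i <- s) pathint gamma (H i).
Proof.
move=> cH; elim: s => [|i s IHs].
  rewrite big_nil -[RHS](mul0r (pathint gamma (fun=> 1))) -pathintZ; last exact: cwithin_cst.
  by apply: eq_pathint => t _; rewrite big_nil mul0r.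
rewrite big_cons -IHs -pathintD //.
  by apply: eq_pathint => t _; rewrite big_cons.
elim: s {IHs} => [|j s IHs].
  by rewrite (_ : (fun=> _) = fun=> 0); [exact: cwithin_cst|apply/funext => t; rewrite big_nil].
rewrite (_ : (fun=> _) = fun t => H j t + \sum_(i <- s) H i t); first exact: cwithinD.
by apply/funext => t; rewrite big_cons.
Qed.

Lemma pathint_le V H M : (forall t, t \in `[0, 1] -> normc (velocity gamma t) <= V) ->
  cwithin 0 1 H -> (forall t, t \in `[0, 1] -> normc (H t) <= M) ->
  normc (pathint gamma H) <= 2 * V * M.
Proof.
move=> hV cH hM.
have [vm _] := velocity_cmeasurable_cbounded.
have := @normc_cint_le _ 0 1 (fun t => H t * velocity gamma t) (V * M) ler01.
rewrite subr0 mulr1 mulrA; apply; first by apply: cmeasurableM => //; exact: cwithin_cmeasurable.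
by move=> t t01; rewrite normcM mulrC ler_pM ?normc_ge0 ?hV ?hM.
Qed.

Lemma pathint_bound : exists2 L, 0 <= L & forall H M, cwithin 0 1 H ->
  (forall t, t \in `[0, 1] -> normc (H t) <= M) -> normc (pathint gamma H) <= L * M.
Proof.
have [_ [V hV]] := velocity_cmeasurable_cbounded; exists (2 * V) => [|H M]; last exact: pathint_le.
by rewrite mulr_ge0 // (le_trans (normc_ge0 _) (hV 0 _)) // in_itv /= lexx ler01.
Qed.

Lemma pathint_FTC (F f : R[i] -> R[i]) :
  (forall t, t \in `[0, 1] -> cder F (gamma t) (f (gamma t))) ->
  cwithin 0 1 (fun t => f (gamma t)) ->
  pathint gamma (fun t => f (gamma t)) = F (gamma 1) - F (gamma 0).
Proof.
move=> hF cf; have ci := pathint_integrable cf.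
have cF : cwithin 0 1 (fun t => F (gamma t)).
  by apply: (cwithin_comp _ piecewise_C1_cwithin) => t /hF /cder_cont.
have [s [ps ls hs]] := hg; rewrite -[in F (gamma 1)]ls /pathint -{1}ls.
(* The side conditions keep the pieces in [[0, 1]], where integrability is known. *)
pose T (a b : R) := 0 <= a -> b <= 1 ->
  cint a b (fun t => f (gamma t) * velocity gamma t) = F (gamma b) - F (gamma a).
suff: T 0 (last 0 s) by rewrite /T ls lexx => ->.
have sub (a b : R) : 0 <= a -> b <= 1 -> cintegrable a b (fun t => f (gamma t) * velocity gamma t).
  move=> a0 b1; have [i1 i2] := ci.
  by split; [apply: integrableS i1|apply: integrableS i2] => //; apply: subset_itvScc => //;
    rewrite bnd_simp.
apply: (path_additive (Q := Q) (T := T) ps hs) => //.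
- by move=> _ _; rewrite subrr /cint !set_itv1 !Rintegral_set1.
- move=> a b ab [[dr [_ cdr hdr]] [di [_ cdi hdi]]] a0 b1.
  pose dg t := dr t +i* di t.
  have cdg : cwithin a b dg by split.
  have cdf : cwithin a b (fun t => f (gamma t) * dg t).
    by apply: cwithinM => //; apply: cwithinS cf.
  have E t : t \in `]a, b[ -> velocity gamma t = dg t.
    by move=> tab; rewrite /velocity !derive1E; case: (hdr t tab) => _ ->;
      case: (hdi t tab) => _ ->.
  (* In the open piece [velocity] is the continuous [dg], to which the fundamental theorem
     applies. *)
  transitivity (cint a b (fun t => f (gamma t) * dg t)).
    have [i1 i2] := sub a b a0 b1; have [j1 j2] := cwithin_integrable cdf.
    by apply: complex_eqE; apply: eq_Rintegral_oo => // t /E ->.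
  apply: (cint_FTC2 (g := fun t => F (gamma t)) ab _ cdf).
    exact: cwithinS cF.
  move=> t tab; apply: pder_comp.
    apply: hF; move: tab; rewrite !in_itv /= => /andP[ta tb].
    by rewrite (le_trans a0 (ltW ta)) (le_trans (ltW tb) b1).
  by apply/pderP; split; [exact: hdr|exact: hdi].
- move=> a b c /andP[ab bc] h1 h2 a0 c1.
  rewrite (@cint_cat _ a b c) ?ab // ?h1 ?h2 ?(le_trans a0) ?(le_trans bc) //; last exact: sub.
  by rewrite addrC subrKA.
Qed.

(** [(gamma t - z)^-1] is continuous in [t], hence bounded; the inverse of a bound is a distance
    from [z] to the trace. *)
Lemma trace_compact (z : R[i]) : (forall t, t \in `[0, 1] -> gamma t != z) ->
  exists2 d : R, 0 < d & forall t, t \in `[0, 1] -> d <= normc (gamma t - z).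
Proof.
move=> h.
have c1 : cwithin 0 1 (fun t => (gamma t - z)^-1).
  apply: cwithin_V => [|t /h]; last by rewrite subr_eq0.
  by apply: cwithinD; [exact: piecewise_C1_cwithin|exact: cwithin_cst].
have [M hM] := cwithin_cbounded c1.
have M0 : 0 <= M by apply: le_trans (normc_ge0 _) (hM 0 _); rewrite in_itv /= lexx ler01.
exists (M + 1)^-1 => [|t t01]; first by rewrite invr_gt0; lra.
have n0 : 0 < normc (gamma t - z) by rewrite normc_gt0 subr_eq0 h.
rewrite -[leRHS]invrK lef_pV2 ?posrE ?invr_gt0 //; last by lra.
by rewrite -normcV; have := hM t t01; lra.
Qed.

End PathIntegral.

Lemma contour_integralE {R : realType} (gamma : R -> R[i]) (h : R[i] -> R[i]) :
  contour_integral gamma h = pathint gamma (fun t => h (gamma t)).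
Proof. by []. Qed.

(** * Cauchy theory in a disc *)

Section MeanValue.
Context {R : realType}.
Implicit Types (f : R[i] -> R[i]) (p q z w l : R[i]) (r M : R).

Lemma pder_segment p q (t : R) : pder (fun s => q + s%:C * (p - q)) t (p - q).
Proof.
move=> e e0; exists 1 => // s _.
rewrite (_ : _ - _ - _ = 0); first by rewrite normc0 mulr_ge0 // ltW.
by rewrite rmorphB /=; ring.
Qed.

Lemma pder_cwithin (a b : R) (g dg : R -> R[i]) :
  (forall t, t \in `[a, b] -> pder g t (dg t)) -> cwithin a b g.
Proof.
move=> hg; apply/cwithinE => t tab e e0; have [d d0 hd] := hg t tab 1 ltr01.
pose k := normc (dg t); have k0 : 0 <= k by exact: normc_ge0.
exists (Num.min d (e / (k + 2))) => [|s sab]; first by rewrite lt_min d0 divr_gt0 //; lra.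
rewrite lt_min ltr_pdivlMr; last by lra.
move=> /andP[/hd h1 h2].
have h3 : normc (g s - g t) <= normc (g s - g t - dg t * (s - t)%:C) + k * `|s - t|.
  by rewrite -normc_real -normcM -[X in normc X <= _](subrK (dg t * (s - t)%:C)); exact: ler_normcD.
by have := normr_ge0 (s - t); nra.
Qed.

Lemma pder_affine (l : R[i]) (t : R) : pder (fun s => l * s%:C) t l.
Proof.
move=> e e0; exists 1 => // s _.
rewrite (_ : _ - _ - _ = 0); first by rewrite normc0 mulr_ge0 // ltW.
by rewrite rmorphB /=; ring.
Qed.

(** Subtract the affine function of slope [l] and apply the real mean value theorem to the real and
    the imaginary part. Their intermediate points differ, hence the factor 2. *)
Lemma pder_mean_value (a b M : R) (g dg : R -> R[i]) l : a <= b ->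
  (forall t, t \in `[a, b] -> pder g t (dg t)) ->
  (forall t, t \in `[a, b] -> normc (dg t - l) <= M) ->
  normc (g b - g a - l * (b - a)%:C) <= 2 * M * (b - a).
Proof.
move=> ab hg hM; pose k s := g s - l * s%:C; pose dk s := dg s - l.
have hk t : t \in `[a, b] -> pder k t (dk t).
  move=> /hg /pderP[h1 h2]; have /pderP[h3 h4] := pder_affine l t.
  apply/pderP; rewrite /k /dk cReB cImB; split.
    rewrite (_ : (fun s => _) = (fun s => complex.Re (g s)) - (fun s => complex.Re (l * s%:C))).
      exact: is_deriveB.
    by apply/funext => s; rewrite cReB.
  rewrite (_ : (fun s => _) = (fun s => complex.Im (g s)) - (fun s => complex.Im (l * s%:C))).
    exact: is_deriveB.
  by apply/funext => s; rewrite cImB.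
have -> : g b - g a - l * (b - a)%:C = k b - k a by rewrite /k rmorphB /=; ring.
have sub (t : R) : t \in `]a, b[ -> t \in `[a, b] by exact: subset_itv_oo_cc.
apply: le_trans (ler_normc_ReIm _) _.
have [g1 g2] := pder_cwithin hk.
have [|c cab E1] := @MVT_segment R _ (fun t => complex.Re (dk t)) _ _ ab _ g1.
  by move=> t /sub /hk /pderP[h _]; exact: h.
have [|c' c'ab E2] := @MVT_segment R _ (fun t => complex.Im (dk t)) _ _ ab _ g2.
  by move=> t /sub /hk /pderP[_ h]; exact: h.
rewrite cReB cImB E1 E2 !normrM (ger0_norm (_ : 0 <= b - a)) ?subr_ge0 //.
rewrite -mulrDl; apply: ler_wpM2r; first by rewrite subr_ge0.
rewrite mulr_natl mulr2n lerD //.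
  exact: le_trans (ler_Re_normc _) (hM _ cab).
exact: le_trans (ler_Im_normc _) (hM _ c'ab).
Qed.

Lemma mean_value f f1 p q l M :
  (forall t : R, t \in `[0, 1] -> cder f (q + t%:C * (p - q)) (f1 (q + t%:C * (p - q)))) ->
  (forall t : R, t \in `[0, 1] -> normc (f1 (q + t%:C * (p - q)) - l) <= M) ->
  normc (f p - f q - l * (p - q)) <= 2 * M * normc (p - q).
Proof.
move=> hf hM.
have := @pder_mean_value 0 1 (M * normc (p - q)) (fun t => f (q + t%:C * (p - q)))
  (fun t => f1 (q + t%:C * (p - q)) * (p - q)) (l * (p - q)) ler01.
rewrite rmorph1 rmorph0 mul1r mul0r addr0 subrKC subr0 rmorph1 !mulr1 mulrA; apply.
  by move=> t t01; apply: pder_comp (pder_segment p q t); exact: hf.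
by move=> t /hM h; rewrite -mulrBl normcM ler_wpM2r // normc_ge0.
Qed.

Lemma segment_cball z r p q (t : R) : t \in `[0, 1] -> cball z r p -> cball z r q ->
  cball z r (q + t%:C * (p - q)).
Proof.
rewrite in_itv /cball /= => /andP[t0 t1] hp hq.
rewrite (_ : _ - z = (1 - t)%:C * (q - z) + t%:C * (p - z)); last by rewrite rmorphB rmorph1; ring.
apply: le_lt_trans (ler_normcD _ _) _.
rewrite !normcM !normc_real !ger0_norm ?subr_ge0 //.
have := normc_ge0 (p - z); have := normc_ge0 (q - z).
move: hp hq; set a := normc _; set b := normc _ => *.
have [->|tn] := eqVneq t 0; first by rewrite subr0 mul1r mul0r addr0.
have t0' : 0 < t by rewrite lt_def tn.
nra.
Qed.

Lemma normc_segment p q (t : R) : t \in `[0, 1] ->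
  normc (q + t%:C * (p - q) - q) <= normc (p - q).
Proof.
rewrite in_itv /= => /andP[t0 t1].
rewrite addrC addKr normcM normc_real ger0_norm //.
by rewrite ler_piMl ?normc_ge0.
Qed.

Lemma mean_value_ball f f1 z r M p q :
  (forall w, cball z r w -> cder f w (f1 w)) ->
  (forall w, cball z r w -> normc (f1 w) <= M) ->
  cball z r p -> cball z r q -> normc (f p - f q) <= 2 * M * normc (p - q).
Proof.
move=> hf hM zp zq; have := @mean_value f f1 p q 0 M.
rewrite mul0r subr0; apply=> t t01; first by apply/hf/segment_cball.
by rewrite subr0; apply/hM/segment_cball.
Qed.

(** On the segment [f1] varies by at most [2 * M * normc (p - q)]; a second use of the mean value
    inequality gives the remainder of [f], hence [4 = 2 * 2]. *)
Lemma taylor2_ball f f1 f2 z r M p q :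
  (forall w, cball z r w -> cder f w (f1 w)) ->
  (forall w, cball z r w -> cder f1 w (f2 w)) ->
  (forall w, cball z r w -> normc (f2 w) <= M) ->
  cball z r p -> cball z r q ->
  normc (f p - f q - f1 q * (p - q)) <= 4 * M * normc (p - q) ^+ 2.
Proof.
move=> hf hf1 hM zp zq.
rewrite (_ : 4 * _ * _ = 2 * (2 * M * normc (p - q)) * normc (p - q)); last by ring.
apply: (@mean_value f f1) => t t01; first by apply/hf/segment_cball.
apply: le_trans (mean_value_ball hf1 hM (segment_cball t01 zp zq) zq) _.
rewrite ler_wpM2l ?normc_segment //.
by rewrite mulr_ge0 // (le_trans (normc_ge0 (f2 q)) (hM _ zq)).
Qed.

(* Spares differentiation under the integral sign: applied to integrals that
   depend on a real parameter [s], whose formal derivative in [s] vanishes. *)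
Lemma quadratic_constant (phi : R -> R[i]) (K : R) :
  (forall s t, s \in `[0, 1] -> t \in `[0, 1] -> normc (phi s - phi t) <= K * (s - t) ^+ 2) ->
  phi 1 = phi 0.
Proof.
move=> h; apply/eqP; rewrite -subr_eq0 -normc_eq0; apply: contraT => n0.
have p0 : 0 < normc (phi 1 - phi 0) by rewrite lt_def n0 normc_ge0.
set A := normc _ in p0.
have K0 : 0 <= K.
  have := h 1 0; rewrite !in_itv /= !lexx ler01 => /(_ isT isT).
  by rewrite subr0 expr1n mulr1; exact: le_trans (normc_ge0 _).
(* [N = n.+1] equal steps move [phi] by at most [K / N ^ 2] each, hence by at most [K / N < A] in
   total. *)
have [n hn] : exists n : nat, K / A < n.+1%:R.
  exists (Num.trunc (K / A)); have /andP[_ //] := truncn_itv (divr_ge0 K0 (ltW p0)).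
pose N : R := n.+1%:R.
have N0 : 0 < N by rewrite ltr0n.
have st m : (m <= n.+1)%N -> m%:R / N \in `[0, 1].
  by move=> mn; rewrite in_itv /= divr_ge0 //= ler_pdivrMr // mul1r ler_nat.
have : forall m, (m <= n.+1)%N -> normc (phi (m%:R / N) - phi 0) <= m%:R * (K / N ^+ 2).
  elim=> [_|m IHm mn]; first by rewrite !mul0r subrr normc0.
  apply: le_trans (ler_distc_add _ (phi (m%:R / N)) _) _.
  rewrite -[in leRHS]natr1 mulrDl mul1r [leRHS]addrC lerD //; last exact: IHm (ltnW mn).
  apply: le_trans (h _ _ (st _ mn) (st _ (ltnW mn))) _.
  by rewrite -mulrBl -natr1 (addrC m%:R) addrK mul1r exprVn.
move=> /(_ _ (leqnn _)); rewrite divff ?gt_eqF // -/A -/N.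
rewrite (_ : N * (K / N ^+ 2) = K / N); last by field; rewrite gt_eqF.
rewrite ler_pdivlMr // => hA; move: hn; rewrite ltr_pdivrMr // -/N; lra.
Qed.

End MeanValue.

(** * Circles, traversed once by the parameter interval [[0, 1]] *)

Section Circle.
Context {R : realType}.
Implicit Types (w z : R[i]) (r : R).

Definition circle w r : R -> R[i] := fun t =>
  (complex.Re w + r * cos (2 * pi * t)) +i* (complex.Im w + r * sin (2 * pi * t)).

Definition two_pi_i : R[i] := 0 +i* (2 * pi).

Lemma two_pi_i_neq0 : two_pi_i != 0.
Proof. by rewrite /two_pi_i eq_complex /= negb_and (gt_eqF (mulr_gt0 _ (pi_gt0 R))) ?orbT. Qed.

Lemma is_derive_trigo_affine (a r t : R) (f : R -> R) l :
  is_derive (2 * pi * t) 1 f l ->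
  is_derive t 1 (fun s => a + r * f (2 * pi * s)) (2 * pi * r * l).
Proof.
move=> h.
have h1 : is_derive t 1 (fun s : R => 2 * pi * s) (2 * pi).
  apply/is_deriveE => e e0; exists 1 => // s _.
  by rewrite -mulrBr subrr normr0 mulr_ge0 // ltW.
have := is_deriveD (is_derive_cst a t 1) (is_deriveZ r (is_derive1_comp h h1)).
move=> h2; apply: (is_derive_eq h2).
by rewrite /GRing.scale /=; ring.
Qed.

Lemma velocity_circle w r t : velocity (circle w r) t = two_pi_i * (circle w r t - w).
Proof.
rewrite /velocity /circle !derive1E /=.
have [_ ->] := @is_derive_trigo_affine (complex.Re w) r t _ _ (is_derive_cos (2 * pi * t)).
have [_ ->] := @is_derive_trigo_affine (complex.Im w) r t _ _ (is_derive_sin (2 * pi * t)).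
by apply: complex_eqE; rewrite ?(cReM, cImM) ?(cReB, cImB) /=; ring.
Qed.

Lemma circle_piecewise_C1 w r : piecewise_C1 (circle w r).
Proof.
exists [:: 1]; split => //=; first by rewrite ltr01.
have aff (a b : R) (f : R -> R) : continuous f ->
  {within `[0, 1], continuous (fun s : R => a + b * f (2 * pi * s))}.
  move=> cf; apply: continuous_subspaceT => s.
  have c1 : {for s, continuous (f \o *%R (2 * pi))}.
    by apply: continuous_comp; [exact: mulrl_continuous|exact: cf].
  have c2 : {for s, continuous ( *%R b \o (f \o *%R (2 * pi)))}.
    by apply: continuous_comp; [exact: c1|exact: mulrl_continuous].
  exact: (continuousD (@cst_continuous _ _ a s) c2).
move=> [|//] _ /=; split.
  (* The leading [0 +] gives the derivative the shape expected by [aff]. *)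
  exists (fun t => 0 + (2 * pi * r * -1) * sin (2 * pi * t)); split.
  - exact/aff/continuous_cos.
  - exact/aff/continuous_sin.
  - move=> t _;
    apply: (is_derive_eq (@is_derive_trigo_affine _ r t _ _ (is_derive_cos (2 * pi * t)))); by ring.
exists (fun t => 0 + (2 * pi * r) * cos (2 * pi * t)); split.
- exact/aff/continuous_sin.
- exact/aff/continuous_cos.
- move=> t _;
  apply: (is_derive_eq (@is_derive_trigo_affine _ r t _ _ (is_derive_sin (2 * pi * t)))); by ring.
Qed.

Lemma circle_closed w r : circle w r 1 = circle w r 0.
Proof. by rewrite /circle !mulr1 !mulr0 cos0 sin0 mulr_natl cos2pi sin2pi. Qed.

Lemma normc_circle w r t : 0 <= r -> normc (circle w r t - w) = r.
Proof.
move=> r0; rewrite /circle; case: w => a b /=.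
rewrite (addrC a) (addrC b) 2!addrK.
rewrite (exprMn _ r (cos _)) (exprMn _ r (sin _)) -mulrDr cos2Dsin2 mulr1.
by rewrite sqrtr_sqr ger0_norm.
Qed.

Lemma normc_velocity_circle w r t : 0 <= r -> normc (velocity (circle w r) t) = 2 * pi * r.
Proof.
move=> r0; rewrite velocity_circle normcM normc_circle //; congr (_ * _).
by rewrite /two_pi_i /= expr0n add0r sqrtr_sqr ger0_norm // mulr_ge0 // pi_ge0.
Qed.

Lemma pathint_circle_center w r : 0 < r ->
  pathint (circle w r) (fun t => (circle w r t - w)^-1) = two_pi_i.
Proof.
move=> r0; rewrite /pathint.
transitivity (cint 0 1 (fun t : R => two_pi_i * 1)).
  apply: eq_cint => t _; rewrite velocity_circle mulrCA mulVf //.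
  by rewrite -normc_gt0 normc_circle // ltW.
rewrite /cint !Rintegral_cst //= lebesgue_measure_itv /= lte_fin ltr01 /= subr0 !mulr1.
by rewrite !mul0r !mulr0 subr0 add0r.
Qed.

End Circle.

(** * Goursat's theorem for rectangles *)

Section Goursat.
Context {R : realType}.
Implicit Types (a b c d e x y s t W : R) (f g F : R[i] -> R[i]).

(** The right ends [u n + W / 2 ^ n] do not increase, so each bounds all the left ends and the
    supremum of the latter lies in every interval. *)
Lemma nested_halving (u : nat -> R) W : 0 <= W ->
  (forall n, u n <= u n.+1 <= u n + W / 2 ^+ n.+1) ->
  exists p, forall n, u n <= p <= u n + W / 2 ^+ n.
Proof.
move=> W0 hu.
have mono n m : u n <= u (n + m)%N <= u n + (W / 2 ^+ n - W / 2 ^+ (n + m)%N).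
  elim: m => [|m IHm]; first by rewrite addn0 subrr addr0 lexx.
  have /andP[h1 h2] := hu (n + m)%N; rewrite addnS.
  have E : W / 2 ^+ (n + m)%N = 2 * (W / 2 ^+ (n + m).+1).
    by rewrite exprS; field; rewrite expf_neq0.
  by rewrite E in IHm; lra.
have ub m n : u m <= u n + W / 2 ^+ n.
  have pos k : 0 <= W / 2 ^+ k by rewrite divr_ge0 // exprn_ge0.
  have [nm|mn] := leqP n m.
    have := mono n (m - n)%N; rewrite subnKC // => /andP[_ h].
    by have := pos m; lra.
  have := mono m (n - m)%N; rewrite subnKC ?(ltnW mn) // => /andP[h _].
  by have := pos n; lra.
have hs : has_sup (range u).
  by split; [exists (u 0%N); exists 0%N|exists (u 0%N + W / 2 ^+ 0) => _ [m _ <-]; exact: ub].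
exists (sup (range u)) => n; apply/andP; split.
  by apply: sup_upper_bound => //; exists n.
by apply: ge_sup; [exists (u 0%N); exists 0%N|move=> _ [m _ <-]; exact: ub].
Qed.

Lemma halving_small W e : 0 <= W -> 0 < e -> exists n, W / 2 ^+ n < e.
Proof.
move=> W0 e0; have h : 0 <= W / e by rewrite divr_ge0 // ltW.
have /andP[_ hn] := truncn_itv h.
exists (Num.trunc (W / e)).+1; set n := _.+1 in hn *.
rewrite ltr_pdivrMr ?exprn_gt0 // mulrC -ltr_pdivrMr //.
apply: lt_trans hn _; rewrite -natrX ltr_nat; exact: ltn_expl.
Qed.

Definition rectangle a b c d : set R[i] :=
  [set z | a <= complex.Re z <= b /\ c <= complex.Im z <= d].

(* Quadrisection: a nonzero value would persist, up to a factor [4 ^ n], on a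
   nested sequence of rectangles shrinking to a point. *)
Lemma additive_rectangle_function_eq0 (Phi : R -> R -> R -> R -> R[i]) A B C D :
  A <= B -> C <= D ->
  (forall a m b c n d, A <= a -> a <= m <= b -> b <= B ->
     C <= c -> c <= n <= d -> d <= D ->
     Phi a b c d = Phi a m c n + Phi m b c n + Phi a m n d + Phi m b n d) ->
  (forall p, rectangle A B C D p -> forall e, 0 < e -> exists2 h, 0 < h &
     forall a b c d, rectangle a b c d p -> A <= a -> b <= B -> C <= c -> d <= D ->
       b - a < h -> d - c < h ->
       normc (Phi a b c d) <= e * (b - a + (d - c)) ^+ 2) ->
  Phi A B C D = 0.
Proof.
move=> AB CD hadd hloc.
pose W := B - A; pose H := D - C.
have W0 : 0 <= W by rewrite subr_ge0.
have H0 : 0 <= H by rewrite subr_ge0.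
(* A rectangle of generation [n] is coded by its lower left corner; its sides are [W / 2 ^ n] and
   [H / 2 ^ n]. *)
pose Psi (n : nat) (p : R * R) := Phi p.1 (p.1 + W / 2 ^+ n) p.2 (p.2 + H / 2 ^+ n).
pose valid (n : nat) (p : R * R) :=
  [/\ A <= p.1, p.1 + W / 2 ^+ n <= B, C <= p.2 & p.2 + H / 2 ^+ n <= D].
pose next (n : nat) (p q : R * R) := [/\ valid n.+1 q,
  p.1 <= q.1 <= p.1 + W / 2 ^+ n.+1, p.2 <= q.2 <= p.2 + H / 2 ^+ n.+1 &
  normc (Psi n p) <= 4 * normc (Psi n.+1 q)].
have half V (n : nat) : V / 2 ^+ n = V / 2 ^+ n.+1 + V / 2 ^+ n.+1 :> R.
  by rewrite exprS; field; rewrite expf_neq0.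
have pos V (n : nat) : 0 <= V -> 0 <= V / 2 ^+ n :> R by move=> V0; rewrite divr_ge0 // exprn_ge0.
have step (n : nat) p : valid n p -> exists q, next n p q.
  case: p => a c [/= h1 h2 h3 h4].
  have w0 := pos _ n.+1 W0; have k0 := pos _ n.+1 H0.
  rewrite /next /Psi /valid /= (half W n) (half H n) in h2 h4 *.
  set w := W / _ in h2 w0 *; set k := H / _ in h4 k0 *.
  have E := @hadd a (a + w) (a + (w + w)) c (c + k) (c + (k + k)).
  have {}E : Phi a (a + (w + w)) c (c + (k + k)) = Phi a (a + w) c (c + k) +
     Phi (a + w) (a + w + w) c (c + k) + Phi a (a + w) (c + k) (c + k + k) +
     Phi (a + w) (a + w + w) (c + k) (c + k + k).
    by rewrite E ?addrA //; lra.
  rewrite E.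
  set P1 := Phi a _ c _; set P2 := Phi (a + w) _ c _.
  set P3 := Phi a _ (c + k) _; set P4 := Phi (a + w) _ (c + k) _.
  have T : normc (P1 + P2 + P3 + P4) <= normc P1 + normc P2 + normc P3 + normc P4.
    have := ler_normcD (P1 + P2 + P3) P4; have := ler_normcD (P1 + P2) P3;
      have := ler_normcD P1 P2; lra.
  set N := normc (P1 + _ + _ + _) in T *.
  (* One of the four quarters carries at least a quarter of the norm; the last one does if the first
     three do not. *)
  have [g1|g1] := leP N (4 * normc P1); first by exists (a, c); split => //=; [split|..]; lra.
  have [g2|g2] := leP N (4 * normc P2); first by exists (a + w, c); split => //=; [split|..]; lra.
  have [g3|g3] := leP N (4 * normc P3); first by exists (a, c + k); split => //=; [split|..]; lra.
  exists (a + w, c + k); split => /=; [split| | |]; rewrite -?/P4; lra.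
have /choice[G hG] : forall np : nat * (R * R), exists q, valid np.1 np.2 -> next np.1 np.2 q.
  move=> [n p]; have [v|nv] := pselect (valid n p); last by exists p.
  by have [q hq] := step n p v; exists q.
pose u := fix u n := if n is m.+1 then G (m, u m) else (A, C).
have vu n : valid n (u n).
  elim: n => [|n IHn]; last by have [] := hG (n, u n) IHn.
  by rewrite /valid /= !expr0 !divr1 /W /H !subrKC !lexx.
have nu n : next n (u n) (u n.+1) by exact: (hG (n, u n) (vu n)).
have [p1 hp1] := @nested_halving (fun n => (u n).1) W W0 (fun n => let: And4 _ h _ _ := nu n in h).
have [p2 hp2] := @nested_halving (fun n => (u n).2) H H0 (fun n => let: And4 _ _ h _ := nu n in h).
have lower n : normc (Phi A B C D) <= 4 ^+ n * normc (Psi n (u n)).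
  elim: n => [|n IHn]; first by rewrite /Psi /= !expr0 !divr1 mul1r /W /H !subrKC.
  apply: le_trans IHn _; rewrite exprSr -mulrA ler_wpM2l ?exprn_ge0 //.
  by have [] := nu n.
apply/eqP; rewrite -normc_eq0; apply: contraT => n0.
have P0 : 0 < normc (Phi A B C D) by rewrite lt_def n0 normc_ge0.
(* The summand 1 keeps [K] positive when the rectangle is a point. The local bound with
   [e = normc (Phi A B C D) / (2 * K)], multiplied by [4 ^ n], is at most half of
   [normc (Phi A B C D)]. *)
pose K := (W + H) ^+ 2 + 1.
have K0 : 0 < K by rewrite ltr_wpDl // sqr_ge0.
have rp : rectangle A B C D (p1 +i* p2).
  have := hp1 0%N; have := hp2 0%N; rewrite /rectangle /= !expr0 !divr1 /W /H.
  by rewrite !subrKC.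
have [h h0 hh] := hloc _ rp _ (divr_gt0 P0 (mulr_gt0 (ltr0n _ 2) K0)).
have [n hn] := halving_small (addr_ge0 W0 H0) h0.
have w0 := pos _ n W0; have k0 := pos _ n H0.
have s : (W + H) / 2 ^+ n = W / 2 ^+ n + H / 2 ^+ n by rewrite mulrDl.
rewrite s in hn.
have [v1 v2 v3 v4] := vu n.
have := hh (u n).1 ((u n).1 + W / 2 ^+ n) (u n).2 ((u n).2 + H / 2 ^+ n).
rewrite /rectangle /= hp1 hp2 => /(_ (conj isT isT) v1 v2 v3 v4).
rewrite (addrC (u n).1) (addrC (u n).2) !addrK -s => hb.
have {}hb := hb (le_lt_trans _ hn) (le_lt_trans _ hn).
have : normc (Psi n (u n)) <= normc (Phi A B C D) / (2 * K) * ((W + H) / 2 ^+ n) ^+ 2.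
  by rewrite /Psi (addrC (u n).1) (addrC (u n).2); apply: hb; rewrite ?lerDl ?lerDr.
move: (lower n); set X := normc (Phi A B C D) in P0 *; set Y := normc (Psi _ _) => l1 l2.
have l3 : X <= 4 ^+ n * (X / (2 * K) * ((W + H) / 2 ^+ n) ^+ 2).
  by apply: le_trans l1 _; rewrite ler_wpM2l // exprn_ge0.
have E : 4 ^+ n * (X / (2 * K) * ((W + H) / 2 ^+ n) ^+ 2) = X / (2 * K) * (W + H) ^+ 2.
  have -> : (4 : R) ^+ n = (2 ^+ n) ^+ 2 by rewrite -exprM mulnC exprM; congr (_ ^+ _); ring.
  by field; rewrite expf_neq0 //= gt_eqF.
rewrite E in l3.
have l4 : X / (2 * K) * (W + H) ^+ 2 <= X / (2 * K) * K.
  by rewrite ler_wpM2l ?divr_ge0 ?ltW // ?mulr_gt0 // /K; lra.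
have l5 : X / (2 * K) * K = X / 2 by field; rewrite gt_eqF.
lra.
Qed.

(** Counterclockwise: lower, right, upper and left side. *)
Definition rectint f a b c d : R[i] :=
  cint a b (fun s => f (s +i* c)) + 'i * cint c d (fun s => f (b +i* s))
  - cint a b (fun s => f (s +i* d)) - 'i * cint c d (fun s => f (a +i* s)).

Definition rect_ccont f a b c d := forall p, rectangle a b c d p -> ccont f p.

Lemma cwithin_hor (a b y : R) : cwithin a b (fun s => s +i* y).
Proof.
apply/cwithinE => t _ e e0; exists e => // s _ st.
have -> : s +i* y - t +i* y = (s - t)%:C by apply: complex_eqE; rewrite ?cReB ?cImB //= subrr.
by rewrite normc_real.
Qed.

Lemma cwithin_ver (a b x : R) : cwithin a b (fun s => x +i* s).
Proof.
apply/cwithinE => t _ e e0; exists e => // s _ st.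
have -> : x +i* s - x +i* t = 'i * (s - t)%:C.
  by apply: complex_eqE; rewrite ?(cReB, cImB) ?(cReM, cImM) /=; ring.
by rewrite normc_mulI normc_real.
Qed.

Lemma rect_ccont_hor f a b c d y : rect_ccont f a b c d -> c <= y <= d ->
  cwithin a b (fun s => f (s +i* y)).
Proof.
move=> h yd; apply: (cwithin_comp (H := fun s => s +i* y)) => [t tab|]; last exact: cwithin_hor.
by apply: h; split => //=; move: tab; rewrite in_itv.
Qed.

Lemma rect_ccont_ver f a b c d x : rect_ccont f a b c d -> a <= x <= b ->
  cwithin c d (fun s => f (x +i* s)).
Proof.
move=> h yd; apply: (cwithin_comp (H := fun s => x +i* s)) => [t tab|]; last exact: cwithin_ver.
by apply: h; split => //=; move: tab; rewrite in_itv.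
Qed.

Lemma rectint_split f a m b c n d : rect_ccont f a b c d -> a <= m <= b -> c <= n <= d ->
  rectint f a b c d = rectint f a m c n + rectint f m b c n + rectint f a m n d + rectint f m b n d.
Proof.
move=> h mab ncd; rewrite /rectint.
have [/andP[am mb] /andP[cn nd]] := (mab, ncd).
have H y : c <= y <= d ->
  cint a b (fun s => f (s +i* y)) = cint a m (fun s => f (s +i* y)) +
  cint m b (fun s => f (s +i* y)).
  by move=> ycd; apply: cint_cat => //; exact: cwithin_integrable (rect_ccont_hor h ycd).
have V x : a <= x <= b ->
  cint c d (fun s => f (x +i* s)) = cint c n (fun s => f (x +i* s)) +
  cint n d (fun s => f (x +i* s)).
  by move=> xab; apply: cint_cat => //; exact: cwithin_integrable (rect_ccont_ver h xab).
rewrite !H ?V ?lexx ?(le_trans am) ?(le_trans cn) //; ring.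
Qed.

Lemma rectintD f g a b c d : a <= b -> c <= d -> rect_ccont f a b c d -> rect_ccont g a b c d ->
  rectint (fun z => f z + g z) a b c d = rectint f a b c d + rectint g a b c d.
Proof.
move=> ab cd hf hg; rewrite /rectint !cintD; first ring.
all: apply: cwithin_integrable;
  first [apply: rect_ccont_hor; [eassumption|] | apply: rect_ccont_ver; [eassumption|]];
  by rewrite lexx ?ab ?cd.
Qed.

Lemma rectint_le f a b c d M : a <= b -> c <= d -> rect_ccont f a b c d ->
  (forall p, rectangle a b c d p -> normc (f p) <= M) ->
  normc (rectint f a b c d) <= 4 * M * (b - a + (d - c)).
Proof.
move=> ab cd hf hM; rewrite /rectint.
have Hy y : c <= y <= d -> normc (cint a b (fun s => f (s +i* y))) <= 2 * M * (b - a).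
  move=> ycd; apply: normc_cint_le => //; first exact/cwithin_cmeasurable/(rect_ccont_hor hf).
  by move=> t tab; apply: hM; split => //=; move: tab; rewrite in_itv.
have Vx x : a <= x <= b -> normc ('i * cint c d (fun s => f (x +i* s))) <= 2 * M * (d - c).
  move=> xab; rewrite normc_mulI; apply: normc_cint_le => //;
    first exact/cwithin_cmeasurable/(rect_ccont_ver hf).
  by move=> t tab; apply: hM; split => //=; move: tab; rewrite in_itv.
have h1 : c <= c <= d by rewrite lexx.
have h2 : c <= d <= d by rewrite lexx cd.
have h3 : a <= a <= b by rewrite lexx.
have h4 : a <= b <= b by rewrite lexx ab.
have := Hy _ h1; have := Hy _ h2; have := Vx _ h3; have := Vx _ h4.
set p1 := cint a b _; set p2 := cint a b _; set q1 := 'i * _; set q2 := 'i * _.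
move=> a1 a2 a3 a4.
have := ler_normcB (p2 + q1 - p1) q2; have := ler_normcB (p2 + q1) p1; have := ler_normcD p2 q1;
  lra.
Qed.

Lemma pder_hor F z l : cder F z l -> pder (fun s => F (s +i* complex.Im z)) (complex.Re z) l.
Proof.
case: z => x y h; rewrite -[l]mulr1; apply: (pder_comp (g := fun s => s +i* y)) h _ => /=.
move=> e e0; exists 1 => // s _.
rewrite (_ : _ - _ - _ = 0); first by rewrite normc0 mulr_ge0 // ltW.
by apply: complex_eqE; rewrite ?(cReB, cImB) ?(cReM, cImM) /=; ring.
Qed.

Lemma pder_ver F z l : cder F z l -> pder (fun s => F (complex.Re z +i* s)) (complex.Im z) ('i * l).
Proof.
case: z => x y h; rewrite mulrC; apply: (pder_comp (g := fun s => x +i* s)) h _ => /=.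
move=> e e0; exists 1 => // s _.
rewrite (_ : _ - _ - _ = 0); first by rewrite normc0 mulr_ge0 // ltW.
by apply: complex_eqE; rewrite ?(cReB, cImB) ?(cReM, cImM) /=; ring.
Qed.

Lemma cint_point a H : cint a a H = 0.
Proof. by rewrite /cint !set_itv1 !Rintegral_set1. Qed.

(** Each side contributes a difference of two corner values of [F], and these cancel. A side of
    length 0 is treated apart, as [cint_FTC2] is about proper intervals. *)
Lemma rectint_primitive F f a b c d : a <= b -> c <= d -> rect_ccont f a b c d ->
  (forall p, rectangle a b c d p -> cder F p (f p)) -> rectint f a b c d = 0.
Proof.
move=> ab cd hf hF; rewrite /rectint.
have hd p : rectangle a b c d p -> ccont F p by move=> /hF /cder_cont.
have Hy y : c <= y <= d -> cint a b (fun s => f (s +i* y)) = F (b +i* y) - F (a +i* y).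
  move=> ycd; have [->|nab] := eqVneq a b; first by rewrite cint_point subrr.
  have lab : a < b by rewrite lt_def eq_sym nab.
  apply: (cint_FTC2 (g := fun s => F (s +i* y))) lab (rect_ccont_hor hd ycd)
    (rect_ccont_hor hf ycd) _.
  move=> t; rewrite in_itv /= => /andP[t1 t2].
  by apply: (pder_hor (z := t +i* y)); apply: hF; split => //=; rewrite !ltW.
have Vx x : a <= x <= b -> 'i * cint c d (fun s => f (x +i* s)) = F (x +i* d) - F (x +i* c).
  move=> xab; have [->|ncd] := eqVneq c d; first by rewrite cint_point subrr mulr0.
  have lcd : c < d by rewrite lt_def eq_sym ncd.
  have cf := rect_ccont_ver hf xab.
  rewrite -cintZ; last exact: cwithin_integrable.
  apply: (cint_FTC2 (g := fun s => F (x +i* s))) lcd (rect_ccont_ver hd xab) _ _.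
    by apply: cwithinM => //; exact: cwithin_cst.
  move=> t; rewrite in_itv /= => /andP[t1 t2].
  by apply: (pder_ver (z := x +i* t)); apply: hF; split => //=; rewrite !ltW.
by rewrite !Hy ?Vx ?lexx ?ab ?cd //; ring.
Qed.

Lemma eq_rectint f g a b c d : f =1 g -> rectint f a b c d = rectint g a b c d.
Proof. by move=> /funext ->. Qed.

(** Near a point, [f] is affine up to [e] times the distance. The affine part has a primitive and
    integrates to 0; the error times the perimeter has the quadratic size asked for by
    [additive_rectangle_function_eq0]. *)
Theorem goursat f a b c d : a <= b -> c <= d -> holo (rectangle a b c d) f ->
  rectint f a b c d = 0.
Proof.
move=> ab cd hf.
have cf : rect_ccont f a b c d by move=> p /hf [l /cder_cont].
have sub a' b' c' d' : a <= a' -> b' <= b -> c <= c' -> d' <= d ->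
    rectangle a' b' c' d' `<=` rectangle a b c d.
  move=> *; move=> [x y] [/= /andP[x1 x2] /andP[y1 y2]]; split => /=; lra.
apply: additive_rectangle_function_eq0 => //.
  move=> a' m b' c' n d' h1 h2 h3 h4 h5 h6; apply: rectint_split => // p hp.
  exact/cf/(sub a' b' c' d').
move=> p /hf [l hl] e e0.
(* The quarter offsets the factor 4 of [rectint_le]. Below, [h / 2] is chosen because two points of
   a rectangle are at most the sum of two sides apart. *)
have e4 : 0 < e / 4 by rewrite divr_gt0.
have [h h0 hh] := hl _ e4.
exists (h / 2) => [|a' b' c' d' pr h1 h2 h3 h4 h5 h6]; first by rewrite divr_gt0.
have [/andP[q1 q2] /andP[q3 q4]] := pr.
have ab' : a' <= b' by lra.
have cd' : c' <= d' by lra.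
pose g z := f p + l * (z - p); pose r z := f z - g z.
have dg q : cder g q l.
  have := cderD (cder_cst (f p) q) (cderZ l (cderB (cder_id q) (cder_cst p q))).
  by apply: eq_cder; rewrite // add0r subr0 mulr1.
have cg : rect_ccont g a' b' c' d' by move=> q _; exact: cder_cont (dg q).
have cr : rect_ccont r a' b' c' d'.
  move=> q /(sub a' b' c' d' h1 h2 h3 h4) /hf[m hm].
  exact: cder_cont (cderB hm (dg q)).
have fE z : f z = g z + r z by rewrite /r [RHS]addrC subrK.
rewrite (eq_rectint a' b' c' d' fE).
rewrite rectintD // (@rectint_primitive (fun z => f p * z + l / 2 * (z - p) ^+ 2) g) ?add0r //;
  last first.
  move=> q _; have D := cderX 2 (cderB (cder_id q) (cder_cst p q)).
  have := cderD (cderZ (f p) (cder_id q)) (cderZ (l / 2) D).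
  by apply: eq_cder => //; rewrite /g /= expr1; field.
apply: le_trans (@rectint_le _ _ _ _ _ (e / 4 * (b' - a' + (d' - c'))) ab' cd' cr _) _; last first.
  by rewrite le_eqVlt; apply/orP; left; apply/eqP; field.
move=> q [/andP[s1 s2] /andP[s3 s4]].
have n1 : normc (q - p) <= b' - a' + (d' - c').
  apply: le_trans (ler_normc_ReIm _) _; rewrite cReB cImB.
  apply: lerD; rewrite ler_norml; lra.
have rE : r q = f q - f p - l * (q - p) by rewrite /r /g opprD addrA.
rewrite rE; apply: le_trans (hh q _) _; first by apply: le_lt_trans n1 _; lra.
by rewrite ler_wpM2l // ltW.
Qed.

End Goursat.

(** * Local primitives; boundedness on closed discs *)

Section Primitive.
Context {R : realType}.
Implicit Types (a b c d e x y s t r : R) (f F : R[i] -> R[i]) (w z : R[i]).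

Lemma cint_FTC1 a b x (g : R -> R[i]) : cwithin a b g -> a < x < b ->
  pder (fun s => cint a s g) x (g x).
Proof.
move=> [g1 g2] /andP[ax xb]; have ab := lt_trans ax xb.
have [h1 _ _] := (continuous_within_itvP _ ab).1 g1.
have [h2 _ _] := (continuous_within_itvP _ ab).1 g2.
have xab : x \in `]a, b[ by rewrite in_itv /= ax.
have [d1 e1] := continuous_FTC1 xb (within_continuous_integrable g1) ax (h1 x xab).
have [d2 e2] := continuous_FTC1 xb (within_continuous_integrable g2) ax (h2 x xab).
apply/pderP; split.
  by split; [exact: d1|rewrite -derive1E; exact: e1].
by split; [exact: d2|rewrite -derive1E; exact: e2].
Qed.

Lemma pder_local (g h : R -> R[i]) t l : (exists2 d, 0 < d &
  forall s, `|s - t| < d -> g s = h s) -> pder g t l -> pder h t l.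
Proof.
move=> [d d0 gh] H e e0; have [d' d'0 k] := H _ e0.
exists (Num.min d d') => [|s]; first by rewrite lt_min d0.
rewrite lt_min => /andP[sd sd']; rewrite -!gh ?subrr ?normr0 //; exact: k.
Qed.

(** Go from [z] to [w] along a vertical and a horizontal leg and apply the mean value inequality to
    each; continuity at [z] makes [f] nearly constant along them. *)
Lemma cder_of_partials f F z r : 0 < r -> ccont f z ->
  (forall p, cball z r p -> pder (fun s => F (s +i* complex.Im p)) (complex.Re p) (f p)) ->
  (forall p, cball z r p -> pder (fun s => F (complex.Re p +i* s)) (complex.Im p) ('i * f p)) ->
  cder F z (f z).
Proof.
move=> r0 cf hx hy e e0.
have e8 : 0 < e / 8 by rewrite divr_gt0.
have [d d0 hd] := cf _ e8.
(* Points of the two legs are within [2 * normc (w - z)] of [z]; the halves keep them in both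
   discs. *)
pose m := Num.min (r / 2) (d / 2).
exists m => [|w]; first by rewrite lt_min !divr_gt0.
rewrite /m lt_min => /andP[wr wd].
case: z w cf hx hy hd wr wd => [x y] [x' y'] cf hx hy hd wr wd.
have b1 := ler_Re_normc (x' +i* y' - x +i* y).
have b2 := ler_Im_normc (x' +i* y' - x +i* y).
rewrite cReB [complex.Re _]/= [complex.Re (x +i* y)]/= in b1.
rewrite cImB [complex.Im _]/= [complex.Im (x +i* y)]/= in b2.
set n := normc (x' +i* y' - x +i* y) in wr wd b1 b2 *.
have near (u v : R) : `|u - x| <= n -> `|v - y| <= n ->
  normc (u +i* v - x +i* y) < r /\ normc (f (u +i* v) - f (x +i* y)) <= e / 8.
  move=> u1 v1; have h : normc (u +i* v - x +i* y) <= 2 * n.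
    apply: le_trans (ler_normc_ReIm _) _; rewrite cReB cImB /=; lra.
  by split; [lra|apply/ltW/hd; lra].
have gen (g dg : R -> R[i]) (u0 u1 : R) l : `|u1 - u0| <= n ->
    (forall u, `|u - u0| <= `|u1 - u0| -> pder g u (dg u)) ->
    (forall u, `|u - u0| <= `|u1 - u0| -> normc (dg u - l) <= e / 8) ->
    normc (g u1 - g u0 - l * (u1 - u0)%:C) <= e / 4 * `|u1 - u0|.
  move=> un hg hl; have [le|lt] := leP u0 u1.
    have -> : `|u1 - u0| = u1 - u0 by rewrite ger0_norm // subr_ge0.
    have -> : e / 4 = 2 * (e / 8) by field.
    apply: (@pder_mean_value _ u0 u1 (e / 8) g dg) => // u; rewrite in_itv /= => hu;
      [apply: hg|apply: hl];
      rewrite !ger0_norm; lra.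
  have -> : `|u1 - u0| = u0 - u1 by rewrite ltr0_norm ?opprB // subr_lt0.
  have -> : g u1 - g u0 - l * (u1 - u0)%:C = - (g u0 - g u1 - l * (u0 - u1)%:C).
    by rewrite !rmorphB /=; ring.
  rewrite normc_opp; have -> : e / 4 = 2 * (e / 8) by field.
  apply: (@pder_mean_value _ u1 u0 (e / 8) g dg) => [|u|u]; first exact: ltW.
    by rewrite in_itv /= => hu; apply: hg; rewrite !ler0_norm; lra.
  by rewrite in_itv /= => hu; apply: hl; rewrite !ler0_norm; lra.
have s1 := gen (fun s => F (s +i* y')) (fun s => f (s +i* y')) x x' (f (x +i* y)) b1.
have s2 := gen (fun s => F (x +i* s)) (fun s => 'i * f (x +i* s)) y y' ('i * f (x +i* y)) b2.
have {}s1 : normc (F (x' +i* y') - F (x +i* y') - f (x +i* y) * (x' - x)%:C) <= e / 4 * `|x' - x|.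
  apply: s1 => u hu; have [k1 k2] := near u y' (le_trans hu b1) b2 => //.
  exact: (hx (u +i* y')).
have {}s2 :
  normc (F (x +i* y') - F (x +i* y) - 'i * f (x +i* y) * (y' - y)%:C) <= e / 4 * `|y' - y|.
  apply: s2 => u hu; have [|k1 k2] := near x u _ (le_trans hu b2);
    rewrite ?subrr ?normr0 ?normc_ge0 //.
    exact: (hy (x +i* u)).
  by rewrite -mulrBr normc_mulI.
have -> : F (x' +i* y') - F (x +i* y) - f (x +i* y) * (x' +i* y' - x +i* y) =
  (F (x' +i* y') - F (x +i* y') - f (x +i* y) * (x' - x)%:C) +
  (F (x +i* y') - F (x +i* y) - 'i * f (x +i* y) * (y' - y)%:C).
  have -> : x' +i* y' - x +i* y = (x' - x)%:C + 'i * (y' - y)%:C.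
    by apply: complex_eqE; rewrite ?(cReD, cImD) ?(cReB, cImB) ?(cReM, cImM) /=; ring.
  by ring.
apply: le_trans (ler_normcD _ _) _.
have n0 : 0 <= n by exact: normc_ge0.
have := ler_wpM2l (ltW (divr_gt0 e0 (ltr0n R 4))) b1.
have := ler_wpM2l (ltW (divr_gt0 e0 (ltr0n R 4))) b2.
by nra.
Qed.

(** The primitive integrates along the lower side and then upwards; by Goursat's theorem it is also
    the integral up the left side and then to the right. The first form yields the vertical partial
    derivative, the second the horizontal one. *)
Lemma local_primitive f w r : 0 < r -> holo (cball w r) f ->
  exists F, forall z, cball w (r / 3) z -> cder F z (f z).
Proof.
move=> r0 hf.
(* A square with half-sides [r / 3] fits in the disc, since [r / 3 + r / 3 < r]. *)
pose a := complex.Re w - r / 3; pose b := complex.Re w + r / 3.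
pose c := complex.Im w - r / 3; pose d := complex.Im w + r / 3.
have sub : rectangle a b c d `<=` cball w r.
  move=> p [/andP[p1 p2] /andP[p3 p4]]; apply: le_lt_trans (ler_normc_ReIm _) _.
  rewrite cReB cImB /a /b /c /d in p1 p2 p3 p4 *.
  have : `|complex.Re p - complex.Re w| <= r / 3 by rewrite ler_norml; lra.
  have : `|complex.Im p - complex.Im w| <= r / 3 by rewrite ler_norml; lra.
  lra.
have cf : rect_ccont f a b c d by move=> p /sub /hf [l /cder_cont].
have inr z : cball w (r / 3) z -> (a < complex.Re z < b) /\ (c < complex.Im z < d).
  move=> zw; have := le_lt_trans (ler_Re_normc _) zw; have := le_lt_trans (ler_Im_normc _) zw.
  rewrite cReB cImB !ltr_norml /a /b /c /d => /andP[h1 h2] /andP[h3 h4]; split; lra.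
pose F z :=
  cint a (complex.Re z) (fun s => f (s +i* c)) +
  'i * cint c (complex.Im z) (fun s => f (complex.Re z +i* s)).
have FE z : a <= complex.Re z <= b -> c <= complex.Im z <= d ->
    F z = 'i * cint c (complex.Im z) (fun s => f (a +i* s)) +
      cint a (complex.Re z) (fun s => f (s +i* complex.Im z)).
  move=> /andP[z1 z2] /andP[z3 z4].
  have := @goursat _ f a (complex.Re z) c (complex.Im z) z1 z3.
  rewrite /rectint => /(_ _) g; apply/eqP; rewrite -subr_eq0; apply/eqP.
  rewrite /F -[RHS]g; first by ring.
  apply: holoW hf; apply: subset_trans sub => p [/andP[p1 p2] /andP[p3 p4]].
  by split; rewrite ?p1 ?p3 /=; lra.
exists F => z zw; have [/andP[z1 z2] /andP[z3 z4]] := inr z zw.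
have [d0 d00 hd0] := copen_cball zw.
have aff (k : R[i]) (l : R[i]) (g : R -> R[i]) t m : pder g t m ->
  pder (fun s => k + l * g s) t (l * m).
  move=> hg; apply: (pder_comp (f := fun u => k + l * u)) hg.
  have := cderD (cder_cst k (g t)) (cderZ l (cder_id (g t))).
  by apply: eq_cder; rewrite // add0r mulr1.
apply: (@cder_of_partials f F z d0) => //.
- by apply: cf; split; rewrite !ltW.
- move=> p pz; have pw := hd0 _ pz; have [h1 h2] := inr p pw.
  have [d1 d10 hd1] := copen_cball pw.
  apply: (@pder_local (fun s => 'i * cint c (complex.Im p) (fun u => f (a +i* u)) +
    1 * cint a s (fun u => f (u +i* complex.Im p)))).
    exists d1 => // s sd; rewrite mul1r FE //=.
      have [|/andP[q1 q2] _] := inr (s +i* complex.Im p).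
        apply: hd1; rewrite (_ : _ - p = (s - complex.Re p)%:C) ?normc_real //.
        by apply: complex_eqE; rewrite ?(cReB, cImB) //= subrr.
      by rewrite !ltW.
    by move: h2 => /andP[? ?]; rewrite !ltW.
  rewrite -[f p]mul1r; apply: aff; have -> : f p = f (complex.Re p +i* complex.Im p) by case: (p).
  apply: (cint_FTC1 (b := b)) => //; apply: rect_ccont_hor cf _.
  by move: h2 => /andP[? ?]; rewrite !ltW.
- move=> p pz; have pw := hd0 _ pz; have [h1 h2] := inr p pw.
  rewrite /F /=; apply: aff.
  have -> : f p = f (complex.Re p +i* complex.Im p) by case: (p).
  apply: (cint_FTC1 (b := d)) => //; apply: rect_ccont_ver cf _.
  by move: h1 => /andP[? ?]; rewrite !ltW.
Qed.

(** Compactness is transported from the real plane, where the disc is a closed subset of a product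
    of two segments. *)
Lemma closed_ball_bounded f w r : (forall z, normc (z - w) <= r -> ccont f z) ->
  exists M, forall z, normc (z - w) <= r -> normc (f z) <= M.
Proof.
move=> cf.
pose P (p : R * R) : R[i] := p.1 +i* p.2.
pose A : set (R * R) :=
  (`[complex.Re w - r, complex.Re w + r] `*` `[complex.Im w - r, complex.Im w + r]) `&`
  [set p | normc (P p - w) <= r].
have PB p q : normc (P p - P q) <= `|p.1 - q.1| + `|p.2 - q.2|.
  by apply: le_trans (ler_normc_ReIm _) _; rewrite cReB cImB.
have cP (p : R * R) e : 0 < e -> \forall q \near p, normc (P q - P p) < e.
  move=> e0; have e2 : 0 < e / 2 by rewrite divr_gt0.
  exists (ball p.1 (e / 2), ball p.2 (e / 2)); first by split; exact: nbhsx_ballx.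
  move=> [q1 q2] [b1 b2]; apply: le_lt_trans (PB _ _) _.
  by move: b1 b2; rewrite /ball /= => b1 b2; rewrite distrC (distrC q2); lra.
have cA : compact A.
  apply: (@subclosed_compact _ _
    (`[complex.Re w - r, complex.Re w + r] `*` `[complex.Im w - r, complex.Im w + r])).
  - apply: closedI.
      by apply: compact_closed; [exact: norm_hausdorff|apply: compact_setX; exact: segment_compact].
    move=> p hp /=; apply/ler_addgt0Pr => e e0.
    have [q [h1 h2]] := hp _ (cP p e e0).
    have {}h1 : normc (P q - w) <= r := h1.
    have {}h2 : normc (P q - P p) < e := h2.
    have := ler_distc_add (P p) (P q) w; rewrite (normcBC (P p) (P q)); lra.
  - by apply: compact_setX; exact: segment_compact.
  - by move=> p [].
have cg : {within A, continuous (fun p : R * R => normc (f (P p)))}.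
  apply/subspace_continuousP => p [_ /= pw]; apply/cvgrPdist_lt => e e0.
  have [d d0 hd] := cf _ pw e e0.
  rewrite near_withinE; near=> q => _.
  have /hd h : normc (P q - P p) < d by near: q; exact: cP.
  apply: le_lt_trans h; rewrite ler_norml.
  have := lerB_normc (f (P q)) (f (P p)); have := lerB_normc (f (P p)) (f (P q)).
  by rewrite (normcBC (f (P p))) /from_subspace; lra.
have /compact_bounded[M [_ mrt]] := continuous_compact cg cA.
exists (M + 1) => z zw; have := mrt (M + 1); rewrite ltrDl ltr01 => /(_ isT (normc (f z))) h.
apply: le_trans (ler_norm _) (h _).
exists (complex.Re z, complex.Im z); last by rewrite /P /=; case: (z).
have h1 := le_trans (ler_Re_normc _) zw; have h2 := le_trans (ler_Im_normc _) zw.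
split; last by rewrite /P /=; case: (z) zw.
move: h1 h2; rewrite cReB cImB !ler_norml => /andP[? ?] /andP[? ?].
by split; rewrite /= in_itv /=; lra.
Unshelve. all: by end_near. Qed.

End Primitive.

(** * Cauchy integrals and winding numbers along a path *)

Section ClosedPath.
Context {R : realType}.
Variable gamma : R -> R[i].
Hypothesis hg : piecewise_C1 gamma.
Implicit Types (f : R[i] -> R[i]) (w z : R[i]) (H : R -> R[i]) (d e K : R).

(* Without the factor [(2 * pi * 'i)^-1] of [winding_number]. *)
Definition winding z := pathint gamma (fun t => (gamma t - z)^-1).

Lemma quadratic_cder f z l d K : 0 < d ->
  (forall w, cball z d w -> normc (f w - f z - l * (w - z)) <= K * normc (w - z) ^+ 2) ->
  cder f z l.
Proof.
move=> d0 h e e0.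
have k0 : 0 < `|K| + 1 by rewrite ltr_wpDl.
exists (Num.min d (e / (`|K| + 1))) => [|w]; first by rewrite lt_min d0 divr_gt0.
rewrite lt_min ltr_pdivlMr // => /andP[/h hw we].
apply: le_trans hw _; rewrite expr2 mulrA; apply: ler_wpM2r; first exact: normc_ge0.
by have := normc_ge0 (w - z); have := ler_norm K; nra.
Qed.

(** A Taylor remainder that is quadratic uniformly in [t] survives integration, up to the constant
    of [pathint_bound], and so identifies the derivative of the integral. *)
Lemma cder_pathint (G : R[i] -> R -> R[i]) (G1 : R -> R[i]) z d K : 0 < d ->
  (forall w, cball z d w -> cwithin 0 1 (G w)) -> cwithin 0 1 G1 ->
  (forall w, cball z d w -> forall t, t \in `[0, 1] ->
     normc (G w t - G z t - G1 t * (w - z)) <= K * normc (w - z) ^+ 2) ->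
  cder (fun w => pathint gamma (G w)) z (pathint gamma G1).
Proof.
move=> d0 cG cG1 hK; have [L L0 hL] := pathint_bound hg.
have cz : cwithin 0 1 (G z) by exact/cG/cball_center.
apply: (@quadratic_cder _ z _ d (L * K)) => // w wz.
have cw := cG w wz.
rewrite -pathintB // [_ * (w - z)]mulrC -pathintZ // -pathintB //.
- rewrite -mulrA; apply: hL => [|t t01]; last by rewrite [(w - z) * _]mulrC; exact: hK.
  apply: cwithinB; [exact: cwithinB|apply: cwithinM => //; exact: cwithin_cst].
- exact: cwithinB.
- by apply: cwithinM => //; exact: cwithin_cst.
Qed.

Lemma cwithin_cauchy_kernel z n : (forall t, t \in `[0, 1] -> gamma t != z) ->
  cwithin 0 1 (fun t => (gamma t - z) ^- n).
Proof.
move=> hz; apply: cwithin_V => [|t /hz]; last by rewrite -subr_eq0 => ?; rewrite expf_neq0.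
by apply: cwithinX; apply: cwithinB; [exact: piecewise_C1_cwithin|exact: cwithin_cst].
Qed.

Lemma cder_kernel (u : R[i]) w n : u != w ->
  cder (fun v => (u - v) ^- n) w (n%:R * (u - w) ^- n.+1).
Proof.
rewrite -subr_eq0 => uw.
have := @cderV _ (fun v => (u - v) ^+ n) w _ (expf_neq0 n uw)
  (cderX n (cderB (cder_cst u w) (cder_id w))).
apply: eq_cder => // /=; case: n => [|n] /=; first by rewrite !mul0r mulr0.
by rewrite !exprS; set b := (u - w) ^+ n; field; rewrite uw expf_neq0.
Qed.

(** Within [d / 2] of [z] the distance to [u] is at least [d / 2], which bounds the second
    derivative of the kernel. The constant involves [u] through [d] alone, hence is uniform along a
    path. *)
Lemma kernel_taylor (u z : R[i]) n d : 0 < d -> d <= normc (u - z) ->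
  forall w, cball z (d / 2) w ->
  normc ((u - w) ^- n - (u - z) ^- n - n%:R * (u - z) ^- n.+1 * (w - z)) <=
  4 * (n%:R * n.+1%:R * (d / 2) ^- n.+2) * normc (w - z) ^+ 2.
Proof.
move=> d0 du w wz.
have d2 : 0 < d / 2 by rewrite divr_gt0.
have far v : cball z (d / 2) v -> d / 2 <= normc (u - v).
  by move=> vz; have := ler_distc_add u v z; rewrite /cball /= in vz; lra.
have ne v : cball z (d / 2) v -> u != v.
  by move=> /far h; rewrite -subr_eq0 -normc_gt0; lra.
apply: (@taylor2_ball _ (fun v => (u - v) ^- n) (fun v => n%:R * (u - v) ^- n.+1)
  (fun v => n%:R * (n.+1%:R * (u - v) ^- n.+2)) z (d / 2)) => //.
- by move=> v /ne; exact: cder_kernel.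
- by move=> v /ne h; apply: cderZ; exact: cder_kernel.
- move=> v vz; rewrite mulrA normcM normcM !normc_nat; apply: ler_wpM2l; first by rewrite mulr_ge0.
  rewrite normcV normcX lef_pV2 ?posrE ?exprn_gt0 //; last exact: lt_le_trans (far _ vz).
  by apply: lerXn2r; rewrite ?nnegrE ?far // ?normc_ge0 // ltW.
- exact: cball_center.
Qed.

Lemma cder_cauchy_integral H z n : cwithin 0 1 H ->
  (forall t, t \in `[0, 1] -> gamma t != z) ->
  cder (fun w => pathint gamma (fun t => H t * (gamma t - w) ^- n)) z
    (n%:R * pathint gamma (fun t => H t * (gamma t - z) ^- n.+1)).
Proof.
move=> cH hz; have [d d0 hd] := trace_compact hg hz.
have [M hM] := cwithin_cbounded cH.
have M0 : 0 <= M by apply: le_trans (normc_ge0 _) (hM 0 _); rewrite in_itv /= lexx ler01.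
have d2 : 0 < d / 2 by rewrite divr_gt0.
rewrite -pathintZ //; last by apply: cwithinM => //; exact: cwithin_cauchy_kernel.
apply: (@cder_pathint (fun w t => H t * (gamma t - w) ^- n) _ z (d / 2)
  (M * (4 * (n%:R * n.+1%:R * (d / 2) ^- n.+2)))) => //.
- move=> w wz; apply: cwithinM => //; apply: cwithin_cauchy_kernel => t /hd h.
  rewrite -subr_eq0 -normc_gt0; have := ler_distc_add (gamma t) w z.
  by rewrite /cball /= in wz; lra.
- by apply: cwithinM; [exact: cwithin_cst|apply: cwithinM => //; exact: cwithin_cauchy_kernel].
- move=> w wz t t01.
  have -> : H t * (gamma t - w) ^- n - H t * (gamma t - z) ^- n - n%:R *
    (H t * (gamma t - z) ^- n.+1) * (w - z)
    = H t * ((gamma t - w) ^- n - (gamma t - z) ^- n - n%:R * (gamma t - z) ^- n.+1 * (w - z))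
      by ring.
  rewrite normcM -[leRHS]mulrA; apply: ler_pM; rewrite ?normc_ge0 ?hM //.
  by apply: kernel_taylor => //; exact: hd.
Qed.

Hypothesis gamma_closed : gamma 1 = gamma 0.

Lemma pathint_closed (F f : R[i] -> R[i]) :
  (forall t, t \in `[0, 1] -> cder F (gamma t) (f (gamma t))) ->
  cwithin 0 1 (fun t => f (gamma t)) -> pathint gamma (fun t => f (gamma t)) = 0.
Proof. by move=> hF cf; rewrite (pathint_FTC hg hF cf) gamma_closed subrr. Qed.

(** The formal derivative along the segment is the integral of [(w - z) / (gamma - p s) ^ 2], which
    has a primitive and vanishes on a closed path. Subtracting it leaves a quadratic remainder, so
    [quadratic_constant] applies; [d ^- 3] bounds the three denominators. *)
Lemma winding_segment z w d : 0 < d ->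
  (forall s t, s \in `[0, 1] -> t \in `[0, 1] -> d <= normc (gamma t - (z + s%:C * (w - z)))) ->
  winding w = winding z.
Proof.
move=> d0 hd; have [L L0 hL] := pathint_bound hg.
pose p (s : R) := z + s%:C * (w - z).
have ne s t : s \in `[0, 1] -> t \in `[0, 1] -> gamma t - p s != 0.
  by move=> s01 t01; rewrite -normc_gt0; exact: lt_le_trans (hd s t s01 t01).
have ck s : s \in `[0, 1] -> cwithin 0 1 (fun t => (gamma t - p s)^-1).
  move=> s01; apply: (@cwithin_cauchy_kernel _ 1) => t t01.
  by rewrite -subr_eq0 ne.
have E : forall s t, s \in `[0, 1] -> t \in `[0, 1] ->
  normc (winding (p s) - winding (p t)) <= L * (d ^- 3 * normc (w - z) ^+ 2) * (s - t) ^+ 2.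
  move=> s t s01 t01.
  have Z : pathint gamma (fun x => (gamma x - p t) ^- 2) = 0.
    apply: (@pathint_closed (fun v => - (v - p t)^-1) (fun v => (v - p t) ^- 2)).
      move=> x x01;
        have := cderZ (-1)
        (@cderV _ (fun v => v - p t) (gamma x) _ (ne t x t01 x01)
        (cderB (cder_id (gamma x)) (cder_cst (p t) (gamma x)))).
      by apply: eq_cder => [v|]; rewrite ?mulN1r // subr0 mulr1 opprK.
    by apply: cwithin_cauchy_kernel => x x01; rewrite -subr_eq0 ne.
  have c2 : cwithin 0 1 (fun x => (gamma x - p t) ^- 2).
    by apply: cwithin_cauchy_kernel => x x01; rewrite -subr_eq0 ne.
  have {}Z : pathint gamma (fun x => (p s - p t) * (gamma x - p t) ^- 2) =
    0 by rewrite pathintZ // Z mulr0.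
  have c3 : cwithin 0 1 (fun x => (p s - p t) * (gamma x - p t) ^- 2).
    by apply: cwithinM => //; exact: cwithin_cst.
  have -> : winding (p s) - winding (p t) =
    pathint gamma
    (fun x => (gamma x - p s)^-1 - (gamma x - p t)^-1 - (p s - p t) * (gamma x - p t) ^- 2).
    rewrite pathintB ?Z ?subr0 // ?pathintB //; try exact: ck.
    by apply: cwithinB; exact: ck.
  rewrite -mulrA; apply: hL => [|x x01]; first by apply: cwithinB => //; apply: cwithinB; exact: ck.
  have h1 := ne s x s01 x01; have h2 := ne t x t01 x01.
  have -> : (gamma x - p s)^-1 - (gamma x - p t)^-1 - (p s - p t) * (gamma x - p t) ^- 2 =
     ((gamma x - p t) ^+ 2 * (gamma x - p s))^-1 * (p s - p t) ^+ 2 by field; rewrite h1 h2.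
  have -> : p s - p t = (s - t)%:C * (w - z) by rewrite /p rmorphB /=; ring.
  rewrite normcM exprMn normcM !normcX normc_real real_normK ?num_real //.
  rewrite [(s - t) ^+ 2 * _]mulrC mulrA; apply: ler_wpM2r; first exact: sqr_ge0.
  apply: ler_wpM2r; first exact: sqr_ge0.
  rewrite normcV normcM normcX lef_pV2 ?posrE ?exprn_gt0 //; last first.
    by rewrite mulr_gt0 ?exprn_gt0 ?normc_gt0.
  rewrite exprSr; apply: ler_pM; rewrite ?exprn_ge0 ?(ltW d0) ?hd //.
  by apply: lerXn2r; rewrite ?nnegrE ?hd ?normc_ge0 ?(ltW d0).
have := quadratic_constant E.
by rewrite /p rmorph1 rmorph0 mul1r mul0r addr0 subrKC.
Qed.

Lemma winding_locally_constant z : (forall t, t \in `[0, 1] -> gamma t != z) ->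
  exists2 d, 0 < d & forall w, normc (w - z) < d ->
    (forall t, t \in `[0, 1] -> gamma t != w) /\ winding w = winding z.
Proof.
move=> hz; have [d d0 hd] := trace_compact hg hz.
have d2 : 0 < d / 2 by rewrite divr_gt0.
exists (d / 2) => // w wz.
have far v : normc (v - z) <= normc (w - z) -> forall t, t \in `[0, 1] ->
  d / 2 <= normc (gamma t - v).
  by move=> vz t /hd h; have := ler_distc_add (gamma t) v z; lra.
split; first by move=> t t01; rewrite -subr_eq0 -normc_gt0; apply: lt_le_trans (far w _ t t01).
apply: (@winding_segment z w (d / 2)) => // s t s01 t01; apply: far => //.
exact: normc_segment.
Qed.

End ClosedPath.

(** * Cauchy's formula on circles and its consequences *)

Section LocalCauchy.
Context {R : realType}.
Implicit Types (f F : R[i] -> R[i]) (w z : R[i]) (r d e K M : R).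

Lemma circle_dist w z r t : 0 <= r -> r - normc (z - w) <= normc (circle w r t - z).
Proof.
move=> r0; have := ler_distc_add (circle w r t) z w; rewrite normc_circle //; lra.
Qed.

Lemma circle_avoids w z r t : cball w r z -> circle w r t != z.
Proof.
rewrite /cball /= => zr; have r0 : 0 <= r by apply: le_trans (normc_ge0 _) (ltW zr).
by rewrite -subr_eq0 -normc_gt0; apply: lt_le_trans (circle_dist w z t r0); rewrite subr_gt0.
Qed.

Lemma winding_circle w z r : cball w r z -> winding (circle w r) z = two_pi_i.
Proof.
move=> zr; have r0 : 0 < r by apply: le_lt_trans (normc_ge0 _) zr.
rewrite -(pathint_circle_center w r0).
apply: (@winding_segment _ _ (circle_piecewise_C1 w r) (circle_closed w r) w z (r - normc (z - w))).
  by rewrite subr_gt0.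
move=> s t s01 t01; apply: le_trans (circle_dist _ _ _ (ltW r0)).
by have := normc_segment z w s01; lra.
Qed.

(* The integral of [f (z + s (g t - z)) / (g t - z)] along the circle [g] does not
   depend on [s], since [f1 (z + s (v - z))] has a primitive in [v]; the claim
   compares [s = 1] with [s = 0]. *)
Lemma cauchy_circle_C2 f f1 f2 w r d M z : r < d ->
  (forall p, cball w d p -> cder f p (f1 p)) ->
  (forall p, cball w d p -> cder f1 p (f2 p)) ->
  (forall p, cball w d p -> normc (f2 p) <= M) -> cball w r z ->
  pathint (circle w r) (fun t => f (circle w r t) * (circle w r t - z)^-1) = two_pi_i * f z.
Proof.
move=> rd hf hf1 hM zr; have r0 : 0 < r by apply: le_lt_trans (normc_ge0 _) zr.
set g := circle w r.
have hg : piecewise_C1 g by exact: circle_piecewise_C1.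
have cg : g 1 = g 0 by exact: circle_closed.
have cgw := piecewise_C1_cwithin hg.
have gd t : cball w d (g t) by rewrite /cball /= normc_circle // ltW.
have zd : cball w d z by apply: lt_trans zr rd.
have gz t : g t - z != 0 by rewrite subr_eq0; exact: circle_avoids.
pose p (s t : R) := z + s%:C * (g t - z).
have pd s t : s \in `[0, 1] -> cball w d (p s t) by move=> s01; exact: segment_cball.
have cp s : cwithin 0 1 (p s).
  apply: cwithinD; first exact: cwithin_cst.
  by apply: cwithinM; [exact: cwithin_cst|apply: cwithinB => //; exact: cwithin_cst].
pose phi (s : R) := pathint g (fun t => f (p s t) * (g t - z)^-1).
have ck : cwithin 0 1 (fun t => (g t - z)^-1).
  by apply: cwithin_V => //; apply: cwithinB => //; exact: cwithin_cst.
have cf s : s \in `[0, 1] -> cwithin 0 1 (fun t => f (p s t)).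
  move=> s01; apply: (cwithin_comp (H := p s)) => // t _; exact: cder_cont (hf _ (pd s t s01)).
have cf1 s : s \in `[0, 1] -> cwithin 0 1 (fun t => f1 (p s t)).
  move=> s01; apply: (cwithin_comp (H := p s)) => // t _; exact: cder_cont (hf1 _ (pd s t s01)).
have [L L0 hL] := pathint_bound hg.
have M0 : 0 <= M by apply: le_trans (normc_ge0 _) (hM _ zd).
have gdist t : normc (g t - z) <= 2 * d.
  by apply: le_trans (ler_distc_add _ w _) _; have := gd t; move: zd;
    rewrite /cball /= (normcBC z); lra.
have Z s : s \in `[0, 1] -> pathint g (fun t => f1 (p s t)) = 0.
  (* The primitive [f (z + s * (v - z)) / s] excludes [s = 0], where the integrand is constant. *)
  move=> s01; have [->|s0] := eqVneq s 0.
    have E t : p 0 t = z by rewrite /p mul0r addr0.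
    rewrite (eq_pathint _ (K := fun=> f1 z)); last by move=> t _; rewrite E.
    apply: (@pathint_closed _ g hg cg (fun v => f1 z * v) (fun=> f1 z)) => [t _|];
      last exact: cwithin_cst.
    by apply: eq_cder (cderZ (f1 z) (cder_id (g t))) => //; rewrite mulr1.
  have sC : s%:C != 0 by rewrite -normc_gt0 normc_real normr_gt0.
  apply: (@pathint_closed _ g hg cg (fun v => s%:C^-1 * f (z + s%:C * (v - z)))
    (fun v => f1 (z + s%:C * (v - z)))) => [t _|]; last exact: cf1.
  have h := cderD (cder_cst z (g t)) (cderZ s%:C (cderB (cder_id (g t)) (cder_cst z (g t)))).
  have := cderZ s%:C^-1 (cder_comp (f := f) h (hf _ (pd s t s01))).
  by apply: eq_cder => //; rewrite add0r subr0 mulr1 mulrC mulfK.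
(* The Taylor remainder is quadratic in [(s - t) * (g x - z)]: one factor [g x - z] cancels the
   kernel, the other is at most [2 * d]. *)
have E : forall s t, s \in `[0, 1] -> t \in `[0, 1] ->
  normc (phi s - phi t) <= L * (4 * M * (2 * d)) * (s - t) ^+ 2.
  move=> s t s01 t01.
  have cs := cwithinM (cf s s01) ck; have ct := cwithinM (cf t t01) ck.
  have cst := cwithinB cs ct; have cu := cwithinM (cwithin_cst 0 1 (s - t)%:C) (cf1 t t01).
  have -> : phi s - phi t =
    pathint g (fun x => f (p s x) * (g x - z)^-1 - f (p t x) * (g x - z)^-1 - (s - t)%:C * f1
    (p t x)).
    rewrite (pathintB hg cst cu) (pathintZ hg _ (cf1 t t01)) (Z t t01) mulr0 subr0.
    by rewrite (pathintB hg cs ct).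
  rewrite -mulrA; apply: hL => [|x _]; first exact: (cwithinB cst cu).
  have pst : p s x - p t x = (s - t)%:C * (g x - z) by rewrite /p rmorphB /=; ring.
  have -> : f (p s x) * (g x - z)^-1 - f (p t x) * (g x - z)^-1 - (s - t)%:C * f1 (p t x) =
     (f (p s x) - f (p t x) - f1 (p t x) * (p s x - p t x)) * (g x - z)^-1 by rewrite pst; field.
  have := taylor2_ball hf hf1 hM (pd s x s01) (pd t x t01).
  rewrite pst normcM normc_real exprMn real_normK ?num_real // => T.
  have nz : 0 < normc (g x - z) by rewrite normc_gt0.
  rewrite normc_div ler_pdivrMr //; apply: le_trans T _.
  have := gdist x; set N := normc _ in nz * => Nd.
  have -> : 4 * M * ((s - t) ^+ 2 * N ^+ 2) = 4 * M * (s - t) ^+ 2 * N * N by ring.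
  have -> : 4 * M * (2 * d) * (s - t) ^+ 2 * N = 4 * M * (s - t) ^+ 2 * N * (2 * d) by ring.
  apply: ler_wpM2l => //.
  exact: mulr_ge0 (mulr_ge0 (mulr_ge0 (ler0n _ 4) M0) (sqr_ge0 _)) (ltW nz).
have := quadratic_constant E.
rewrite /phi; have p1 t : p 1 t = g t by rewrite /p rmorph1 mul1r subrKC.
have p0 t : p 0 t = z by rewrite /p mul0r addr0.
rewrite (eq_pathint _ (K := fun t => f (g t) * (g t - z)^-1)); last by move=> t _; rewrite p1.
move=> ->; rewrite (eq_pathint _ (K := fun t => f z * (g t - z)^-1)); last by move=> t _;
  rewrite p0.
by rewrite pathintZ // mulrC; congr (_ * _); exact: winding_circle.
Qed.

(* Zero where [f] has no complex derivative. *)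
Definition cderiv f z : R[i] := xget 0 [set l | cder f z l].

Lemma cderivE f z l : cder f z l -> cderiv f z = l.
Proof.
move=> h; rewrite /cderiv; case: xgetP => [m _ hm|]; first exact: cder_uniq hm h.
by move=> /(_ l).
Qed.

Lemma holo_cder (U : set R[i]) f z : holo U f -> U z -> cder f z (cderiv f z).
Proof. by move=> hf /hf [l hl]; rewrite (cderivE hl). Qed.

Definition circle_kernel f w r n z :=
  pathint (circle w r) (fun t => f (circle w r t) * (circle w r t - z) ^- n).

Lemma cder_circle_kernel f w r n z :
  (forall t, ccont f (circle w r t)) -> cball w r z ->
  cder (circle_kernel f w r n) z (n%:R * circle_kernel f w r n.+1 z).
Proof.
move=> cf zr; have hg := circle_piecewise_C1 w r.
apply: (@cder_cauchy_integral _ _ hg (fun t => f (circle w r t))) => [|t _];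
  last exact: circle_avoids.
by apply: (cwithin_comp (H := circle w r)) => [t _|]; [exact: cf|exact: piecewise_C1_cwithin].
Qed.

(* Goursat gives primitives [F2] of [F1] of [f]. Cauchy's formula for C2 functions
   applies to [F2], whose third derivative is thus again a Cauchy integral. *)
Lemma cder_cderiv f w r : 0 < r -> holo (cball w r) f -> exists l, cder (cderiv f) w l.
Proof.
move=> r0 hf.
have [F1 hF1] := local_primitive r0 hf.
have r3 : 0 < r / 3 by rewrite divr_gt0.
have [F2 hF2] : exists F2, forall z, cball w (r / 3 / 3) z -> cder F2 z (F1 z).
  by apply: local_primitive => // z /hF1; exists (f z).
(* [f] is the second derivative of [F2], and [cauchy_circle_C2] asks for a bound on it: near [w],
   continuity provides [normc (f w) + 1]. *)
have [l0 /cder_cont /ccont_le[d0 d00 hd0]] := hf w (cball_center w r0).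
pose d := Num.min (r / 3 / 3) d0.
have d_gt0 : 0 < d by rewrite lt_min !divr_gt0.
have [dr dd0] : d <= r / 3 / 3 /\ d <= d0 by rewrite !ge_min !lexx orbT.
have q0 : 0 < d / 2 by rewrite divr_gt0.
have qd : d / 2 < d by lra.
have sub p : cball w d p -> cball w (r / 3 / 3) p by move=> h; exact: lt_le_trans h dr.
have sub3 p : cball w d p -> cball w (r / 3) p.
  by move=> /sub h; apply: lt_trans h _; rewrite ltr_pdivrMr //; lra.
have subq p : cball w (d / 2) p -> cball w d p by move=> h; exact: lt_trans h qd.
pose c := two_pi_i^-1 : R[i].
(* Each derivative raises the exponent of the kernel by one: [F2], [F1], [f] and [cderiv f] are
   multiples of [K 1], [K 2], [K 3] and [K 4], and [K 4] is again differentiable. *)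
pose K n z := circle_kernel F2 w (d / 2) n z.
have KF z : cball w (d / 2) z -> F2 z = c * K 1%N z.
  move=> zq; rewrite /K /circle_kernel /c.
  rewrite (eq_pathint _ (K := fun t => F2 (circle w (d / 2) t) * (circle w (d / 2) t - z)^-1));
    last by move=> t _; rewrite expr1.
  rewrite (@cauchy_circle_C2 F2 F1 f w (d / 2) d (normc (f w) + 1) z) ?mulKf ?two_pi_i_neq0 //.
  - by move=> p /sub /hF2.
  - by move=> p /sub3 /hF1.
  - by move=> p pd; apply: hd0; exact: lt_le_trans pd dd0.
have cF2 t : ccont F2 (circle w (d / 2) t).
  apply: cder_cont (hF2 _ _); apply: sub; rewrite /cball /= normc_circle //; exact: ltW.
have dK n z : cball w (d / 2) z -> cder (K n) z (n%:R * K n.+1 z) by exact: cder_circle_kernel.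
have oq := @copen_cball R w (d / 2).
have KF1 z : cball w (d / 2) z -> F1 z = c * (1 * K 2%N z).
  move=> zq; apply: cder_uniq (hF2 z (sub _ (subq _ zq))) _.
  by apply: (cder_open oq zq _ (cderZ c (dK 1%N z zq))) => v /KF.
have Kf z : cball w (d / 2) z -> f z = c * (1 * (2 * K 3%N z)).
  move=> zq; apply: cder_uniq (hF1 z (sub3 _ (subq _ zq))) _.
  by apply: (cder_open oq zq _ (cderZ c (cderZ 1 (dK 2%N z zq)))) => v /KF1.
have Kf1 z : cball w (d / 2) z -> cderiv f z = c * (1 * (2 * (3 * K 4%N z))).
  move=> zq; apply: cderivE.
  by apply: (cder_open oq zq _ (cderZ c (cderZ 1 (cderZ 2 (dK 3%N z zq))))) => v /Kf.
have wq := cball_center w q0.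
eexists; apply: (cder_open oq wq _ (cderZ c (cderZ 1 (cderZ 2 (cderZ 3 (dK 4%N w wq)))))) => v vq.
by rewrite Kf1.
Qed.

Lemma holo_cderiv (U : set R[i]) f : copen U -> holo U f -> holo U (cderiv f).
Proof.
move=> oU hf z /oU[d d0 hd]; apply: (@cder_cderiv f z d d0).
by move=> v /hd /hf.
Qed.

(** The C2 case applies on the disc of radius [(r + d) / 2]: its closure lies in the domain, so the
    second derivative, which exists by [holo_cderiv], is bounded there. *)
Theorem cauchy_circle f w r d z : r < d -> holo (cball w d) f -> cball w r z ->
  pathint (circle w r) (fun t => f (circle w r t) * (circle w r t - z)^-1) = two_pi_i * f z.
Proof.
move=> rd hf zr; have r0 : 0 < r by apply: le_lt_trans (normc_ge0 _) zr.
have h1 := holo_cderiv (@copen_cball R w d) hf; have h2 := holo_cderiv (@copen_cball R w d) h1.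
have rdd : (r + d) / 2 < d by lra.
have [M hM] : exists M, forall v, normc (v - w) <= (r + d) / 2 -> normc (cderiv (cderiv f) v) <= M.
  by apply: closed_ball_bounded => v vw; have [l /cder_cont] := h2 v (le_lt_trans vw rdd).
have sub v : cball w ((r + d) / 2) v -> cball w d v by rewrite /cball /=; lra.
apply: (@cauchy_circle_C2 f (cderiv f) (cderiv (cderiv f)) w r ((r + d) / 2) M) => //; first by lra.
- by move=> p /sub; exact: holo_cder.
- by move=> p /sub; exact: holo_cder.
- by move=> p /ltW; exact: hM.
Qed.

Lemma cauchy_circle_derivatives f w r d z : r < d -> holo (cball w d) f -> cball w r z ->
  two_pi_i * cderiv f z = circle_kernel f w r 2 z /\
  two_pi_i * cderiv (cderiv f) z = 2 * circle_kernel f w r 3 z.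
Proof.
move=> rd hf zr; have r0 : 0 < r by apply: le_lt_trans (normc_ge0 _) zr.
have c0 := @two_pi_i_neq0 R.
have cf t : ccont f (circle w r t).
  have [|l /cder_cont //] := hf (circle w r t).
  by rewrite /cball /= normc_circle // ltW.
have E v : cball w r v -> f v = two_pi_i^-1 * circle_kernel f w r 1 v.
  move=> vr; rewrite /circle_kernel
    (eq_pathint _ (K := fun t => f (circle w r t) * (circle w r t - v)^-1)).
    by rewrite (cauchy_circle rd hf vr) mulKf.
  by move=> t _; rewrite expr1.
have E1 v : cball w r v -> cderiv f v = two_pi_i^-1 * (1 * circle_kernel f w r 2 v).
  move=> vr; apply: cderivE.
  by apply: (cder_open (@copen_cball R w r) vr _ (cderZ _ (cder_circle_kernel 1 cf vr))) => u /E.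
rewrite E1 // mul1r mulVKf //; split=> //.
rewrite (@cderivE _ _ (two_pi_i^-1 * (1 * (2 * circle_kernel f w r 3 z))));
  first by rewrite mul1r mulVKf.
by apply: (cder_open (@copen_cball R w r) zr _ (cderZ _ (cderZ 1 (cder_circle_kernel 2 cf zr)))) =>
  u /E1.
Qed.

(** From the integral formulas on the circle of radius [d / 2], at least [d / 4] away from [z]. As
    [K] depends on [d] alone, a uniformly bounded family of functions has uniformly bounded
    derivatives. *)
Lemma cauchy_estimate d : 0 < d -> exists2 K, 0 <= K & forall f w M,
  holo (cball w d) f -> (forall z, cball w d z -> normc (f z) <= M) ->
  forall z, cball w (d / 4) z ->
    normc (cderiv f z) <= K * M /\ normc (cderiv (cderiv f) z) <= K * M.
Proof.
move=> d0; pose r := d / 2.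
have r0 : 0 < r by rewrite divr_gt0.
have d4 : 0 < d / 4 by rewrite divr_gt0.
pose V := 2 * pi * r : R.
have V0 : 0 <= V by rewrite mulr_ge0 ?mulr_ge0 ?pi_ge0 // ltW.
pose B n := (normc (two_pi_i : R[i]))^-1 * (2 * V * (d / 4) ^- n).
have B0 n : 0 <= B n.
  apply: mulr_ge0; first by rewrite invr_ge0 normc_ge0.
  apply: mulr_ge0; first by apply: mulr_ge0.
  by rewrite invr_ge0 exprn_ge0 // ltW.
exists (B 2%N + 2 * B 3%N) => [|f w M hf hM z zd];
  first exact: addr_ge0 (B0 _) (mulr_ge0 (ler0n _ 2) (B0 _)).
have rd : r < d by rewrite /r; lra.
have zr : cball w r z by apply: lt_trans zd _; rewrite /r; lra.
have [e1 e2] := cauchy_circle_derivatives rd hf zr.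
have M0 : 0 <= M by apply: le_trans (normc_ge0 _) (hM w (cball_center w d0)).
have gd t : cball w d (circle w r t) by rewrite /cball /= normc_circle // ltW.
have Kn n : (normc (two_pi_i : R[i]))^-1 * normc (circle_kernel f w r n z) <= B n * M.
  rewrite /B -mulrA; apply: ler_wpM2l; first by rewrite invr_ge0 normc_ge0.
  rewrite -[leRHS]mulrA; apply: (pathint_le (circle_piecewise_C1 w r)) => [t _||t _].
  - by rewrite normc_velocity_circle // ltW.
  - apply: cwithinM.
      apply: (cwithin_comp (H := circle w r)) => [t _|];
        last exact: piecewise_C1_cwithin (circle_piecewise_C1 w r).
      by have [l /cder_cont] := hf _ (gd t).
    apply: cwithin_cauchy_kernel; first exact: circle_piecewise_C1.
    by move=> t _; exact: circle_avoids.
  - rewrite normcM mulrC; apply: ler_pM; rewrite ?normc_ge0 ?hM //.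
    have far : d / 4 <= normc (circle w r t - z).
      by apply: le_trans (circle_dist _ _ _ (ltW r0)); move: zd; rewrite /cball /= /r; lra.
    rewrite normcV normcX lef_pV2 ?posrE ?exprn_gt0 //; last exact: lt_le_trans far.
    by apply: lerXn2r; rewrite ?nnegrE ?normc_ge0 // ltW.
have c0 : 0 < normc (two_pi_i : R[i]) by rewrite normc_gt0 two_pi_i_neq0.
have {}e1 : normc (cderiv f z) = (normc (two_pi_i : R[i]))^-1 * normc (circle_kernel f w r 2 z).
  by rewrite -e1 normcM mulKf // gt_eqF.
have {}e2 :
  normc (cderiv (cderiv f) z) =
  2 * ((normc (two_pi_i : R[i]))^-1 * normc (circle_kernel f w r 3 z)).
  have := congr1 (@normc R) e2; rewrite !normcM normc_nat => E.
  by rewrite mulrCA -E mulKf // gt_eqF.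
have := Kn 2%N; have := Kn 3%N; rewrite e1 e2.
have := mulr_ge0 (B0 2%N) M0; have := mulr_ge0 (B0 3%N) M0.
rewrite mulrDl -(mulrA 2 (B 3%N)); split; lra.
Qed.

Lemma cwithin_uniform_limit (a b : R) (H : R -> R[i]) :
  (forall e, 0 < e -> exists2 K, cwithin a b K & forall t, t \in `[a, b] -> normc (K t - H t) <= e)
    ->
  cwithin a b H.
Proof.
move=> h; apply/cwithinE => t tab e e0.
have e4 : 0 < e / 4 by rewrite divr_gt0.
have [K /cwithinE cK hK] := h _ e4.
have [d d0 hd] := cK t tab _ e4; exists d => // s sab /(hd s sab) st.
have := hK s sab; have := hK t tab; rewrite (normcBC (K s)) => k1 k2.
have := ler_distc_add (H s) (K s) (H t); have := ler_distc_add (K s) (K t) (H t); lra.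
Qed.

(** Cauchy's estimates turn the bound [M] into a Taylor bound uniform in [t], as [cder_pathint]
    wants. This plays the part of Morera's theorem in Dixon's argument, and it also handles partial
    derivatives in several variables. *)
Lemma holo_pathint (gamma : R -> R[i]) (G : R[i] -> R -> R[i]) w d M :
  piecewise_C1 gamma -> 0 < d ->
  (forall t, t \in `[0, 1] -> holo (cball w d) (fun z => G z t)) ->
  (forall z t, cball w d z -> t \in `[0, 1] -> normc (G z t) <= M) ->
  (forall z, cball w d z -> cwithin 0 1 (G z)) ->
  exists l, cder (fun z => pathint gamma (G z)) w l.
Proof.
move=> hg d0 hG hM cG.
have [K K0 hK] := cauchy_estimate d0.
have d4 : 0 < d / 4 by rewrite divr_gt0.
have ww := cball_center w d4.
have sub v : cball w (d / 4) v -> cball w d v by rewrite /cball /=; lra.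
pose G1 t := cderiv (fun z => G z t) w.
have T z t : cball w (d / 4) z -> t \in `[0, 1] ->
    normc (G z t - G w t - G1 t * (z - w)) <= 4 * (K * M) * normc (z - w) ^+ 2.
  move=> zw t01; have hGt := hG t t01; have h1 := holo_cderiv (@copen_cball R w d) hGt.
  apply: (@taylor2_ball _ (fun z => G z t) (cderiv (fun z => G z t))
    (cderiv (cderiv (fun z => G z t))) w (d / 4)) => //.
  - by move=> v /sub; exact: holo_cder.
  - by move=> v /sub; exact: holo_cder.
  - move=> v vw; have [] := hK (fun z => G z t) w M hGt _ v vw => // u uw; exact: hM.
exists (pathint gamma G1).
apply: (@cder_pathint _ gamma hg G G1 w (d / 4) (4 * (K * M))) => //.
- by move=> v /sub; exact: cG.
(* [G1] is continuous in [t] as a uniform limit of difference quotients with real step [h], whose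
   error is at most [4 * (K * M) * h <= e]. The cap [d / 8] keeps [w + h] in the disc of radius
   [d / 4]. *)
- apply: cwithin_uniform_limit => e e0.
  pose C := 4 * `|K * M| + 1.
  have C0 : 0 < C by rewrite ltr_wpDl // mulr_ge0.
  pose h := Num.min (d / 8) (e / C).
  have h0 : 0 < h by rewrite lt_min !divr_gt0.
  have [hd hC] : h <= d / 8 /\ h <= e / C by rewrite !ge_min !lexx orbT.
  have zE : normc (w + h%:C - w) = h by rewrite addrC addKr normc_real gtr0_norm.
  have zw : cball w (d / 4) (w + h%:C) by rewrite /cball /= zE; lra.
  have hC0 : h%:C != 0 by rewrite -normc_gt0 normc_real gtr0_norm.
  exists (fun t => h%:C^-1 * (G (w + h%:C) t - G w t)).
    by apply: cwithinM; [exact: cwithin_cst|apply: cwithinB; apply: cG; exact: sub].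
  move=> t t01; have := T _ t zw t01.
  have -> : G (w + h%:C) t - G w t - G1 t * (w + h%:C - w) =
    h%:C * (h%:C^-1 * (G (w + h%:C) t - G w t) - G1 t) by field.
  rewrite normcM zE normc_real gtr0_norm // expr2 mulrCA ler_pM2l // => hT.
  apply: le_trans hT _; rewrite ler_pdivlMr // in hC.
  apply: le_trans hC; rewrite mulrC; apply: ler_wpM2l; first exact: ltW.
  by have := ler_norm (K * M); rewrite /C; lra.
- by move=> z zw t t01; exact: T.
Qed.

End LocalCauchy.

(** * The homological Cauchy formula *)

Section GlobalCauchy.
Context {R : realType}.
Implicit Types (f F : R[i] -> R[i]) (w z : R[i]) (r d e K M : R) (U : set R[i]).

Definition dquot f z w := if z == w then cderiv f z else (f z - f w) / (z - w).

Lemma dquotC f z w : dquot f z w = dquot f w z.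
Proof.
rewrite /dquot eq_sym; case: eqVneq => [->//|wz].
by rewrite -opprB -[z - w]opprB invrN mulrNN.
Qed.

(** The divided difference of the Cauchy kernel is the product of two kernels. The case [z = v] is
    the formula for the derivative, so the integral shows holomorphy in [z] across the diagonal. *)
Lemma dquot_circle f w r d z v : r < d -> holo (cball w d) f ->
  cball w r z -> cball w r v ->
  dquot f z v = two_pi_i^-1 *
    pathint (circle w r)
      (fun t => f (circle w r t) * (circle w r t - v)^-1 * (circle w r t - z) ^- 1).
Proof.
move=> rd hf zr vr; rewrite /dquot; have c0 := @two_pi_i_neq0 R.
have hg := circle_piecewise_C1 w r.
have gz t : circle w r t - z != 0 by rewrite subr_eq0 circle_avoids.
have gv t : circle w r t - v != 0 by rewrite subr_eq0 circle_avoids.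
case: eqVneq => [E|zv].
  have [h _] := cauchy_circle_derivatives rd hf zr.
  apply: (mulfI c0); rewrite h mulVKf //; apply: eq_pathint => t _.
  by rewrite -E expr1 -mulrA -invfM expr2.
have r0 : 0 < r by apply: le_lt_trans (normc_ge0 _) zr.
have cf : cwithin 0 1 (fun t => f (circle w r t)).
  apply: (cwithin_comp (H := circle w r)) => [t _|]; last exact: piecewise_C1_cwithin.
  have [|l /cder_cont //] := hf (circle w r t).
  by rewrite /cball /= normc_circle // ltW.
have ck p : cball w r p -> cwithin 0 1 (fun t => f (circle w r t) * (circle w r t - p)^-1).
  move=> pr; apply: cwithinM => //; apply: (@cwithin_cauchy_kernel _ _ hg p 1) => t _.
  exact: circle_avoids.
have e1 := cauchy_circle rd hf zr; have e2 := cauchy_circle rd hf vr.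
have zv0 : z - v != 0 by rewrite subr_eq0.
apply: (mulIf zv0); rewrite mulfVK //; apply: (mulfI c0).
rewrite mulrBr -e1 -e2 -(pathintB hg (ck _ zr) (ck _ vr)) mulrA mulVKf // mulrC -(pathintZ hg).
  by apply: eq_pathint => t _; rewrite expr1; field; rewrite gz gv.
apply: cwithinM; first exact: ck.
by apply: (cwithin_cauchy_kernel hg) => t _; exact: circle_avoids.
Qed.

Lemma dquot_holo U f w : copen U -> holo U f -> U w -> holo U (fun z => dquot f z w).
Proof.
move=> oU hf Uw z Uz; have [->|zw] := eqVneq z w.
  have [d d0 hd] := oU _ Uw; have r0 : 0 < d / 2 by rewrite divr_gt0.
  have rd : d / 2 < d by lra.
  have hfd : holo (cball w d) f by apply: holoW hf => v; exact: hd.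
  have wr := cball_center w r0; have hg := circle_piecewise_C1 w (d / 2).
  eexists; apply: (cder_open (@copen_cball R w (d / 2)) wr
    (fun v vr => esym (dquot_circle rd hfd vr wr))).
  apply: cderZ;
    apply: (@cder_cauchy_integral _ _ hg
    (fun t => f (circle w (d / 2) t) * (circle w (d / 2) t - w)^-1) w 1).
    apply: cwithinM.
      apply: (cwithin_comp (H := circle w (d / 2))) => [t _|]; last exact: piecewise_C1_cwithin.
      have [|l /cder_cont //] := hfd (circle w (d / 2) t).
      by rewrite /cball /= normc_circle // ltW.
    by apply: (@cwithin_cauchy_kernel _ _ hg w 1) => t _; exact: circle_avoids.
  by move=> t _; exact: circle_avoids.
have zw0 : z - w != 0 by rewrite subr_eq0.
have h1 := cderB (holo_cder hf Uz) (cder_cst (f w) z).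
have h2 := @cderV _ (fun v => v - w) z _ zw0 (cderB (cder_id z) (cder_cst w z)).
eexists; apply: cder_local (cderM h1 h2).
exists (normc (z - w)) => [|v vz]; first by rewrite normc_gt0.
rewrite /dquot ifN //; apply: contraTneq vz => ->.
by rewrite normcBC ltxx.
Qed.

Variable gamma : R -> R[i].
Hypothesis hg : piecewise_C1 gamma.
Hypothesis gamma_closed : gamma 1 = gamma 0.
Local Notation W := (winding gamma).

Lemma path_bounded : exists2 B, 0 <= B & forall t, t \in `[0, 1] -> normc (gamma t) <= B.
Proof.
have [B hB] := cwithin_cbounded (piecewise_C1_cwithin hg).
exists B => //; apply: le_trans (normc_ge0 (gamma 0)) (hB 0 _).
by rewrite in_itv /= lexx ler01.
Qed.

(** The ray from [z] away from the origin avoids the path, so the winding number is constant on it,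
    while the integral is at most [L] over the distance to the path. *)
Lemma winding_far B z : (forall t, t \in `[0, 1] -> normc (gamma t) <= B) -> B < normc z -> W z = 0.
Proof.
move=> hB Bz; apply/eqP; rewrite -normc_eq0; apply: contraT => n0.
have p0 : 0 < normc (W z) by rewrite lt_def n0 normc_ge0.
have B0 : 0 <= B by apply: le_trans (normc_ge0 (gamma 0)) (hB 0 _); rewrite in_itv /= lexx ler01.
have [L L0 hL] := pathint_bound hg.
have z0 : 0 < normc z by exact: le_lt_trans Bz.
have k0 : 0 <= (L / normc (W z) + 1 + B) / normc z.
  by rewrite divr_ge0 ?normc_ge0 // addr_ge0 // addr_ge0 // divr_ge0 ?normc_ge0.
(* At [k * z] the distance to the path is at least [L / normc (W z) + 1], which would force
   [normc (W z)] below itself. The summand 1 gives [k >= 1], so the segment moves away from the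
   origin. *)
pose k := (L / normc (W z) + 1 + B) / normc z + 1.
have kz : normc (k%:C * z) = L / normc (W z) + 1 + B + normc z.
  by rewrite normcM normc_real ger0_norm ?addr_ge0 // mulrDl mul1r divfK ?gt_eqF.
have E : W (k%:C * z) = W z.
  apply: (@winding_segment _ _ hg gamma_closed z (k%:C * z) (normc z - B));
    first by rewrite subr_gt0.
  move=> s t; rewrite in_itv /= => /andP[s0 s1] /hB gB.
  have -> : z + s%:C * (k%:C * z - z) = (1 + s * (k - 1))%:C * z.
    by rewrite !(rmorphD, rmorphM, rmorphB, rmorph1) /=; ring.
  have h : 1 <= 1 + s * (k - 1) by rewrite lerDl mulr_ge0 // /k addrK.
  have := lerB_normc ((1 + s * (k - 1))%:C * z) (gamma t).
  rewrite normcM normc_real ger0_norm ?(le_trans ler01) // normcBC.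
  have : normc z <= (1 + s * (k - 1)) * normc z by rewrite ler_peMl ?normc_ge0.
  lra.
have far t : t \in `[0, 1] -> L / normc (W z) + 1 <= normc (gamma t - k%:C * z).
  move=> /hB gB; have := lerB_normc (k%:C * z) (gamma t); rewrite kz normcBC.
  by have := normc_ge0 z; lra.
have q0 : 0 < L / normc (W z) + 1 by rewrite ltr_wpDl // divr_ge0 // ltW.
have : normc (W (k%:C * z)) <= L * (L / normc (W z) + 1)^-1.
  apply: hL => [|t t01].
    apply: (@cwithin_cauchy_kernel _ _ hg _ 1) => t /far h.
    by rewrite -subr_eq0 -normc_gt0; exact: lt_le_trans h.
  by rewrite normcV lef_pV2 ?posrE ?far // (lt_le_trans q0) ?far.
rewrite E ler_pdivlMr // mulrDr mulrCA divff ?gt_eqF // !mulr1.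
lra.
Qed.

Variables (U : set R[i]) (f : R[i] -> R[i]).
Hypotheses (oU : copen U) (hf : holo U f).
Hypothesis gU : forall t, t \in `[0, 1] -> U (gamma t).
Hypothesis hW : forall z, ~ U z -> W z = 0.

Let K z := pathint gamma (fun t => f (gamma t) * (gamma t - z) ^- 1).
Let h z := pathint gamma (fun t => dquot f z (gamma t)).

Lemma cwithin_path_comp : cwithin 0 1 (fun t => f (gamma t)).
Proof.
apply: (cwithin_comp (H := gamma)) => [t /gU/hf[l /cder_cont //]|].
exact: piecewise_C1_cwithin.
Qed.

Lemma cwithin_dquot z : U z -> cwithin 0 1 (fun t => dquot f z (gamma t)).
Proof.
move=> Uz; apply: (cwithin_comp (H := gamma)) => [t /gU Ut|]; last exact: piecewise_C1_cwithin.
rewrite (_ : dquot f z = dquot f ^~ z); last by apply/funext => v; exact: dquotC.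
by have [l /cder_cont] := dquot_holo oU hf Uz Ut.
Qed.

(** The point is a bound on the divided difference that is uniform in [t], including the [t] for
    which [gamma t] comes near the variable; [holo_pathint] does the rest. *)
Lemma cder_int_dquot z : U z -> exists l, cder h z l.
Proof.
move=> Uz; have [d d0 hd] := oU Uz.
pose r := d / 4; have r0 : 0 < r by rewrite divr_gt0.
have sub v : normc (v - z) <= 2 * r -> U v by move=> vz; apply: hd; rewrite /r in vz; lra.
have hf1 := holo_cderiv oU hf.
have [M1 hM1] : exists M, forall v, normc (v - z) <= 2 * r -> normc (cderiv f v) <= M.
  by apply: closed_ball_bounded => v /sub /hf1[l /cder_cont].
have [M2 hM2] : exists M, forall v, normc (v - z) <= 2 * r -> normc (f v) <= M.
  by apply: closed_ball_bounded => v /sub /hf[l /cder_cont].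
have [M3 hM3] := cwithin_cbounded cwithin_path_comp.
have Ur v : cball z r v -> U v by move=> vz; apply: sub; move: vz; rewrite /cball /=; lra.
have z2 : normc (z - z) <= 2 * r by rewrite subrr normc0 mulr_ge0 // ltW.
have M10 : 0 <= M1 := le_trans (normc_ge0 _) (hM1 z z2).
have M20 : 0 <= M2 := le_trans (normc_ge0 _) (hM2 z z2).
have M30 : 0 <= M3 by apply: le_trans (normc_ge0 _) (hM3 0 _); rewrite in_itv /= lexx ler01.
apply: (@holo_pathint _ gamma (fun v t => dquot f v (gamma t)) z r (2 * M1 + (M2 + M3) / r) hg r0).
- by move=> t /gU Ut; apply: holoW (dquot_holo oU hf Ut).
- move=> v t vz t01; have q0 : 0 <= (M2 + M3) / r by rewrite divr_ge0 ?addr_ge0 // ltW.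
  have v2 : normc (v - z) <= 2 * r by move: vz; rewrite /cball /=; lra.
  rewrite /dquot; case: eqVneq => [_|vg].
    by apply: le_trans (hM1 _ v2) _; lra.
  have n0 : 0 < normc (v - gamma t) by rewrite normc_gt0 subr_eq0.
  rewrite normc_div ler_pdivrMr //.
  (* If [gamma t] is near, both points lie in one disc and the mean value inequality applies;
     otherwise they are at least [r] apart and the quotient is bounded crudely. *)
  have [gz|gz] := ltP (normc (gamma t - z)) (2 * r).
    apply: (@le_trans _ _ (2 * M1 * normc (v - gamma t))).
      apply: (@mean_value_ball _ f (cderiv f) z (2 * r)) => //; last by move: vz;
        rewrite /cball /=; lra.
        by move=> u /ltW /sub; exact: holo_cder.
      by move=> u /ltW; exact: hM1.
    by apply: ler_wpM2r; [exact: ltW|lra].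
  have rv : r <= normc (v - gamma t).
    have := ler_distc_add (gamma t) v z; rewrite (normcBC (gamma t) v); move: vz;
      rewrite /cball /=; lra.
  apply: le_trans (ler_normcB _ _) _; have := hM2 _ v2; have := hM3 _ t01 => a1 a2.
  have b1 : (M2 + M3) / r * r <= (M2 + M3) / r * normc (v - gamma t) by exact: ler_wpM2l.
  rewrite divfK ?gt_eqF // in b1.
  have b2 : 0 <= 2 * M1 * normc (v - gamma t) by rewrite !mulr_ge0 // ltW.
  rewrite mulrDl; lra.
- by move=> v /Ur; exact: cwithin_dquot.
Qed.

Lemma int_dquotE z : U z -> (forall t, t \in `[0, 1] -> gamma t != z) ->
  h z = K z - f z * W z.
Proof.
move=> Uz hz; have ck := cwithin_cauchy_kernel hg 1 hz.
have ck1 : cwithin 0 1 (fun t => (gamma t - z)^-1) := ck.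
rewrite /h /K /winding -(pathintZ hg _ ck1) -(pathintB hg).
- apply: eq_pathint => t t01; rewrite dquotC /dquot ifN ?hz // expr1.
  by rewrite mulrBl.
- by apply: cwithinM => //; exact: cwithin_path_comp.
- by apply: cwithinM => //; exact: cwithin_cst.
Qed.

Lemma cder_cauchy_transform z : (forall t, t \in `[0, 1] -> gamma t != z) ->
  exists l, cder K z l.
Proof.
move=> hz; eexists.
exact: (@cder_cauchy_integral _ _ hg (fun t => f (gamma t)) z 1 cwithin_path_comp hz).
Qed.

(* [h] is defined on [U], [K] off the trace, and they agree where both make sense
   and [W] vanishes: [dixon] is entire, and it tends to [0] at infinity. *)
Let dixon z := if `[< U z >] then h z else K z.

Lemma dixon_cauchy_transform z : (forall t, t \in `[0, 1] -> gamma t != z) -> W z = 0 ->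
  dixon z = K z.
Proof.
move=> hz Wz; rewrite /dixon; case: asboolP => // Uz.
by rewrite int_dquotE // Wz mulr0 subr0.
Qed.

Lemma holo_dixon : holo setT dixon.
Proof.
move=> z _; have [Uz|nUz] := pselect (U z).
  have [l hl] := cder_int_dquot Uz; exists l.
  by apply: (cder_open oU Uz _ hl) => w Uw; rewrite /dixon; case: asboolP.
have hz t : t \in `[0, 1] -> gamma t != z.
  by move=> /gU Ut; apply/eqP => E; apply: nUz; rewrite -E.
have [l hl] := cder_cauchy_transform hz; exists l.
have [d d0 hd] := winding_locally_constant hg gamma_closed hz.
apply: cder_local hl; exists d => // w /hd[hw Ww].
by rewrite dixon_cauchy_transform // Ww hW.
Qed.

(** Liouville's argument in quantitative form: Cauchy's formula at the centre of a large circle on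
    which [dixon] is the Cauchy transform, hence small. *)
Lemma dixon_eq0 z : dixon z = 0.
Proof.
have [B B0 hB] := path_bounded; have [L L0 hL] := pathint_bound hg.
have [M hM] := cwithin_cbounded cwithin_path_comp.
have M0 : 0 <= M by apply: le_trans (normc_ge0 _) (hM 0 _); rewrite in_itv /= lexx ler01.
have c0 : 0 < normc (two_pi_i : R[i]) by rewrite normc_gt0 two_pi_i_neq0.
apply/eqP; rewrite -normc_eq0; apply: contraT => n0.
have p0 : 0 < normc (dixon z) by rewrite lt_def n0 normc_ge0.
pose V := 4 * pi : R.
have V0 : 0 <= V by rewrite mulr_ge0 ?pi_ge0.
pose e := normc (two_pi_i : R[i]) * normc (dixon z).
have e0 : 0 < e by rewrite mulr_gt0.
(* The points of the circle are at distance at least [q] from the path; the resulting bound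
   [e <= V * (L * M) / q] contradicts this choice. [V] is the factor 2 of [pathint_le] times the
   length of the circle over its radius. *)
pose q := V * (L * M) / e + 1.
have q0 : 0 < q by rewrite /q ltr_wpDl // (divr_ge0 (mulr_ge0 V0 (mulr_ge0 L0 M0)) (ltW e0)).
pose r := normc z + B + q.
have r0 : 0 < r by rewrite ltr_wpDl // addr_ge0 ?normc_ge0.
have hball : holo (cball z (r + 1)) dixon by move=> v _; exact: holo_dixon.
have rr : r < r + 1 by rewrite ltrDl.
have := cauchy_circle rr hball (cball_center z r0).
have far t : B + q <= normc (circle z r t).
  have := lerB_normc (circle z r t) (- z + (circle z r t - (circle z r t))).
  have := ler_distc_add (circle z r t) 0 z;
    rewrite normc_circle ?(ltW r0) // subr0 sub0r normc_opp /r.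
  lra.
have hq t : normc (dixon (circle z r t)) <= L * (M / q).
  have farg s : s \in `[0, 1] -> q <= normc (gamma s - circle z r t).
    move=> /hB gB; have := lerB_normc (circle z r t) (gamma s); rewrite normcBC.
    by have := far t; lra.
  have av s : s \in `[0, 1] -> gamma s != circle z r t.
    by move=> /farg h1; rewrite -subr_eq0 -normc_gt0; exact: lt_le_trans h1.
  (* These points have modulus above [B], so the winding number vanishes there. *)
  rewrite dixon_cauchy_transform //; last by apply: (winding_far hB); have := far t; lra.
  apply: hL => [|s s01].
    by apply: cwithinM; [exact: cwithin_path_comp|exact: cwithin_cauchy_kernel].
  rewrite expr1 normc_div; apply: ler_pM; rewrite ?invr_ge0 ?normc_ge0 ?hM //.
  by rewrite lef_pV2 ?posrE ?farg // (lt_le_trans q0) ?farg.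
move=> /(congr1 (@normc R)); rewrite [normc (_ * dixon z)]normcM => E.
have : normc (pathint (circle z r) (fun t => dixon (circle z r t) / (circle z r t - z))) <=
  2 * (2 * pi * r) * (L * (M / q) / r).
  apply: (pathint_le (circle_piecewise_C1 z r)) => [t _||t _].
  - by rewrite normc_velocity_circle // ltW.
  - apply: cwithinM.
      apply: (cwithin_comp (H := circle z r)) => [t _|];
        last exact: piecewise_C1_cwithin (circle_piecewise_C1 z r).
      by have [l /cder_cont] := @holo_dixon (circle z r t) I.
    apply: (@cwithin_cauchy_kernel _ _ (circle_piecewise_C1 z r) z 1) => t _; apply: circle_avoids.
    exact: cball_center.
  - by rewrite normc_div normc_circle ?(ltW r0) // ler_wpM2r ?invr_ge0 ?(ltW r0).
rewrite E -/e.
have -> : 2 * (2 * pi * r) * (L * (M / q) / r) = V * (L * M) / q.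
  by rewrite /V; field; rewrite !gt_eqF.
rewrite ler_pdivlMr // /q mulrDr mulr1 mulrC divfK ?gt_eqF // => hle.
lra.
Qed.

Theorem homology_cauchy z : U z -> (forall t, t \in `[0, 1] -> gamma t != z) ->
  pathint gamma (fun t => f (gamma t) * (gamma t - z) ^- 1) = f z * W z.
Proof.
move=> Uz hz; have := dixon_eq0 z; rewrite /dixon; case: asboolP => // _.
by rewrite int_dquotE // => /eqP; rewrite subr_eq0 => /eqP.
Qed.

(** Induction by differentiating in [z]. The formula is available around [z] because [U] is open and
    the winding number is locally constant; the factors [n.+1] from the kernel build up the
    factorial. *)
Theorem homology_cauchy_derivatives n z : U z -> (forall t, t \in `[0, 1] -> gamma t != z) ->
  W z = two_pi_i ->
  pathint gamma (fun t => f (gamma t) * (gamma t - z) ^- n.+1) =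
    two_pi_i * iter n cderiv f z / n`!%:R.
Proof.
elim: n z => [|n IHn] z Uz hz Wz.
  by rewrite homology_cauchy // Wz mulrC fact0 divr1.
have f0 k : (k`!%:R : R[i]) != 0 by rewrite pnatr_eq0 -lt0n fact_gt0.
have c0 := @two_pi_i_neq0 R.
have [d d0 hd] := winding_locally_constant hg gamma_closed hz.
have [d' d'0 hd'] := oU Uz.
have D := cderZ (n`!%:R / two_pi_i) (cder_cauchy_integral hg n.+1 cwithin_path_comp hz).
have : cder (iter n cderiv f) z
  (n`!%:R / two_pi_i * (n.+1%:R * pathint gamma (fun t => f (gamma t) * (gamma t - z) ^- n.+2))).
  apply: cder_local D; exists (Num.min d d') => [|v]; first by rewrite lt_min d0.
  rewrite lt_min => /andP[/hd[hv Wv] /hd' Uv].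
  rewrite IHn ?Wv //; by field; rewrite c0 f0.
move=> /cderivE; rewrite iterS => ->; rewrite factS natrM.
have nn : (n.+1%:R : R[i]) != 0 by rewrite pnatr_eq0.
set I := pathint _ _.
move: (n.+1%:R : R[i]) (n`!%:R : R[i]) nn (f0 n) => a b a0 b0.
by field; rewrite c0 b0 a0.
Qed.

End GlobalCauchy.

(** * Winding numbers of Jordan contours *)

Section Contours.
Context {R : realType}.
Implicit Types (gamma : R -> R[i]) (z w : R[i]) (U : set R[i]).

Lemma nbhs_normc z (d : R) : 0 < d -> nbhs z [set w | normc (w - z) < d].
Proof.
move=> d0; have dC : 0 < d%:C by rewrite ltcR.
have := nbhsx_ballx z d%:C dC; apply: filterS => w.
by rewrite -ball_normE /= distrC -ltcR.
Qed.

Lemma open_copen U : open U <-> copen U.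
Proof.
split=> [oU z Uz|oU].
  have := open_nbhs_nbhs (conj oU Uz) => /nbhs_ballP[e /= e0 he].
  have eE : e = (complex.Re e)%:C by move: e0; rewrite ltcE /= => /andP[/eqP h _];
    case: (e) h => a b /= ->.
  rewrite eE ltcR in e0; exists (complex.Re e) => // w wz; apply: he.
  by rewrite -ball_normE /= distrC eE ltcR.
rewrite openE => z Uz; have [d d0 hd] := oU z Uz.
by apply: filterS (nbhs_normc z d0) => w; exact: hd.
Qed.

Lemma trace_path gamma t : t \in `[0, 1] -> trace gamma (gamma t).
Proof. by move=> t01; exists t. Qed.

Lemma notin_trace gamma z : ~ trace gamma z -> forall t, t \in `[0, 1] -> gamma t != z.
Proof. by move=> nz t t01; apply/eqP => E; apply: nz; rewrite -E; exact: trace_path. Qed.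

(* The winding number is locally constant off the trace and vanishes far away. *)
Lemma winding_unbounded_component gamma z : piecewise_C1 gamma -> gamma 1 = gamma 0 ->
  ~ trace gamma z -> ~ bounded_set (connected_component (~` trace gamma) z) ->
  winding gamma z = 0.
Proof.
move=> hg cg nz unb; apply: contrapT => Wz; apply: unb.
have [B B0 hB] := path_bounded hg.
set A := connected_component _ z.
have AT w : A w -> ~ trace gamma w by move=> /connected_component_sub.
have loc w (nw : ~ trace gamma w) := winding_locally_constant hg cg (notin_trace nw).
have off w v d :
  (forall u, normc (u - w) < d ->
  (forall t, t \in `[0, 1] -> gamma t != u) /\ winding gamma u = winding gamma w) ->
    normc (v - w) < d -> ~ trace gamma v /\ winding gamma v = winding gamma w.
  move=> h /h[h1 h2]; split=> // -[t t01 E].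
  by have := h1 t t01; rewrite E eqxx.
have cA : connected A by exact: component_connected.
(* Connectedness: the part of [A] with the winding number of [z] is nonempty, relatively open, and
   relatively closed as the complement of the open set where the winding number differs. *)
have E : A `&` [set w | ~ trace gamma w /\ winding gamma w = winding gamma z] = A.
  apply: cA.
  - by exists z; split => //; exact: connected_component_refl.
  - exists [set w | ~ trace gamma w /\ winding gamma w = winding gamma z] => //.
    apply/open_copen => w [nw Ww]; have [d d0 hd] := loc w nw.
    by exists d => // v /(off w v d hd)[nv E]; split=> //; rewrite E.
  - exists (~` [set w | ~ trace gamma w /\ winding gamma w != winding gamma z]).
      apply: open_closedC; apply/open_copen => w [nw Ww]; have [d d0 hd] := loc w nw.
      by exists d => // v /(off w v d hd)[nv E]; split=> //; rewrite E.
    apply/seteqP; split=> w [Aw]; first by move=> [nw Ww]; split=> // -[_]; rewrite Ww eqxx.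
    move=> h; split=> //; split; first exact: AT.
    by apply/eqP; apply: contrapT => /negP ne; apply: h; split=> //; exact: AT.
exists B%:C; split; first by apply/complex_realP; exists B.
move=> x Bx w /= Aw; apply: le_trans (ltW Bx).
suff h : normc w <= B by rewrite -lecR in h; exact: h.
rewrite leNgt; apply/negP => Bw.
have : A w by [].
rewrite -E => -[_ [_ Ww]]; apply: Wz; rewrite -Ww.
exact: (winding_far hg cg hB Bw).
Qed.

Variables (gamma : R -> R[i]) (D : set R[i]).
Hypothesis hC : positive_simple_closed_contour gamma.
Hypothesis hCD : trace gamma `|` inside gamma `<=` D.

Lemma contour_piecewise_C1 : piecewise_C1 gamma.
Proof. by have [] := hC. Qed.

Lemma contour_closed : gamma 1 = gamma 0.
Proof. by have [_ [-> _] _] := hC. Qed.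

Lemma winding_inside z : inside gamma z -> winding gamma z = two_pi_i.
Proof.
have [_ _ hp] := hC; move=> /hp; rewrite /winding_number contour_integralE -/(winding gamma z).
move=> h; have := congr1 ( *%R two_pi_i) h; rewrite mulr1 mulVKf //; exact: two_pi_i_neq0.
Qed.

(** A point off [D] is neither on the trace nor inside, so its component is unbounded. This is the
    vanishing that the homological formula asks for. *)
Lemma winding_off_domain z : ~ D z -> winding gamma z = 0.
Proof.
move=> nD; have nt : ~ trace gamma z by move=> h; apply: nD; apply: hCD; left.
apply: (winding_unbounded_component contour_piecewise_C1 contour_closed nt) => bd.
by apply: nD; apply: hCD; right; exact: (conj nt bd).
Qed.

Lemma contour_in_domain t : t \in `[0, 1] -> D (gamma t).
Proof. by move=> t01; apply: hCD; left; exact: trace_path. Qed.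

Lemma inside_in_domain z : inside gamma z -> D z.
Proof. by move=> h; apply: hCD; right. Qed.

Lemma inside_off_trace z : inside gamma z -> forall t, t \in `[0, 1] -> gamma t != z.
Proof. by move=> [h _]; exact: notin_trace. Qed.

End Contours.

(** * Several variables *)

Section SeveralVariables.
Context {R : realType}.

Definition set_coord n (z : 'rV[R[i]]_n) (j : 'I_n) (t : R[i]) : 'rV[R[i]]_n :=
  \row_i (if i == j then t else z 0 i).

(** Over any [Type], hence [const_mx], to serve real and complex vectors alike; [row_mx_cons_row]
    links it to the [z%:M] of [iterated_contour_integral]. *)
Definition cons_row (K : Type) m (z : K) (w : 'rV[K]_m) : 'rV[K]_m.+1 :=
  row_mx (const_mx z : 'M[K]_(1, 1)) w.

Lemma cons_row0 (K : Type) m (z : K) (w : 'rV[K]_m) : cons_row z w 0 ord0 = z.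
Proof.
rewrite /cons_row (_ : ord0 = lshift m (ord0 : 'I_1)); last exact: val_inj.
by apply: etrans (@row_mxEl K 1 1 m (const_mx z) w 0 ord0) _; rewrite mxE.
Qed.

Lemma cons_rowS (K : Type) m (z : K) (w : 'rV[K]_m) j : cons_row z w 0 (lift ord0 j) = w 0 j.
Proof.
rewrite /cons_row (_ : lift ord0 j = rshift 1 j); last exact: val_inj.
exact: (@row_mxEr K 1 1 m (const_mx z) w 0 j).
Qed.

Lemma cons_rowE (K : Type) m (p : 'rV[K]_m.+1) : p = cons_row (p 0 ord0) (\row_j p 0 (lift ord0 j)).
Proof.
apply/rowP => i; case: (unliftP ord0 i) => [j ->|->]; first by rewrite cons_rowS mxE.
by rewrite cons_row0.
Qed.

Lemma set_coord0 m z (w : 'rV[R[i]]_m) t : set_coord (cons_row z w) ord0 t = cons_row t w.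
Proof.
apply/rowP => i; rewrite mxE; case: (unliftP ord0 i) => [j ->|->]; first by rewrite !cons_rowS.
by rewrite eqxx cons_row0.
Qed.

Lemma set_coordS m z (w : 'rV[R[i]]_m) j t :
  set_coord (cons_row z w) (lift ord0 j) t = cons_row z (set_coord w j t).
Proof.
apply/rowP => i; rewrite mxE; case: (unliftP ord0 i) => [k ->|->]; last by rewrite !cons_row0.
by rewrite !cons_rowS mxE (inj_eq lift_inj).
Qed.

Lemma set_coord_id n (z : 'rV[R[i]]_n) j : set_coord z j (z 0 j) = z.
Proof. by apply/rowP => i; rewrite mxE; case: eqVneq => [->|]. Qed.

Lemma set_coord_set_coord n (z : 'rV[R[i]]_n) j s t :
  set_coord (set_coord z j s) j t = set_coord z j t.
Proof. by apply/rowP => i; rewrite !mxE; case: eqVneq. Qed.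

Lemma set_coordC n (z : 'rV[R[i]]_n) i j s t : i != j ->
  set_coord (set_coord z i s) j t = set_coord (set_coord z j t) i s.
Proof.
move=> ij; apply/rowP => k; rewrite !mxE.
by case: (eqVneq k j) => // ->; rewrite eq_sym (negbTE ij).
Qed.

Lemma set_coord_same n (z : 'rV[R[i]]_n) j t : set_coord z j t 0 j = t.
Proof. by rewrite mxE eqxx. Qed.

Lemma set_coord_other n (z : 'rV[R[i]]_n) i j t : i != j -> set_coord z j t 0 i = z 0 i.
Proof. by move=> ij; rewrite mxE (negbTE ij). Qed.

(* Unlike joint differentiability, this is inherited by partial derivatives by
   Cauchy's formula in one variable. *)
Definition sep_holo n (D : 'I_n -> set R[i]) (F : 'rV[R[i]]_n -> R[i]) :=
  (forall z j, box D z -> exists l, cder (fun t => F (set_coord z j t)) (z 0 j) l) /\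
  (forall z, box D z -> exists d M : R, 0 < d /\
     forall w : 'rV[R[i]]_n, (forall j, normc (w 0 j - z 0 j) < d) -> normc (F w) <= M).

Definition cpartial n (j : 'I_n) (F : 'rV[R[i]]_n -> R[i]) : 'rV[R[i]]_n -> R[i] :=
  fun z => cderiv (fun t => F (set_coord z j t)) (z 0 j).

(** Same order of differentiation as in [mixed_partial], so that the two can be compared one
    derivative at a time. *)
Definition cmixed n (k : 'I_n -> nat) (F : 'rV[R[i]]_n -> R[i]) :=
  foldr (fun j G => iter (k j) (cpartial j) G) F (enum 'I_n).

Lemma box_set_coord n (D : 'I_n -> set R[i]) z j t : box D z -> D j t -> box D (set_coord z j t).
Proof. by move=> hz ht i; rewrite mxE; case: eqVneq => [->|]. Qed.

Lemma sep_holo_slice n (D : 'I_n -> set R[i]) F z j : sep_holo D F -> box D z ->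
  holo (D j) (fun t => F (set_coord z j t)).
Proof.
move=> [hF _] hz t Dt; have [l] := hF _ j (box_set_coord hz Dt).
rewrite set_coord_same => hl; exists l; apply: eq_cder hl => // s.
by rewrite set_coord_set_coord.
Qed.

(** [P j] is stable under shrinking, so the least of the finitely many radii works; the 1 in the
    minimum covers [n = 0]. *)
Lemma finite_min n (P : 'I_n -> R -> Prop) :
  (forall j, exists2 d, 0 < d & forall e, 0 < e <= d -> P j e) ->
  exists2 d, 0 < d & forall j, P j d.
Proof.
move=> hP.
have /choice[g hg] : forall j, exists d, 0 < d /\ forall e, 0 < e <= d -> P j e.
  by move=> j; have [d d0 h] := hP j; exists d.
pose d := \big[Num.min/1]_j g j.
have d0 : 0 < d.
  by rewrite /d; elim/big_ind: _ => // [a b a0 b0|j _]; [rewrite lt_min a0|have [] := hg j].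
exists d => // j; have [_ h] := hg j; apply: h; rewrite d0 /=.
by rewrite /d (bigD1 j) //= ge_min lexx.
Qed.

Lemma box_nbhs n (D : 'I_n -> set R[i]) z : (forall j, copen (D j)) -> box D z ->
  exists2 d, 0 < d & forall j t, normc (t - z 0 j) < d -> D j t.
Proof.
move=> oD hz; apply: (finite_min (P := fun j d => forall t, normc (t - z 0 j) < d -> D j t)) => j.
have [d d0 hd] := oD j _ (hz j); exists d => // e /andP[_ ed] t te.
by apply: hd; exact: lt_le_trans ed.
Qed.

(** For [i = j], derivatives of holomorphic functions are holomorphic. For [i != j], Cauchy's
    formula on a circle in the [j]-th variable writes the derivative as an integral of values of
    [F], to which [holo_pathint] applies in the [i]-th variable. *)
Lemma sep_holo_partial n (D : 'I_n -> set R[i]) F j : (forall j, copen (D j)) ->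
  sep_holo D F -> sep_holo D (cpartial j F).
Proof.
move=> oD sF; have [hF bF] := sF.
have loc z : box D z -> exists d M, [/\ 0 < d, forall i t, normc (t - z 0 i) < d -> D i t &
    forall w : 'rV[R[i]]_n, (forall i, normc (w 0 i - z 0 i) < d) -> normc (F w) <= M].
  move=> hz; have [d d0 hd] := box_nbhs oD hz; have [d' [M [d'0 hM]]] := bF z hz.
  exists (Num.min d d'), M; split; first by rewrite lt_min d0.
    by move=> i t; rewrite lt_min => /andP[/hd].
  by move=> w hw; apply: hM => i; have := hw i; rewrite lt_min => /andP[].
split=> [z i hz|z hz].
  have [E|ij] := eqVneq i j.
    rewrite -E; have h := sep_holo_slice (j := i) sF hz; have [l hl] := holo_cderiv (oD i) h (hz i).
    exists l; apply: (cder_open (oD i) (hz i) _ hl) => t Dt.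
    rewrite /cpartial set_coord_same; congr cderiv; apply/funext => s.
    by rewrite set_coord_set_coord.
  have [d [M [d0 hd hM]]] := loc z hz.
  have r0 : 0 < d / 2 by rewrite divr_gt0.
  have rd : d / 2 < d by lra.
  pose g := circle (z 0 j) (d / 2); have hg : piecewise_C1 g := circle_piecewise_C1 _ _.
  have Dg t : D j (g t) by apply: hd; rewrite /g normc_circle // ltW.
  have zj0 := cball_center (z 0 j) r0.
  have [l hl] :
    exists l, cder
    (fun t => pathint g (fun s => F (set_coord (set_coord z i t) j (g s)) * (g s - z 0 j) ^- 2))
    (z 0 i) l.
    apply: (@holo_pathint _ g
      (fun t s => F (set_coord (set_coord z i t) j (g s)) * (g s - z 0 j) ^- 2) (z 0 i) d
      (M * (d / 2) ^- 2) hg d0).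
    - move=> s _ t tz; have hz' := box_set_coord hz (Dg s).
      have [l hl] := sep_holo_slice (j := i) sF hz' (hd _ _ tz).
      eexists; apply: eq_cder (cderM hl (cder_cst ((g s - z 0 j) ^- 2) t)) => [u|]; last by [].
      by rewrite (set_coordC z _ _ ij).
    - move=> t s tz _; rewrite normcM; apply: ler_pM; rewrite ?normc_ge0 //.
        apply: hM => k; rewrite !mxE; case: eqVneq => [->|_];
          first by rewrite /g normc_circle // ltW.
        by case: eqVneq => [->|_] //; rewrite subrr normc0.
      by rewrite normcV normcX /g normc_circle // ltW.
    - move=> t tz; apply: cwithinM; last first.
        by apply: (cwithin_cauchy_kernel hg) => s _; exact: circle_avoids.
      apply: (cwithin_comp (H := g) (f := fun u => F (set_coord (set_coord z i t) j u))) => [s _|];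
        last exact: piecewise_C1_cwithin.
      have [l /cder_cont //] := sep_holo_slice (j := j) sF (box_set_coord hz (hd _ _ tz)) (Dg s).
  exists (two_pi_i^-1 * l).
  apply: (cder_open (@copen_cball R (z 0 i) d) (cball_center _ d0) _ (cderZ _ hl)) => t tz.
  have hf : holo (cball (z 0 j) d) (fun s => F (set_coord (set_coord z i t) j s)).
    apply: holoW (sep_holo_slice (j := j) sF (box_set_coord hz (hd _ _ tz))) => u; exact: hd.
  have [h _] := cauchy_circle_derivatives rd hf zj0.
  rewrite /cpartial set_coord_other 1?eq_sym // -(mulKf (@two_pi_i_neq0 R) (cderiv _ _));
    congr (_ * _).
  by rewrite h.
(* Local boundedness: Cauchy's estimate in the [j]-th variable, on discs of radius [d / 2] about
   points within [d / 2] of [z], where [F] is still bounded by [M]. *)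
have [d [M [d0 hd hM]]] := loc z hz.
have r0 : 0 < d / 2 by rewrite divr_gt0.
have [K K0 hK] := @cauchy_estimate R _ r0.
exists (d / 2), (K * M); split=> // w wz.
have hw : box D w by move=> i; apply: hd; have := wz i; lra.
have sub t : cball (w 0 j) (d / 2) t -> normc (t - z 0 j) < d.
  move=> tw; have := wz j; have := ler_distc_add t (w 0 j) (z 0 j); move: tw; rewrite /cball /=;
    lra.
have h := sep_holo_slice (j := j) sF hw.
have [] := hK _ (w 0 j) M (holoW (fun t tw => hd _ _ (sub t tw)) h) _ (w 0 j) (cball_center _ _) =>
  //.
  move=> t tw; apply: hM => i; rewrite mxE; case: eqVneq => [->|_]; first exact: sub.
  by have := wz i; lra.
by rewrite divr_gt0.
Qed.

Lemma sep_holo_iter n (D : 'I_n -> set R[i]) F (T : Type) (s : seq T) (a : T -> 'I_n) (k : T ->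
  nat) :
  (forall j, copen (D j)) ->
  sep_holo D F -> sep_holo D (foldr (fun j G => iter (k j) (cpartial (a j)) G) F s).
Proof.
move=> oD sF; elim: s => //= j s IHs; elim: (k j) => //= m IHm.
exact: sep_holo_partial.
Qed.

Lemma cpartial_consS m j (G : 'rV[R[i]]_m.+1 -> R[i]) z :
  (fun w => cpartial (lift ord0 j) G (cons_row z w)) = cpartial j (fun w => G (cons_row z w)).
Proof.
apply/funext => w; rewrite /cpartial cons_rowS; congr cderiv; apply/funext => t.
by rewrite set_coordS.
Qed.

Lemma cmixed_slice m (k : 'I_m -> nat) (F : 'rV[R[i]]_m.+1 -> R[i]) z w :
  cmixed k (fun v => F (cons_row z v)) w =
  foldr (fun j H => iter (k j) (cpartial (lift ord0 j)) H) F (enum 'I_m) (cons_row z w).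
Proof.
suff -> : cmixed k (fun v => F (cons_row z v)) = fun v =>
  foldr (fun j H => iter (k j) (cpartial (lift ord0 j)) H) F (enum 'I_m) (cons_row z v) by [].
rewrite /cmixed; elim: (enum 'I_m) => //= j s ->.
by elim: (k j) => //= q ->; rewrite -cpartial_consS.
Qed.

(** [enum] lists coordinate 0 first and [foldr] applies it last, so the derivatives in the first
    variable are outermost. *)
Lemma cmixed_cons m (k : 'I_m.+1 -> nat) (F : 'rV[R[i]]_m.+1 -> R[i]) z w :
  cmixed k F (cons_row z w) =
  iter (k ord0) cderiv (fun t => cmixed (fun j => k (lift ord0 j)) (fun v => F (cons_row t v)) w) z.
Proof.
rewrite [LHS]/cmixed enum_ordSl /= foldr_map.
under [in RHS]eq_fun do rewrite cmixed_slice.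
set G := foldr _ F _.
elim: (k ord0) z => //= q IHq z.
rewrite [LHS]/cpartial cons_row0; congr cderiv; apply/funext => t.
by rewrite set_coord0.
Qed.

Lemma sep_holo_cons m (D : 'I_m.+1 -> set R[i]) F z : sep_holo D F -> D ord0 z ->
  sep_holo (fun j => D (lift ord0 j)) (fun w => F (cons_row z w)).
Proof.
move=> [hF bF] Dz.
have bx (w : 'rV_m) : box (fun j => D (lift ord0 j)) w -> box D (cons_row z w).
  move=> hw i; case: (unliftP ord0 i) => [j ->|->]; first by rewrite cons_rowS; exact: hw.
  by rewrite cons_row0.
split=> [w j /bx hw|w /bx hw].
  have [l hl] := hF _ (lift ord0 j) hw; exists l; rewrite cons_rowS in hl.
  by apply: eq_cder hl => // t; rewrite set_coordS.
have [d [M [d0 hM]]] := bF _ hw; exists d, M; split=> // v hv; apply: hM => i.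
case: (unliftP ord0 i) => [j ->|->]; first by rewrite !cons_rowS.
by rewrite !cons_row0 subrr normc0.
Qed.

End SeveralVariables.

(** * Cauchy's formula for iterated integrals *)

Section IteratedCauchy.
Context {R : realType}.

Definition cauchy_domain (gamma : R -> R[i]) (D : set R[i]) :=
  [/\ piecewise_C1 gamma, gamma 1 = gamma 0, copen D,
      (forall t, t \in `[0, 1] -> D (gamma t)) &
      forall z, ~ D z -> winding gamma z = 0].

Definition encircled (gamma : R -> R[i]) (D : set R[i]) (z : R[i]) :=
  [/\ D z, (forall t, t \in `[0, 1] -> gamma t != z) & winding gamma z = two_pi_i].

Lemma holo_cmixed_slice m (D : 'I_m.+1 -> set R[i]) F k (w : 'rV[R[i]]_m) :
  (forall j, copen (D j)) ->
  sep_holo D F -> (forall j, D (lift ord0 j) (w 0 j)) ->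
  holo (D ord0) (fun z => cmixed k (fun v => F (cons_row z v)) w).
Proof.
move=> oD sF hw z Dz.
have [h _] := sep_holo_iter (enum 'I_m) (fun j => lift ord0 j) k oD sF.
have [|l] := h (cons_row z w) ord0.
  move=> i; case: (unliftP ord0 i) => [j ->|->]; first by rewrite cons_rowS; exact: hw.
  by rewrite cons_row0.
rewrite cons_row0 => hl; exists l; apply: eq_cder hl => // t.
by rewrite set_coord0 cmixed_slice.
Qed.

Lemma row_mx_cons_row m (z : R[i]) (w : 'rV[R[i]]_m) : row_mx z%:M w = cons_row z w.
Proof. by congr row_mx; apply/matrixP => i j; rewrite !mxE !ord1. Qed.

Lemma eq_iterated_contour_integral n (C : 'I_n -> R -> R[i]) (F G : 'rV[R[i]]_n -> R[i]) :
  (forall z : 'rV[R[i]]_n, (forall j, trace (C j) (z 0 j)) -> F z = G z) ->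
  iterated_contour_integral C F = iterated_contour_integral C G.
Proof.
elim: n C F G => [|m IHm] C F G FG /=; first by apply: FG; case.
rewrite !contour_integralE; apply: eq_pathint => t t01; apply: IHm => w hw; apply: FG => i.
rewrite row_mx_cons_row; case: (unliftP ord0 i) => [j ->|->]; first by rewrite cons_rowS; exact: hw.
by rewrite cons_row0; exact: trace_path.
Qed.

(** The sum with coefficients makes the induction close: for a fixed outer variable its kernels join
    the coefficients [c]. The outer integrand is then explicit, and linearity is applied to a single
    integral of continuous functions. *)
Theorem iterated_cauchy n (C : 'I_n -> R -> R[i]) (D : 'I_n -> set R[i]) F
  (S : Type) (s : seq S) (c : S -> R[i]) (p : S -> 'rV[R[i]]_n) (k : S -> 'I_n -> nat) :
  (forall j, cauchy_domain (C j) (D j)) ->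
  (forall i j, encircled (C j) (D j) (p i 0 j)) -> sep_holo D F ->
  iterated_contour_integral C (fun z =>
    \sum_(i <- s) c i * (\prod_r (z 0 r - p i 0 r) ^- (k i r).+1) * F z) =
  two_pi_i ^+ n * \sum_(i <- s) c i * (cmixed (k i) F (p i) / \prod_r (k i r)`!%:R).
Proof.
elim: n C D F s c p k => [|m IHm] C D F s c p k hC hp sF.
  rewrite /= expr0 mul1r; apply: eq_bigr => i _; rewrite !big_ord0 mulr1 divr1; congr (_ * _).
  rewrite /cmixed (_ : enum 'I_0 = [::]) /=; first by rewrite [p i]thinmx0.
  by apply/size0nil; rewrite size_enum_ord.
have [hg cg oD gD W0] := hC ord0.
have oDj j : copen (D j) by have [] := hC j.
pose p' i : 'rV[R[i]]_m := \row_j p i 0 (lift ord0 j).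
pose k' i j := k i (lift ord0 j).
pose G i z := cmixed (k' i) (fun v => F (cons_row z v)) (p' i).
have hG i : holo (D ord0) (G i).
  by apply: holo_cmixed_slice => // j; rewrite mxE; have [] := hp i (lift ord0 j).
pose a i := two_pi_i ^+ m * (c i / \prod_j (k' i j)`!%:R) : R[i].
rewrite /= contour_integralE.
(* The inner integrals are evaluated at each point of the outer contour; Cauchy's formula for [G i]
   in the outer variable remains. *)
transitivity
  (pathint (C ord0)
  (fun t => \sum_(i <- s) a i * (G i (C ord0 t) * (C ord0 t - p i 0 ord0) ^- (k i ord0).+1))).
  apply: eq_pathint => t t01.
  have sFt := sep_holo_cons sF (gD t t01).
  have hpt i j : encircled (C (lift ord0 j)) (D (lift ord0 j)) (p' i 0 j) by rewrite mxE.
  have := IHm (fun j => C (lift ord0 j)) _ _ s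
    (fun i => c i * (C ord0 t - p i 0 ord0) ^- (k i ord0).+1) p' k' (fun j => hC _) hpt sFt.
  rewrite mulr_sumr => IH;
    transitivity (\sum_(i <- s) two_pi_i ^+ m * (c i / (C ord0 t - p i 0 ord0) ^+ (k i ord0).+1 *
         (cmixed (k' i) (fun w => F (cons_row (C ord0 t) w)) (p' i) / \prod_r (k' i r)`!%:R)));
           last first.
    by apply: eq_bigr => i _; rewrite /a /G; ring.
  rewrite -IH; apply: eq_iterated_contour_integral => w _; apply: eq_bigr => i _.
  rewrite row_mx_cons_row big_ord_recl cons_row0 !mulrA; congr (_ * _ * _).
  by apply: eq_bigr => j _; rewrite cons_rowS mxE.
have hz i : forall t, t \in `[0, 1] -> C ord0 t != p i 0 ord0 by have [] := hp i ord0.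
have cGk i : cwithin 0 1 (fun t => G i (C ord0 t) * (C ord0 t - p i 0 ord0) ^- (k i ord0).+1).
  apply: cwithinM; last exact: (cwithin_cauchy_kernel hg _ (hz i)).
  exact: cwithin_path_comp (hG i) gD.
rewrite (pathint_sum hg) => [|i]; last by apply: cwithinM => //; exact: cwithin_cst.
rewrite mulr_sumr; apply: eq_bigr => i _; rewrite (pathintZ hg) //.
have [Dp _ Wp] := hp i ord0.
rewrite (homology_cauchy_derivatives hg cg oD (hG i) gD W0 (k i ord0) Dp (hz i) Wp).
rewrite [p i in RHS](cons_rowE (p i)) cmixed_cons big_ord_recl /a /= exprS.
have f0 q : (q`!%:R : R[i]) != 0 by rewrite pnatr_eq0 -lt0n fact_gt0.
have P0 : \prod_j ((k' i j)`!%:R : R[i]) != 0 by apply/prodf_neq0 => j _.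
pose A := iter (k i ord0) cderiv (G i) (p i 0 ord0).
pose B : R[i] := \prod_j (k' i j)`!%:R; pose q : R[i] := (k i ord0)`!%:R.
change (two_pi_i ^+ m * (c i / B) * (two_pi_i * A / q) =
  two_pi_i * two_pi_i ^+ m * (c i * (A / (q * B)))).
move: (f0 (k i ord0)) P0; rewrite -/q -/B; move: A B q => A B q q0 B0.
by field; rewrite q0 B0.
Qed.

End IteratedCauchy.

(** * Real partial derivatives as complex ones *)

Section RealPartials.
Context {R : realType}.

Lemma cons_row_shift (K : numFieldType) m (h x : K) (w : 'rV[K]_m) :
  h *: delta_mx 0 ord0 + cons_row x w = cons_row (h + x) w.
Proof.
have E (u : 'rV[K]_m.+1) i :
  (h *: delta_mx 0 ord0 + u) 0 i = h * (i == ord0)%:R + u 0 i by rewrite !mxE.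
apply/rowP => i; rewrite E; case: (unliftP ord0 i) => [j ->|->].
  by rewrite !cons_rowS /= mulr0 add0r.
by rewrite !cons_row0 eqxx mulr1.
Qed.

Lemma cons_row_shiftS (K : numFieldType) m (h x : K) (w : 'rV[K]_m) j :
  h *: delta_mx 0 (lift ord0 j) + cons_row x w = cons_row x (h *: delta_mx 0 j + w).
Proof.
have E q (u : 'rV[K]_q) k i : (h *: delta_mx 0 k + u) 0 i = h * (i == k)%:R + u 0 i by rewrite !mxE.
apply/rowP => i; rewrite E; case: (unliftP ord0 i) => [l ->|->].
  by rewrite !cons_rowS E (inj_eq lift_inj).
by rewrite !cons_row0 mulr0 add0r.
Qed.

(** A directional derivative sees the function along a line only. As [V] and [W] may differ, a
    partial derivative in [m.+1] variables can become one in [m] variables or in one. *)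
Lemma eq_derive_line (V W : normedModType R) (f : V -> R) (g : W -> R) a v b u :
  (forall h : R, f (h *: v + a) = g (h *: u + b)) -> 'D_v f a = 'D_u g b.
Proof.
move=> fg; have f0 : f a = g b by have := fg 0; rewrite !scale0r !add0r.
rewrite /derive; set F := (X in lim (X @ _)); set G := (X in _ = lim (X @ _)).
by suff -> : F = G by []; apply/funext => h; rewrite /F /G /= fg f0.
Qed.

Lemma partial_cons0 m (f : 'rV[R]_m.+1 -> R) x w :
  partial ord0 f (cons_row x w) = derive1 (fun t => f (cons_row t w)) x.
Proof.
rewrite /partial derive1E; apply: eq_derive_line => h.
by rewrite cons_row_shift // [h *: 1]mulr1.
Qed.

Lemma partial_consS m j (f : 'rV[R]_m.+1 -> R) x :
  (fun w => partial (lift ord0 j) f (cons_row x w)) = partial j (fun w => f (cons_row x w)).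
Proof.
apply/funext => w; rewrite /partial; apply: eq_derive_line => h.
by rewrite cons_row_shiftS.
Qed.

Lemma mixed_partial_cons m (k : 'I_m.+1 -> nat) (f : 'rV[R]_m.+1 -> R) x w :
  mixed_partial k f (cons_row x w) =
  derive1n (k ord0)
    (fun t => mixed_partial (fun j => k (lift ord0 j)) (fun v => f (cons_row t v)) w) x.
Proof.
rewrite [LHS]/mixed_partial enum_ordSl /= foldr_map.
set G := foldr _ f _.
have E t : mixed_partial (fun j => k (lift ord0 j)) (fun v => f (cons_row t v)) =
  fun v => G (cons_row t v).
  rewrite /G /mixed_partial; elim: (enum 'I_m) => //= j s ->.
  by elim: (k (lift ord0 j)) => //= q ->; rewrite -partial_consS.
under [in RHS]eq_fun do rewrite E.
elim: (k ord0) x => //= q IHq x.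
by rewrite partial_cons0; congr (derive1 _ x); apply/funext => t.
Qed.

(** Along the real line the function is real, so the derivative has the real derivative as real part
    and 0 as imaginary part. Holomorphy of the iterates is carried along so that the next derivative
    exists. *)
Lemma cderiv_real (U : set R[i]) (G : R[i] -> R[i]) (g : R -> R) n t : copen U -> holo U G ->
  (forall t, U t%:C -> G t%:C = (g t)%:C) -> U t%:C ->
  iter n cderiv G t%:C = (derive1n n g t)%:C.
Proof.
move=> oU hG Gg Ut.
suff : holo U (iter n cderiv G) /\ forall t, U t%:C ->
  iter n cderiv G t%:C = (derive1n n g t)%:C by case=> _; exact.
elim: n => //= n [hn En]; split; first exact: holo_cderiv.
move=> {Ut}t Ut; have h := holo_cder hn Ut; set l := cderiv _ _ in h *.
have /pderP[h1 h2] : pder (fun s : R => (derive1n n g s)%:C) t l.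
  have [d d0 hd] := oU _ Ut.
  apply: (@pder_local _ (fun s : R => iter n cderiv G s%:C)).
    exists d => // s sd; apply: En; apply: hd.
    by rewrite -(rmorphB (real_complex R)) normc_real.
  rewrite -[l]mulr1; apply: (pder_comp (g := fun s : R => s%:C)) h _ => e e0; exists 1 => // s _.
  by rewrite mul1r -(rmorphB (real_complex R)) subrr normc0 mulr_ge0 // ltW.
apply: complex_eqE => /=.
  by rewrite derive1E; have [_ <-] := h1.
have [_ <-] := h2; rewrite -[LHS]/('D_1 (cst (0 : R)) t).
exact: derive_cst.
Qed.

Lemma cmixed_real n (D : 'I_n -> set R[i]) F (f : 'rV[R]_n -> R) k x : (forall j, copen (D j)) ->
  sep_holo D F -> (forall x, box D (embedC x) -> F (embedC x) = (f x)%:C) ->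
  box D (embedC x) -> cmixed k F (embedC x) = (mixed_partial k f x)%:C.
Proof.
elim: n D F f k x => [|m IHm] D F f k x oD sF Ff Dx.
  by rewrite /cmixed /mixed_partial (_ : enum 'I_0 = [::]) /= ?Ff //; apply/size0nil;
    rewrite size_enum_ord.
have embC (t : R) (v : 'rV[R]_m) : embedC (cons_row t v) = cons_row t%:C (embedC v).
  have E q (u : 'rV[R]_q) i : embedC u 0 i = (u 0 i)%:C by rewrite mxE.
  apply/rowP => i; rewrite E; case: (unliftP ord0 i) => [j ->|->]; first by rewrite !cons_rowS E.
  by rewrite !cons_row0.
have bx (t : R) (v : 'rV[R]_m) : D ord0 t%:C -> box (fun j => D (lift ord0 j)) (embedC v) ->
  box D (embedC (cons_row t v)).
  move=> Dt Dv i; rewrite embC; case: (unliftP ord0 i) => [j ->|->]; first by rewrite cons_rowS.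
  by rewrite cons_row0.
rewrite (cons_rowE x); set w := \row_j _; set x0 := x 0 ord0.
have Dw : box (fun j => D (lift ord0 j)) (embedC w) by move=> j; rewrite !mxE;
  have := Dx (lift ord0 j); rewrite mxE.
have Dx0 : D ord0 x0%:C by have := Dx ord0; rewrite mxE.
rewrite mixed_partial_cons embC cmixed_cons.
apply: (cderiv_real (U := D ord0)) => //.
  by apply: holo_cmixed_slice => // j; have := Dw j.
move=> t Dt; apply: (IHm (fun j => D (lift ord0 j))) => //; first exact: sep_holo_cons.
by move=> v Dv; rewrite -embC Ff //; exact: bx.
Qed.

End RealPartials.

(** * Partial fractions of the one-variable kernel *)

(** The dependent families are passed through functions into the tagged union, where distributivity
    over a fixed codomain applies, and then translated back. *)
Lemma prod_sum_dffun (K : comNzRingType) (I : finType) (T : I -> finType) (F : forall i, T i -> K) :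
  \prod_i \sum_(x : T i) F i x = \sum_(f : {dffun forall i, T i}) \prod_i F i (f i).
Proof.
pose P i : {ffun T i -> K} := [ffun x => F i x].
transitivity (\prod_i \sum_(x : T i) P i x).
  by apply: eq_bigr => i _; apply: eq_bigr => x _; rewrite ffunE.
transitivity (\prod_i \sum_(j in tagged_with T i) untag 0 (P i) j).
  by apply: eq_bigr => i _; rewrite (big_tag (fun i => P i)).
rewrite bigA_distr_big_dep -big_fprod.
rewrite (reindex (@fprod_of_dffun I T)); last first.
  by apply: onW_bij; exists (@dffun_of_fprod I T); [exact: fprod_of_dffunK|exact: dffun_of_fprodK].
apply: eq_bigr => f _; apply: eq_bigr => i _; rewrite ffunE.
by rewrite -[in RHS](fprod_of_dffunK f) ffunE.
Qed.

(** * Taylor expansion of polynomials *)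

Section PolynomialTaylor.
Variable K : numFieldType.
Implicit Types (p q u : {poly K}) (a : K).

Lemma poly_taylor p a : p = \sum_(i < size p) (p^`(i).[a] / i`!%:R) *: ('X - a%:P) ^+ i.
Proof.
have E : (map_poly polyC p).[a%:P + ('X - a%:P)] = p by rewrite subrKC; exact: comp_polyXr.
rewrite -[LHS]E nderiv_taylor; last exact: mulrC.
rewrite size_map_polyC; apply: eq_bigr => i _.
rewrite nderivn_map horner_map /= mul_polyC nderivn_def hornerMn -mulr_natr mulfK // pnatr_eq0
  -lt0n fact_gt0.
Qed.

Lemma dvdp_taylor p a m :
  ('X - a%:P) ^+ m %| p - \sum_(t < m) (p^`(t).[a] / t`!%:R) *: ('X - a%:P) ^+ t.
Proof.
pose c i := (p^`(i).[a] / i`!%:R) *: ('X - a%:P) ^+ i.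
have E n : (size p <= n)%N -> p = \sum_(0 <= i < n) c i.
  move=> pn; rewrite {1}(poly_taylor p a) (@big_cat_nat _ _ _ (size p) 0 n) //= big_mkord
    [X in _ = _ + X]big1_seq ?addr0 //.
  move=> i /andP[_]; rewrite mem_index_iota => /andP[pi _].
  by rewrite /c derivn_poly0 // horner0 mul0r scale0r.
rewrite -(big_mkord xpredT c) {1}(E (maxn m (size p))) ?leq_maxr //.
rewrite (big_cat_nat (leq0n m) (leq_maxl m (size p))) /= [X in _ %| X]addrC addKr.
rewrite big_seq; elim/big_ind: _ => [|x y|i]; first exact: dvdp0.
  exact: dvdp_add.
rewrite mem_index_iota => /andP[mi _]; rewrite /c -mul_polyC; apply: dvdp_mull; exact: dvdp_exp2l.
Qed.

End PolynomialTaylor.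

(** * Derivatives of the reciprocal of a polynomial *)

Section ReciprocalDerivatives.
Context {R : realType}.
Implicit Types (u p q : {poly R}) (a y : R).

(* The [t]-th derivative of [p / u] is [recip_num u p t / u ^+ t.+1]. *)
Fixpoint recip_num u p t : {poly R} := if t is s.+1 then
  (recip_num u p s)^`() * u - s.+1%:R *: (recip_num u p s * u^`()) else p.

Lemma recip_numB u p q t : recip_num u (p - q) t = recip_num u p t - recip_num u q t.
Proof.
elim: t => //= t ->; rewrite derivB -!mul_polyC; ring.
Qed.

Lemma recip_num_mul u q t : recip_num u (u * q) t = q^`(t) * u ^+ t.+1.
Proof.
elim: t => [|t IHt] /=; first by rewrite expr1 mulrC.
rewrite IHt derivM deriv_exp /= -mulr_natr -mul_polyC polyC_natr !exprS; ring.
Qed.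

(** One differentiation lowers the order of vanishing at [a] by at most 1; as [m - t] is truncated,
    the claim is void for [t >= m]. *)
Lemma dvdp_recip_num u p a m t :
  ('X - a%:P) ^+ m %| p -> ('X - a%:P) ^+ (m - t) %| recip_num u p t.
Proof.
move=> h; elim: t => [|t IHt] /=; first by rewrite subn0.
have dX n (q : {poly R}) : ('X - a%:P) ^+ n %| q -> ('X - a%:P) ^+ n.-1 %| q^`().
  case: n => [|n]; first by move=> _; exact: dvd1p.
  move=> /dvdpP[r ->]; rewrite derivM deriv_exp /=; apply: dvdp_add.
    by rewrite exprS mulrA dvdp_mulIr.
  by rewrite -mulr_natr; apply: dvdp_mull; apply: dvdp_mulr; apply: dvdp_mull.
rewrite subnS; apply: dvdp_add.
  by apply: dvdp_mulr; exact: dX.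
rewrite dvdpNr -mul_polyC; apply: dvdp_mull; apply: dvdp_mulr.
by apply: dvdp_trans IHt; apply: dvdp_exp2l; exact: leq_pred.
Qed.

Lemma derive1n_recip u t y : u.[y] != 0 ->
  derive1n t (fun x => (u.[x])^-1) y = (recip_num u 1 t).[y] / u.[y] ^+ t.+1.
Proof.
elim: t y => [|t IHt] y uy; first by rewrite /= hornerC mul1r expr1.
pose g x := (recip_num u 1 t).[x] / u.[x] ^+ t.+1.
have uS : u.[y] ^+ t.+1 != 0 by rewrite expf_neq0.
(* The induction hypothesis gives the formula where [u] does not vanish; by continuity this is a
   neighbourhood of [y], which determines the derivative. *)
rewrite /= derive1E (@near_eq_derive _ _ _ _ g); last first.
  have cu : {for y, continuous (horner u)}.
    by apply/differentiable_continuous/derivable1_diffP; exact: derivable_horner.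
  have := cu; move/cvgrPdist_lt/(_ `|u.[y]|); rewrite normr_gt0 => /(_ uy).
  apply: filterS => x hx; apply: IHt; apply: contraTneq hx => ->.
  by rewrite subr0 ltxx.
have dp := is_derive_poly (recip_num u 1 t) y.
have du := is_derive_poly (u ^+ t.+1) y.
have un : (u ^+ t.+1).[y] != 0 by rewrite horner_exp.
have dv := is_deriveV un du.
have dg := is_deriveM dp dv.
have -> : g = (horner (recip_num u 1 t)) * (fun x => (u ^+ t.+1).[x]^-1).
  by apply/funext => x; rewrite /g -horner_exp.
have [_ ->] := dg.
rewrite /GRing.scale /= deriv_exp -mulr_natr -polyC_natr
  !(hornerM, hornerD, hornerN, hornerZ, hornerC, horner_exp) /=.
rewrite !exprS; set b := u.[y] ^+ t; have b0 : b != 0 by rewrite expf_neq0.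
by field; rewrite uy b0.
Qed.

(* Choose [q] with [u * q = 1] modulo ['X - a] ^ m: then [1 / u] and [q] have
   the same derivatives of order less than [m] at [a]. *)
Lemma dvdp_recip_taylor u a m : u.[a] != 0 ->
  ('X - a%:P) ^+ m %|
  u * \sum_(t < m) (derive1n t (fun x => (u.[x])^-1) a / t`!%:R) *: ('X - a%:P) ^+ t - 1.
Proof.
move=> ua.
have cop : coprimep u (('X - a%:P) ^+ m).
  by rewrite coprimep_sym coprimep_expl // coprimep_sym coprimep_XsubC.
have /Bezout_eq1_coprimepP[[q r] /= E] := cop.
(* Modulo the power of ['X - a] the numerator 1 may be replaced by [u * q]; the difference still
   vanishes at [a] after [t < m] derivatives. *)
have E1 : 1 = u * q - - (r * ('X - a%:P) ^+ m) by rewrite opprK -E mulrC.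
have D t : (t < m)%N -> derive1n t (fun x => (u.[x])^-1) a = q^`(t).[a].
  move=> tm; rewrite derive1n_recip // E1 recip_numB recip_num_mul.
  have : ('X - a%:P) ^+ (m - t) %| recip_num u (- (r * ('X - a%:P) ^+ m)) t.
    by apply: dvdp_recip_num; rewrite dvdpNr dvdp_mulIr.
  have mt : (0 < m - t)%N by rewrite subn_gt0.
  move=> /(dvdp_trans (dvdp_exp2l _ mt)); rewrite expr1 dvdp_XsubCl => /rootP z.
  by rewrite hornerD hornerN z subr0 hornerM horner_exp mulfK // expf_neq0.
under eq_bigr => t _ do rewrite D //.
set T := \sum_(t < m) _; have h := dvdp_taylor q a m; rewrite -/T in h.
have -> : u * T - 1 = - (u * (q - T)) - r * ('X - a%:P) ^+ m by rewrite -[1]E; ring.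
apply: dvdp_add; last by rewrite dvdpNr dvdp_mulIr.
by rewrite dvdpNr dvdp_mull.
Qed.

End ReciprocalDerivatives.

Lemma dvdp_prod_coprime (K : fieldType) (I : eqType) (s : seq I) (F : I -> {poly K}) D : uniq s ->
  (forall i j, i != j -> coprimep (F i) (F j)) -> (forall i, F i %| D) -> \prod_(i <- s) F i %| D.
Proof.
move=> us cF hD; elim: s us => [|i s IHs]; first by rewrite big_nil dvd1p.
move=> /= /andP[iNs us]; rewrite big_cons Gauss_dvdp ?hD ?IHs //.
rewrite big_seq; elim/big_ind: _ => [|p q hp hq|j js]; first exact: coprimep1.
  by rewrite coprimepMr hp.
by apply: cF; apply: contraNneq iNs => ->.
Qed.

(** * The Hermite basis polynomials *)

Section HermiteBasis.
Context {R : realType}.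
Variables (A : {fset R}) (nu : A -> nat).
Implicit Types (a b c : A) (x : R) (z : R[i]).

Let deg := (\sum_(c : A) nu c)%N.

Definition nodal_poly : {poly R} := \prod_(c : A) ('X - (val c)%:P) ^+ nu c.

Definition factor_poly a : {poly R} :=
  \prod_(c : A | c != a) ((val a - val c)^-1 *: ('X - (val c)%:P)) ^+ nu c.

Definition recip_coef a t : R :=
  derive1n t (fun y => (hermite_factor nu a y)^-1) (val a) / t`!%:R.

Definition basis_poly a k : {poly R} :=
  factor_poly a * (k`!%:R^-1 *: ('X - (val a)%:P) ^+ k) *
  \sum_(t < nu a - k) recip_coef a t *: ('X - (val a)%:P) ^+ t.

Lemma horner_factor_poly a x : (factor_poly a).[x] = hermite_factor nu a x.
Proof.
rewrite /factor_poly /hermite_factor horner_prod; apply: eq_bigr => c _.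
by rewrite horner_exp hornerZ hornerXsubC mulrC.
Qed.

Lemma horner_basis_poly a k x : (basis_poly a k).[x] = hermite_basis nu a k x.
Proof.
rewrite /basis_poly /hermite_basis !hornerM horner_factor_poly hornerZ horner_exp hornerXsubC.
congr (_ * _ * _); first by rewrite mulrC.
rewrite horner_sum; apply: eq_bigr => t _.
by rewrite hornerZ horner_exp hornerXsubC /recip_coef mulrC mulrA mulrAC.
Qed.

Lemma val_sub_neq0 a c : c != a -> val a - val c != 0.
Proof. by move=> ca; rewrite subr_eq0 (inj_eq val_inj) eq_sym. Qed.

Lemma factor_poly_self a : (factor_poly a).[val a] = 1.
Proof.
rewrite horner_factor_poly /hermite_factor big1 // => c /val_sub_neq0 ca.
by rewrite divff // expr1n.
Qed.

Lemma dvdp_basis_other a b k : b != a -> ('X - (val b)%:P) ^+ nu b %| basis_poly a k.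
Proof.
move=> ba; rewrite /basis_poly /factor_poly -!mulrA (bigD1 b ba) /= -mulrA.
by apply: dvdp_mulr; rewrite exprZn -mul_polyC dvdp_mulIr.
Qed.

(** The sum in [basis_poly] is the Taylor polynomial of the reciprocal of [factor_poly], so their
    product is 1 up to order [nu a - k]; the factor [('X - a) ^ k] supplies the remaining orders. *)
Lemma dvdp_basis_self a k : (k <= nu a)%N ->
  ('X - (val a)%:P) ^+ nu a %| basis_poly a k - k`!%:R^-1 *: ('X - (val a)%:P) ^+ k.
Proof.
move=> ka; rewrite /basis_poly; set X := k`!%:R^-1 *: _; set S := \sum_(t < _) _.
have -> : factor_poly a * X * S - X = (factor_poly a * S - 1) * X by ring.
rewrite -{1}(subnK ka) exprD; apply: dvdp_mul; last by rewrite /X -mul_polyC dvdp_mulIr.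
have := @dvdp_recip_taylor R (factor_poly a) (val a) (nu a - k).
rewrite factor_poly_self oner_neq0 => /(_ isT).
rewrite (_ : (fun y => _) = fun y => (hermite_factor nu a y)^-1) //.
by apply/funext => y; rewrite horner_factor_poly.
Qed.

Lemma size_prod_powers (P : pred A) (s : A -> R) : (forall c, P c -> s c != 0) ->
  size (\prod_(c | P c) (s c *: ('X - (val c)%:P)) ^+ nu c) = (\sum_(c | P c) nu c).+1.
Proof.
move=> s0.
have sz c : P c -> size ((s c *: ('X - (val c)%:P)) ^+ nu c) = (nu c).+1.
  by move=> /s0 sc; rewrite exprZn size_scale ?expf_neq0 // size_exp_XsubC.
rewrite size_prod; last by move=> c Pc; rewrite -size_poly_gt0 sz.
rewrite (eq_bigr (fun c => nu c + 1)%N); last by move=> c /sz ->; rewrite addn1.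
by rewrite big_split /= sum1_card subSn ?leq_addl // addnK.
Qed.

Lemma size_nodal_poly : size nodal_poly = deg.+1.
Proof.
have -> : nodal_poly = \prod_(c | predT c) (1 *: ('X - (val c)%:P)) ^+ nu c.
  by apply: eq_bigr => c _; rewrite scale1r.
by apply: (@size_prod_powers predT (fun=> 1)) => c _; exact: oner_neq0.
Qed.

(** The degrees [deg - nu a], [k] and at most [nu a - k - 1] of the three factors add up to at most
    [deg - 1]. *)
Lemma size_basis_poly a k : (k < nu a)%N -> (size (basis_poly a k) <= deg)%N.
Proof.
move=> ka; have sf : size (factor_poly a) = (\sum_(c | c != a) nu c).+1.
  by apply: size_prod_powers => c /val_sub_neq0; exact: invr_neq0.
rewrite /basis_poly; set X := k`!%:R^-1 *: _; set S := \sum_(t < _) _.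
have sS : (size S <= nu a - k)%N.
  apply: leq_trans (size_sum _ _ _) _; apply/bigmax_leqP => t _.
  by apply: leq_trans (size_scale_leq _ _) _; rewrite size_exp_XsubC.
have sX : (size X <= k.+1)%N.
  by apply: leq_trans (size_scale_leq _ _) _; rewrite size_exp_XsubC.
have s1 := size_polyMleq (factor_poly a) X.
have s2 := size_polyMleq (factor_poly a * X) S.
have -> : deg = (nu a + \sum_(c | c != a) nu c)%N by rewrite /deg (bigD1 a).
rewrite sf in s1; apply: (leq_trans s2).
set u := size _ in s1 *; set v := size S in sS *; set w := size X in sX s1.
set d := (\sum_(c | _) _)%N in s1 *; clearbody u v w d; lia.
Qed.

Local Notation toC := (map_poly (real_complex R)).

Lemma nodalE z : nodal nu z = (toC nodal_poly).[z].
Proof.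
rewrite /nodal rmorph_prod horner_prod; apply: eq_bigr => c _.
by rewrite rmorphXn /= map_polyXsubC horner_exp hornerXsubC.
Qed.

(** Truncated expansion of [1 / (z - 'X)] around [w], with its exact remainder. *)
Lemma geometric_XsubC (w z : R[i]) m : z != w ->
  (z%:P - 'X) * \sum_(k < m) ((z - w) ^- k.+1) *: ('X - w%:P) ^+ k =
    1 - (z - w) ^- m *: ('X - w%:P) ^+ m.
Proof.
rewrite -subr_eq0 => zw; elim: m => [|m IHm].
  by rewrite big_ord0 mulr0 !expr0 invr1 scale1r subrr.
rewrite big_ord_recr /= mulrDr IHm -!mul_polyC.
have -> : z%:P - 'X = (z - w)%:P - ('X - w%:P) :> {poly R[i]} by rewrite polyCB; ring.
have E : ((z - w) ^- m)%:P = ((z - w) ^- m.+1)%:P * (z - w)%:P :> {poly R[i]}.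
  by rewrite -polyCM; congr _%:P; rewrite exprS; field; rewrite zw expf_neq0.
set Y := 'X - w%:P; rewrite E (exprS Y); set c := ((z - w) ^- m.+1)%:P; set d := (z - w)%:P; ring.
Qed.

(* Both sides are polynomials in [x] of degree less than [deg]; modulo each
   ['X - a] ^ nu a they are inverse to [z - 'X]. *)
Theorem hermite_partial_fractions z x : (forall a, z != (val a)%:C) -> z != x%:C ->
  (nodal nu z - nodal nu x%:C) / ((z - x%:C) * nodal nu z) =
  \sum_(a : A) \sum_(k < nu a) (hermite_basis nu a k x)%:C * k`!%:R * (z - (val a)%:C) ^- k.+1.
Proof.
move=> za zx.
pose HC := toC nodal_poly; pose h := nodal nu z.
have h0 : h != 0 by rewrite /h /nodal; apply/prodf_neq0 => c _; rewrite expf_neq0 // subr_eq0.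
have sHC : size HC = deg.+1 by rewrite size_map_poly size_nodal_poly.
have : root (h%:P - HC) z by rewrite /root hornerD hornerN hornerC /h nodalE subrr.
(* [q] is the quotient of [H(z) - H(X)] by [X - z]; divided by [- H(z)] it becomes [P], the kernel
   as a polynomial in [x]. *)
move=> /factor_theorem[q Eq].
pose P := - (h^-1 *: q).
pose Q := \sum_(a : A) \sum_(k < nu a) (k`!%:R * (z - (val a)%:C) ^- k.+1) *: toC (basis_poly a k).
have EP : (z%:P - 'X) * P = 1 - h^-1 *: HC.
  have -> : (z%:P - 'X) * P = h^-1 *: (q * ('X - z%:P)) by rewrite /P -!mul_polyC; ring.
  by rewrite -Eq scalerBr -mul_polyC -polyCM mulVf.
have f0 k : (k`!%:R : R[i]) != 0 by rewrite pnatr_eq0 -lt0n fact_gt0.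
have toCX a k :
  toC (('X - (val a)%:P) ^+ k) = ('X - (val a)%:C%:P) ^+ k by rewrite rmorphXn /= map_polyXsubC.
(* As [z != a], divisibility may be tested after multiplication by [z - 'X]. This turns [P] into 1
   modulo [HC]; the terms of [Q] at [a] are congruent to [G], a truncated inverse of [z - 'X], and
   the others vanish modulo the power. *)
have dP a : ('X - (val a)%:C%:P) ^+ nu a %| P - Q.
  have cop : coprimep (('X - (val a)%:C%:P) ^+ nu a) (z%:P - 'X).
    apply: coprimep_expl; rewrite coprimep_sym coprimep_XsubC /root hornerD hornerN hornerC hornerX.
    by rewrite subr_eq0.
  rewrite -(Gauss_dvdpr _ cop) mulrBr EP.
  rewrite /Q (bigD1 a) //= mulrDr.
  pose G := \sum_(k < nu a) ((z - (val a)%:C) ^- k.+1) *: ('X - (val a)%:C%:P) ^+ k.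
  set T := \sum_(k < nu a) _; set U := \sum_(c | c != a) _.
  have -> : 1 - h^-1 *: HC - ((z%:P - 'X) * T + (z%:P - 'X) * U) =
      (1 - (z%:P - 'X) * G) - h^-1 *: HC - (z%:P - 'X) * (T - G) - (z%:P - 'X) * U by ring.
  apply: dvdp_sub; [apply: dvdp_sub; [apply: dvdp_sub|]|].
  - by rewrite geometric_XsubC // subKr -mul_polyC dvdp_mulIr.
  - rewrite -mul_polyC; apply: dvdp_mull; rewrite /HC /nodal_poly (bigD1 a) //= rmorphM /= toCX.
    exact: dvdp_mulIl.
  - apply: dvdp_mull; rewrite /T /G -sumrB; elim/big_ind: _ => [|u v|k _]; first exact: dvdp0.
      exact: dvdp_add.
    have -> : (z - (val a)%:C) ^- k.+1 *: ('X - (val a)%:C%:P) ^+ k =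
      (k`!%:R * (z - (val a)%:C) ^- k.+1) *: toC (k`!%:R^-1 *: ('X - (val a)%:P) ^+ k).
      rewrite map_polyZ toCX scalerA /= fmorphV rmorph_nat; congr (_ *: _).
      by rewrite mulrAC mulfV // mul1r.
    rewrite -scalerBr -rmorphB -mul_polyC; apply: dvdp_mull; rewrite -toCX dvdp_map.
    by apply: dvdp_basis_self; exact: ltnW.
  - apply: dvdp_mull; rewrite /U; elim/big_ind: _ => [|u v|b ba]; [exact: dvdp0|exact: dvdp_add|].
    elim/big_ind: _ => [|u v|k _]; [exact: dvdp0|exact: dvdp_add|].
    by rewrite -mul_polyC; apply: dvdp_mull; rewrite -toCX dvdp_map dvdp_basis_other // eq_sym.
have PQ0 : P - Q = 0.
  apply/eqP; apply: contraT => nz.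
  (* The powers are pairwise coprime, so their product [HC], of size [deg.+1], divides [P - Q],
     whose size is at most [deg]. *)
  have : HC %| P - Q.
    rewrite /HC /nodal_poly rmorph_prod /=; apply: dvdp_prod_coprime; first exact: index_enum_uniq.
      move=> i j ij; rewrite !toCX; apply: coprimep_expl; apply: coprimep_expr.
      rewrite coprimep_XsubC root_XsubC; apply: contraNneq ij => /complexI /val_inj ->.
      by [].
    by move=> a; rewrite toCX.
  move=> /(dvdp_leq nz); rewrite sHC => big.
  have sq : (size q <= deg)%N.
    have [->|q0] := eqVneq q 0; first by rewrite size_poly0.
    have := congr1 (size : {poly R[i]} -> nat) Eq.
    rewrite size_Mmonic ?monicXsubC // size_XsubC addn2 /= => sE.
    rewrite -ltnS -sE; apply: leq_trans (size_polyD _ _) _;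
      rewrite size_polyN sHC geq_max leqnn andbT.
    by apply: leq_trans (size_polyC_leq1 _) _.
  have sP : (size P <= deg)%N by rewrite /P size_polyN; apply: leq_trans (size_scale_leq _ _) sq.
  have sQ : (size Q <= deg)%N.
    apply: leq_trans (size_sum _ _ _) _; apply/bigmax_leqP => a _.
    apply: leq_trans (size_sum _ _ _) _; apply/bigmax_leqP => k _.
    by apply: leq_trans (size_scale_leq _ _) _; rewrite size_map_poly size_basis_poly.
  have : (size (P - Q)%R <= deg)%N.
    by apply: leq_trans (size_polyD _ _) _; rewrite size_polyN geq_max sP sQ.
  by rewrite leqNgt big.
have /(congr1 (fun p => p.[x%:C])) : P = Q by apply/eqP; rewrite -subr_eq0 PQ0.
have -> : P.[x%:C] = (nodal nu z - nodal nu x%:C) / ((z - x%:C) * nodal nu z).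
  have := congr1 (fun p => p.[x%:C]) Eq; rewrite !hornerE /= -/h -nodalE => E.
  rewrite E; field.
  by rewrite h0 subr_eq0.
move=> ->; rewrite /Q horner_sum; apply: eq_bigr => a _; rewrite horner_sum; apply: eq_bigr => k _.
by rewrite hornerZ horner_map /= horner_basis_poly mulrC mulrA.
Qed.

End HermiteBasis.

(** * The error formula *)

Section ErrorFormula.
Context {R : realType}.

(** Positivity in [R[i]] includes being real; this converts the radii of balls into real ones. *)
Lemma gt0_complexE (e : R[i]) : 0 < e -> exists2 d : R, 0 < d & e = d%:C.
Proof.
move=> e0; exists (complex.Re e); move: e0; case: e => a b; rewrite ltcE /= => /andP[/eqP h a0] //.
by rewrite h.
Qed.

Lemma set_coord_line n (z : 'rV[R[i]]_n) j t : set_coord z j t = (t - z 0 j) *: delta_mx 0 j + z.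
Proof.
apply/rowP => i.
have E (u : 'rV[R[i]]_n) h : (h *: delta_mx 0 j + u) 0 i = h * (i == j)%:R + u 0 i by rewrite !mxE.
rewrite E mxE; case: eqVneq => [->|_]; first by rewrite mulr1 subrK.
by rewrite mulr0 add0r.
Qed.

(** The derivative along the [j]-th basis vector is the partial one, and continuity at [z] bounds
    [F] nearby. *)
Lemma holomorphic_on_sep_holo n (D : 'I_n -> set R[i]) (F : 'rV[R[i]]_n -> R[i]) :
  holomorphic_on (box D) F -> sep_holo D F.
Proof.
move=> hF; split=> [z j Dz|z Dz].
  have /cvg_ex[l] := diff_derivable (v := delta_mx 0 j) (hF z Dz).
  move=> /cvgrPdist_le hl; exists l => e e0.
  have eC : 0 < e%:C by rewrite ltcR.
  have := hl _ eC; rewrite near_withinE => /nbhs_ballP[d0 /= /gt0_complexE[d d_gt0 ->]] hd.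
  exists d => // t td; rewrite set_coord_id set_coord_line.
  have [->|tz] := eqVneq t (z 0 j).
    by rewrite subrr scale0r add0r subrr mulr0 subr0 normc0 mulr0.
  have tz0 : t - z 0 j != 0 by rewrite subr_eq0.
  have := hd (t - z 0 j); rewrite -ball_normE /= sub0r normrN => /(_ _ tz0).
  have h1 : (`|t - z 0 j| < d%:C)%R by rewrite -ltcR in td; exact: td.
  move=> /(_ h1).
  set X := F _ - F z => h2.
  have -> : X - l * (t - z 0 j) = - ((l - (t - z 0 j)^-1 * X) * (t - z 0 j)) by field.
  rewrite normc_opp normcM ler_wpM2r ?normc_ge0 //.
  by rewrite -lecR; exact: h2.
have /cvgrPdist_le/(_ 1 ltr01)/nbhs_ballP[d0 /= /gt0_complexE[d d_gt0 ->]] :=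
  differentiable_continuous (hF z Dz).
move=> hd; exists d, (normc (F z) + 1); split=> // w hw.
have : ball z d%:C w.
  split=> [|i j]; first by rewrite ltcR.
  rewrite ord1 -ball_normE /= distrC.
  have := hw j; rewrite -ltcR; exact.
move=> /hd h.
have -> : F w = F z - (F z - F w) by rewrite subKr.
apply: le_trans (ler_normcB _ _) _; rewrite lerD2l.
by rewrite -lecR; exact: h.
Qed.

(** The first product leaves the Cauchy kernel at [x]. The second is a product of one-variable
    kernels, each a sum by partial fractions; distributing yields the families [a] and [k]. *)
Lemma hermite_kernel n (A : 'I_n -> {fset R}) (nu : forall j, A j -> nat)
  (x : 'rV[R]_n) (z : 'rV[R[i]]_n) :
  (forall j (a : A j), z 0 j != (val a)%:C) -> (forall j, z 0 j != (x 0 j)%:C) ->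
  (\prod_r nodal (@nu r) (z 0 r) - \prod_r (nodal (@nu r) (z 0 r) - nodal (@nu r) (x 0 r)%:C)) /
    (\prod_r ((z 0 r - (x 0 r)%:C) * nodal (@nu r) (z 0 r))) =
  \prod_r (z 0 r - (x 0 r)%:C)^-1 -
  \sum_(a : {dffun forall j, A j}) \sum_(k : {dffun forall j, 'I_(nu j (a j))})
    \prod_r ((hermite_basis (@nu r) (a r) (k r) (x 0 r))%:C * (k r)`!%:R) *
    \prod_r (z 0 r - (val (a r))%:C) ^- (k r).+1.
Proof.
move=> za zx; rewrite mulrBl -!prodf_div; congr (_ - _).
  apply: eq_bigr => r _; rewrite invfM mulrCA mulfV ?mulr1 //.
  by apply/prodf_neq0 => a _; rewrite expf_neq0 // subr_eq0.
under eq_bigr => r _ do rewrite hermite_partial_fractions //.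
rewrite prod_sum_dffun; apply: eq_bigr => a _.
rewrite (prod_sum_dffun
  (fun r (k : 'I_(nu r (a r))) => (hermite_basis (@nu r) (a r) k (x 0 r))%:C * k`!%:R *
  (z 0 r - (val (a r))%:C) ^- k.+1)).
by apply: eq_bigr => k _; rewrite big_split.
Qed.

End ErrorFormula.

Theorem theorem3p2 (R : realType) (n : nat) (n_gt0 : (0 < n)%N)
  (D : 'I_n -> set R[i]) (hD : forall j, region (D j))
  (f : 'rV[R]_n -> R) (F : 'rV[R[i]]_n -> R[i])
  (hF : analytic_continuation (box D) f F)
  (A : 'I_n -> {fset R}) (nu : forall j, A j -> nat)
  (hnu : forall j (a : A j), (0 < nu j a)%N)
  (C : 'I_n -> R -> R[i])
  (hC : forall j, positive_simple_closed_contour (C j))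
  (hCD : forall j, trace (C j) `|` inside (C j) `<=` D j)
  (hAC : forall j (a : A j), inside (C j) (val a)%:C)
  (x : 'rV[R]_n) (hx : forall j, inside (C j) (x 0 j)%:C) :
  (f x - hermite_interpolant nu f x)%:C =
  (0 +i* (2 * pi)) ^- n *
  iterated_contour_integral C (fun z =>
    (\prod_r nodal (nu r) (z 0 r)
     - \prod_r (nodal (nu r) (z 0 r) - nodal (nu r) (x 0 r)%:C))
    / (\prod_r ((z 0 r - (x 0 r)%:C) * nodal (nu r) (z 0 r)))
    * F z).
Proof.
have cCD j : cauchy_domain (C j) (D j).
  have [_ oD _] := hD j; split.
  - exact: contour_piecewise_C1 (hC j).
  - exact: contour_closed (hC j).
  - exact/open_copen.
  - exact: contour_in_domain (hCD j).
  - exact: winding_off_domain (hC j) (hCD j).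
have enc j w : inside (C j) w -> encircled (C j) (D j) w.
  move=> h; split; [exact: inside_in_domain (hCD j) _ h|exact: inside_off_trace h|].
  exact: winding_inside (hC j) _ h.
have oD j : copen (D j) by have [] := cCD j.
have [hol Ff] := hF.
have sF := holomorphic_on_sep_holo hol.
pose B (a : {dffun forall j, A j}) (k : {dffun forall j, 'I_(nu j (a j))}) : R[i] :=
  \prod_r ((hermite_basis (nu r) (a r) (k r) (x 0 r))%:C * (k r)`!%:R).
(* [None] is the Cauchy kernel at [x]; [Some (a, k)] is a term of the interpolant. *)
pose S := option {a : {dffun forall j, A j} & {dffun forall j, 'I_(nu j (a j))}}.
pose c (s : S) := if s is Some (existT a k) then - B a k else 1.
pose p (s : S) : 'rV[R]_n := if s is Some (existT a k) then \row_j val (a j) else x.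
pose m (s : S) (j : 'I_n) : nat := if s is Some (existT a k) then k j else 0%N.
have inp s j : inside (C j) ((p s) 0 j)%:C.
  by case: s => [[a k]|] /=; [rewrite mxE; exact: hAC|exact: hx].
have embE (y : 'rV[R]_n) j : embedC y 0 j = (y 0 j)%:C by rewrite mxE.
have boxp s : box D (embedC (p s)) by move=> j; rewrite embE; have [] := enc j _ (inp s j).
pose s0 : seq S := None :: [seq Some s | s <- index_enum _].
have sumE (V : zmodType) (G : S -> V) : \sum_(s <- s0) G s =
    G None + \sum_(a : {dffun forall j, A j}) \sum_(k : {dffun forall j, 'I_(nu j (a j))}) G
      (Some (existT _ a k)).
  rewrite big_cons big_map sig_big_dep /=; congr (_ + _).
  by apply: eq_bigr => -[].
(* Only values on the contours matter. These avoid the nodes and the coordinates of [x], which lie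
   inside, so [hermite_kernel] applies. *)
rewrite (@eq_iterated_contour_integral _ _ _ _ (fun z =>
    \sum_(s <- s0) c s * (\prod_r (z 0 r - embedC (p s) 0 r) ^- (m s r).+1) * F z)); last first.
  move=> z hz; rewrite hermite_kernel.
  - rewrite sumE mulrBl mul1r -mulNr; congr (_ * _ + _).
      by apply: eq_bigr => r _; rewrite embE expr1.
    rewrite -sumrN mulr_suml; apply: eq_bigr => a _.
    rewrite -sumrN mulr_suml; apply: eq_bigr => k _.
    by rewrite -mulNr; congr (_ * _ * _); apply: eq_bigr => r _; rewrite embE mxE.
  - move=> j a; have [t t01 <-] := hz j; exact: inside_off_trace (hAC j a) _ t01.
  - move=> j; have [t t01 <-] := hz j; exact: inside_off_trace (hx j) _ t01.
rewrite (iterated_cauchy (D := D)) //; last by move=> s j; rewrite embE; exact: enc.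
rewrite mulKf ?expf_neq0 ?two_pi_i_neq0 //.
under eq_bigr => s _ do rewrite (cmixed_real _ oD sF Ff (boxp s)).
rewrite sumE /= mul1r.
(* The term [None] has order 0 in every variable and contributes [f x]. *)
have -> : mixed_partial (fun=> 0%N) f x = f x by rewrite /mixed_partial; elim: (enum _).
rewrite big1 ?divr1 // (rmorphB (real_complex R)); congr (_ + _).
rewrite /hermite_interpolant (rmorph_sum (real_complex R)) -sumrN; apply: eq_bigr => a _.
rewrite (rmorph_sum (real_complex R)) -sumrN; apply: eq_bigr => k _.
rewrite (rmorphM (real_complex R)) (rmorph_prod (real_complex R)) mulNr; congr (- _).
(* The factorials that the partial fractions put into [B] cancel the denominators of Cauchy's
   formula. *)
rewrite /B big_split /= mulrC; set b := \prod_r _%:C; set q := \prod_r _%:R.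
rewrite -mulrA [q * _]mulrC divfK //.
by apply/prodf_neq0 => r _; rewrite pnatr_eq0 -lt0n fact_gt0.
Qed.
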